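(* Let $N$ be a linear graphon Hawkes process on $\mathscr X=[\boldsymbol a,\boldsymbol b]\subset\mathbb R^m$ with parameters $\lambda_\infty,h,W,B$ satisfying all assumptions listed in the context, and suppose it is stable, i.e. $\int_{\mathscr X}\lambda_\infty(x)\,\mathrm dx<\infty$ and $\rho(T_{\mathrm{hom}})<1$. Let $\tilde N^d$, $d\in\mathbb N$, be its approximating processes with parameters $\tilde\lambda^d_\infty,\tilde W^d,\tilde B^d$ averaged over the partitions $\mathcal P^d$, with corresponding operators $\tilde T^{(d)}_{\mathrm{hom}}$. Let $\delta:=\tfrac12(1-\rho(T_{\mathrm{hom}}))$. (1) There is $D'\in\mathbb N$ such that for all $d\ge D'$ the process $\tilde N^d$ satisfies the stability conditions as well, i.e. $\int_{\mathscr X}\tilde\lambda^d_\infty(x)\,\mathrm dx<\infty$ and $\rho(\tilde T^{(d)}_{\mathrm{hom}})<1$, with in fact $\rho(\tilde T^{(d)}_{\mathrm{hom}})\le\rho(T_{\mathrm{hom}})+\delta<1$. (2) There is $D\in\mathbb N$ such that the expected cluster size $\mathbb E[Z^d_x]$ for $\tilde N^d$ of a particle in $x$ is bounded uniformly over $x\in\mathscr X$ and $d\ge D$, i.e. there is $\mathfrak K<\infty$ with $\mathbb E[Z_x^d]\le\mathfrak K$ for all $x\in\mathscr X$, $d\ge D$.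
   Context: Parameters and assumptions. $\mathscr X=[\boldsymbol a,\boldsymbol b]=\prod_{i=1}^m[a_i,b_i]\subset\mathbb R^m$ is a nondegenerate hyperrectangle with Lebesgue measure $\mathrm{Leb}^m$. $\lambda_\infty:\mathscr X\to\mathbb R_+$ is in $L^1(\mathscr X)\cap L^\infty(\mathscr X)$ with $\|\lambda_\infty\|_{\mathrm{TV}(\mathscr X)}<\infty$; $h:\mathbb R_+\to\mathbb R_+$ is in $L^1(\mathbb R_+)$; $W:\mathscr X^2\to\mathbb R_+$ is measurable with $W(x,y)\le C_W$ for all $x,y$, and $W(\cdot,y)$ of bounded variation for all $y\in\mathscr X$ with $\sup_y\|W(\cdot,y)\|_{\mathrm{TV}(\mathscr X)}<\infty$; $B=(B_{xy})$ is a nonnegative stochastic process on $\mathscr X^2$, separable with respect to the open subsets of $\mathscr X^2$, with $\mathbb E[B_{xy}]\le C_B$ for all $x,y$, with $B_{\cdot y}$ a.s. of bounded variation for a.a. $y$ and $\sup_y\mathbb E\|B_{\cdot y}\|_{\mathrm{TV}(\mathscr X)}<\infty$. There are conjugate exponents $p,q\in[1,\infty]$ with $W(\cdot,y)\in L^p(\mathscr X)$, $\mathbb E[B_{\cdot y}]\in L^q(\mathscr X)$ for a.e. $y$. Here the total variation of $f$ is $\sup\{\int \mathrm{div}(\Phi)f\,\mathrm dx:\Phi\in C^1_c(\Omega,\mathbb R^m),\|\Phi\|_{L^\infty}\le1\}$ with $\Omega$ the interior of $\mathscr X$. Linear graphon Hawkes process: the marked point process of events $(s,y)$ (time $s$,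 location $y\in\mathscr X$), each carrying an independent realization $B(s)$ of $B$, with conditional intensity density (events occur in $\mathrm dt\times\mathrm dx$ at rate $\lambda_t(x)\,\mathrm dt\,\mathrm dx$ given the past) $\lambda_t(x)=\lambda_\infty(x)+\sum_{(s,y)\in N,s<t}B_{xy}(s)W(x,y)h(t-s)$. Operator. $T_{\mathrm{hom}}:L^1(\mathscr X)\to L^1(\mathscr X)$, $(T_{\mathrm{hom}}f)(x)=\|h\|_{L^1(\mathbb R_+)}\int_{\mathscr X}\mathbb E[B_{xy}]W(x,y)f(y)\,\mathrm dy$; $\rho$ denotes the spectral radius on $L^1(\mathscr X)$. Partitions and averaged process. $(\mathcal P^d)_{d\in\mathbb N}$ are partitions of $\mathscr X$ into $d$ hyperrectangles $\mathscr X^d_1,\dots,\mathscr X^d_d$, with $\mathrm{mesh}(\mathcal P^d):=\max_n\mathrm{diam}(\mathscr X^d_n)\to0$ monotonically as $d\to\infty$. $\tilde\lambda^d_\infty$ is the function constant on each $\mathscr X^d_i$, equal there to the average of $\lambda_\infty$ over $\mathscr X^d_i$; $\tilde W^d$ and $\tilde B^d(s)$ are constant on each $\mathscr X^d_i\times\mathscr X^d_j$, equal there to the averages of $W$ and of the realization $B(s)$ over $\mathscr X^d_i\times\mathscr X^d_j$. $\tilde N^d$ is the linear graphon Hawkes process with parameters $\tilde\lambda^d_\infty,h,\tilde W^d,\tilde B^d$, and $(\tilde T^{(d)}_{\mathrm{hom}}f)(x)=\|h\|_{L^1}\int_{\mathscr X}\mathbb E[\tilde B^d_{xy}]\tilde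 W^d(x,y)f(y)\,\mathrm dy$. Cluster. The cluster for $\tilde N^d$ of a particle in $x$ is the branching process started from one event at location $x$ at time $0$, in which each event at time $s$ and location $y$, with its own independent mark realization $\tilde B^d(s)$, produces children according to a Poisson process on $[s,\infty)\times\mathscr X$ with intensity $\tilde B^d_{zy}(s)\tilde W^d(z,y)h(t-s)\,\mathrm dt\,\mathrm dz$; $Z^d_x$ is the total number of events in the cluster. *)

(* Defs.v *)
From HB Require Import structures.
From mathcomp Require Import all_boot all_order all_algebra.
From mathcomp Require Import all_classical all_reals all_analysis.
From mathcomp Require Import complex.

Set Implicit Arguments.
Unset Strict Implicit.
Unset Printing Implicit Defensive.

Import Order.TTheory GRing.Theory Num.Theory.
Import numFieldTopology.Exports numFieldNormedType.Exports.

Local Open Scope classical_set_scope.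
Local Open Scope ring_scope.

(* Row vectors carry the product sigma-algebra, generated by the coordinate
   maps (for entries in R this is the Borel sigma-algebra of R^n). *)
Definition row_display : measure_display -> measure_display.
Proof. exact. Qed.

Section measurable_row.
Context {d} {T : sigmaRingType d}.
Variable n : nat.

Let coord : 'I_n -> 'rV[T]_n -> T := fun i v => v ord0 i.

Let row_set0 : g_sigma_preimage coord set0.
Proof. exact: sigma_algebra0. Qed.

Let row_setC A : g_sigma_preimage coord A -> g_sigma_preimage coord (~` A).
Proof. exact: sigma_algebraC. Qed.

Let row_bigcup (F : _^nat) : (forall i, g_sigma_preimage coord (F i)) ->
  g_sigma_preimage coord (\bigcup_i (F i)).
Proof. exact: sigma_algebra_bigcup. Qed.

HB.instance Definition _ := @isMeasurable.Build (row_display d)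
  'rV[T]_n (g_sigma_preimage coord) row_set0 row_setC row_bigcup.

End measurable_row.

Lemma measurable_coord d (T : sigmaRingType d) n (i : 'I_n) :
  measurable_fun [set: 'rV[T]_n] (fun v : 'rV[T]_n => v ord0 i).
Proof.
move=> _ Y mY; rewrite setTI; apply: sub_sigma_algebra => /=.
rewrite -bigcup_seq/=; exists i => /=; first by rewrite mem_index_enum.
by exists Y => //; rewrite setTI.
Qed.

Lemma measurable_fun_rowP d1 d2 (T1 : measurableType d1)
    (T2 : measurableType d2) n (f : T1 -> 'rV[T2]_n) :
  (forall i, measurable_fun [set: T1] (fun x => f x ord0 i)) ->
  measurable_fun [set: T1] f.
Proof.
move=> mf _ A mA; rewrite setTI.
pose G := image_set_system setT f (@measurable _ T1).
have sG : sigma_algebra setT G.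
  exact: sigma_algebra_image (sigma_algebra_measurable _).
suff : @measurable _ 'rV[T2]_n `<=` G.
  by move=> /(_ _ mA); rewrite /G /image_set_system/= setTI.
apply: smallest_sub => // B; rewrite -bigcup_seq/= => -[i _ [C mC <-]].
rewrite /G /image_set_system/= !setTI.
by have := mf i measurableT _ mC; rewrite setTI.
Qed.

Definition row_cons (T : Type) n (p : T * 'rV[T]_n) : 'rV[T]_n.+1 :=
  \row_i (if unlift ord0 i is Some j then p.2 ord0 j else p.1).

Definition row_uncons (T : Type) n (v : 'rV[T]_n.+1) : T * 'rV[T]_n :=
  (v ord0 ord0, \row_i v ord0 (lift ord0 i)).

Lemma row_unconsK (T : Type) n : cancel (@row_cons T n) (@row_uncons T n).
Proof.
move=> [a v]; rewrite /row_cons /row_uncons mxE unlift_none; congr pair.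
by apply/rowP => i; rewrite !mxE liftK.
Qed.

Lemma measurable_row_cons d (T : measurableType d) n :
  measurable_fun [set: T * 'rV[T]_n] (@row_cons T n).
Proof.
apply: measurable_fun_rowP => i; case: (unliftP ord0 i) => [j|] ->.
- rewrite (_ : (fun _ => _) = (fun v : 'rV[T]_n => v ord0 j) \o snd).
    by apply: measurableT_comp => //; exact: measurable_coord.
  by apply/funext => x; rewrite mxE liftK.
- rewrite (_ : (fun _ => _) = fst) //.
  by apply/funext => x; rewrite mxE unlift_none.
Qed.

Lemma measurable_row_uncons d (T : measurableType d) n :
  measurable_fun [set: 'rV[T]_n.+1] (@row_uncons T n).
Proof.
apply: measurable_fun_pair; first exact: measurable_coord.
apply: measurable_fun_rowP => i.
rewrite (_ : (fun _ => _) = (fun v : 'rV[T]_n.+1 => v ord0 (lift ord0 i))).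
  exact: measurable_coord.
by apply/funext => v; rewrite mxE.
Qed.

Section lebesgue_row_step.
Variables (R : realType) (n : nat).
Variable mu : {sigma_finite_measure set 'rV[R]_n -> \bar R}.

Definition lebesgue_row_step : set 'rV[R]_n.+1 -> \bar R :=
  pushforward (@lebesgue_measure R \x mu)%E
    (@row_cons R n : measurableTypeR R * 'rV[R]_n -> 'rV[R]_n.+1).

Let step0 : lebesgue_row_step set0 = 0%E.
Proof. by rewrite /lebesgue_row_step /pushforward preimage_set0 measure0. Qed.

Let step_ge0 A : (0 <= lebesgue_row_step A)%E.
Proof. exact: (measure_ge0 (@lebesgue_measure R \x mu)%E). Qed.

Let step_sigma_additive : semi_sigma_additive lebesgue_row_step.
Proof.
have mcons : measurable_fun setT
  (@row_cons R n : measurableTypeR R * 'rV[R]_n -> 'rV[R]_n.+1).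
  exact: measurable_row_cons.
move=> F mF tF mUF; rewrite /lebesgue_row_step /pushforward preimage_bigcup.
apply: measure_semi_sigma_additive.
- by move=> i; rewrite -[X in measurable X]setTI; exact: mcons.
- apply/trivIsetP => /= i j _ _ ij; rewrite -preimage_setI.
  by move/trivIsetP : tF => /(_ _ _ _ _ ij) ->//; rewrite preimage_set0.
- by rewrite -preimage_bigcup -[X in measurable X]setTI; exact: mcons.
Qed.

HB.instance Definition _ := isMeasure.Build _ _ _
  lebesgue_row_step step0 step_ge0 step_sigma_additive.

Let step_sigma_finite : sigma_finite setT lebesgue_row_step.
Proof.
have /sigma_finiteP[F [FT ndF mF]] := sigma_finiteT (@lebesgue_measure R).
have /sigma_finiteP[G [GT ndG mG]] := sigma_finiteT mu.
exists (fun k => @row_uncons R n @^-1` (F k `*` G k)).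
  rewrite -preimage_bigcup (_ : \bigcup_k _ = setT) ?preimage_setT//.
  rewrite -subTset -setXTT FT GT => -[x y] [/= [i _ Fix] [j _ Gjy]].
  exists (maxn i j) => //; split => /=.
  - by move: x Fix; exact/subsetPset/ndF/leq_maxl.
  - by move: y Gjy; exact/subsetPset/ndG/leq_maxr.
move=> k; have [mFk Fk] := mF k; have [mGk Gk] := mG k; split.
  rewrite -[X in measurable X]setTI; apply: measurable_row_uncons => //.
  exact: measurableX.
rewrite /lebesgue_row_step /pushforward -comp_preimage.
rewrite (_ : _ \o _ = id) ?preimage_id.
  by rewrite product_measure1E// lte_mul_pinfty// ge0_fin_numE.
by apply/funext => p; exact: row_unconsK.
Qed.

HB.instance Definition _ := Measure_isSigmaFinite.Build _ _ _ lebesgue_row_step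
  step_sigma_finite.

End lebesgue_row_step.

(* Lebesgue measure on R^n, as an n-fold product of one-dimensional ones. *)
Fixpoint lebm (R : realType) (n : nat) :
    {sigma_finite_measure set 'rV[R]_n -> \bar R} :=
  if n is k.+1 return {sigma_finite_measure set 'rV[R]_n -> \bar R}
  then lebesgue_row_step (lebm R k) else \d_(0 : 'rV[R]_0).

Section geometry.
Variables (R : realType) (m : nat).
Local Notation E := 'rV[R]_m.

Definition box (a b : E) : set E :=
  [set x | forall k, a ord0 k <= x ord0 k <= b ord0 k].

(* Each side is a bounded interval with distinct endpoints, which may be open,
   closed or half-open: cells of a partition cannot all be closed. *)
Definition hyperrectangle (A : set E) : Prop :=
  exists2 I : 'I_m -> interval R,
    forall k, exists (l r : bool) (u v : R),
      I k = Interval (BSide l u) (BSide r v) /\ u < v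
    & A = [set x | forall k, x ord0 k \in I k].

(* The library norm on row vectors is the max norm. *)
Definition eucl (v : E) : R := Num.sqrt (\sum_k v ord0 k ^+ 2).

Definition diam (A : set E) : R := sup [set eucl (p.1 - p.2) | p in A `*` A].

Definition mesh d (P : 'I_d -> set E) : R := \big[Num.max/0]_i diam (P i).

(* P d is the partition into d cells; P 0 is unconstrained. *)
Record hyperrect_partitions (X : set E) (P : forall d, 'I_d -> set E) : Prop := {
  cell_hyperrect : forall d (i : 'I_d), hyperrectangle (P d i) ;
  cell_disjoint : forall d, trivIset setT (P d) ;
  cell_cover : forall d, (0 < d)%N -> \bigcup_i P d i = X ;
  mesh_nonincreasing : forall d d', (0 < d <= d')%N -> mesh (P d') <= mesh (P d) ;
  mesh_cvg0 : mesh (P d) @[d --> \oo] --> (0 : R)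
}.

Definition divergence (Phi : E -> E) (x : E) : R :=
  \sum_k ('D_(delta_mx ord0 k) Phi x) ord0 k.

(* C^1_c(Omega, R^m), a field on Omega being extended by 0 to the whole space. *)
Definition C1c (Omega : set E) (Phi : E -> E) : Prop :=
  let supp := closure [set x | Phi x != 0] in
  [/\ forall k x, derivable Phi x (delta_mx ord0 k),
      forall k, continuous ('D_(delta_mx ord0 k) Phi),
      compact supp & supp `<=` Omega].

Definition total_variation (Omega : set E) (f : E -> R) : \bar R :=
  ereal_sup [set (\int[lebm R m]_(x in Omega) (divergence Phi x * f x)%:E)%E
    | Phi in [set Phi | C1c Omega Phi /\
                        (Lnorm (lebm R m) +oo (EFin \o eucl \o Phi) <= 1)%E]].

Definition bounded_variation (X : set E) (f : E -> R) : Prop :=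
  (lebm R m).-integrable X (EFin \o f) /\ (total_variation X° f < +oo)%E.

Definition in_Lp (X : set E) (p : \bar R) (f : E -> R) : Prop :=
  measurable_fun X f /\
  (Lnorm (lebm R m) p (fun x => (\1_X x * f x)%:E) < +oo)%E.

End geometry.

(* Spectral radius of a real operator T on L^1(X), whose elements are
   represented by functions modulo a.e. equality on X: the supremum of |z| over
   the spectrum of the complexification of T on L^1(X; C). *)
Section spectral_radius.
Variables (R : realType) (m : nat).
Local Notation E := 'rV[R]_m.
Local Notation C := (complex R).
Local Notation mu := (lebm R m).
Variables (X : set E) (T : (E -> R) -> (E -> R)).

Definition in_L1C (f : E -> C) : Prop :=
  mu.-integrable X (EFin \o (@complex.Re R \o f)) /\
  mu.-integrable X (EFin \o (@complex.Im R \o f)).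

Definition normL1C (f : E -> C) : \bar R :=
  (\int[mu]_(x in X) (ComplexField.Normc.normc (f x))%:E)%E.

Definition complexify (f : E -> C) (x : E) : C :=
  Complex (T (@complex.Re R \o f) x) (T (@complex.Im R \o f) x).

Definition resolvent_set : set C := [set z |
  (exists c : R, forall g, in_L1C g -> exists f,
    [/\ in_L1C f,
        {ae mu, forall x, X x -> z * f x - complexify f x = g x}
      & (normL1C f <= c%:E * normL1C g)%E]) /\
  (forall f, in_L1C f ->
    {ae mu, forall x, X x -> z * f x - complexify f x = 0} ->
    {ae mu, forall x, X x -> f x = 0})].

Definition spectrum : set C := ~` resolvent_set.

Definition spectral_radius : \bar R :=
  ereal_sup [set (ComplexField.Normc.normc z)%:E | z in spectrum].

End spectral_radius.

(* The marks live on a probability space (M, Q), on which the process B is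
   defined: an event with mark w carries the realization B w of B, so that
   marks with law Q carry independent copies of B. *)
Record hawkes_param (R : realType) (m : nat) (M : Type) := HawkesParam {
  base : 'rV[R]_m -> R ;
  exc : R -> R ;
  weight : 'rV[R]_m -> 'rV[R]_m -> R ;
  impact : M -> 'rV[R]_m -> 'rV[R]_m -> R }.

Section parameters.
Variables (R : realType) (m : nat).
Context (dM : measure_display) (M : measurableType dM) (Q : probability M R).
Local Notation E := 'rV[R]_m.
Local Notation mu := (lebm R m).
Implicit Types (X : set E) (th : hawkes_param R m M).

Definition mean_impact th (x y : E) : \bar R :=
  ('E_Q[fun w => impact th w x y])%E.

(* Doob separability with respect to the (relatively) open subsets of X x X. *)
Definition separable_process X (B : M -> E -> E -> R) : Prop :=
  exists S : set (E * E),
    [/\ countable S, S `<=` X `*` X, X `*` X `<=` closure S &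
     exists2 N : set M, Q.-negligible N &
       forall (U : set (E * E)) (F : set R) w, open U -> closed F -> ~ N w ->
         (forall z, (S `&` U) z -> F (B w z.1 z.2)) ->
         (forall z, (X `*` X `&` U) z -> F (B w z.1 z.2))].

Record graphon_assumptions X th : Prop := {
  base_ge0 : forall x, X x -> 0 <= base th x ;
  base_L1 : in_Lp X 1 (base th) ;
  base_Loo : in_Lp X +oo (base th) ;
  base_TV : (total_variation X° (base th) < +oo)%E ;
  exc_ge0 : forall t, 0 <= t -> 0 <= exc th t ;
  exc_L1 : lebesgue_measure.-integrable `[0, +oo[ (EFin \o exc th) ;
  weight_ge0 : forall x y, X x -> X y -> 0 <= weight th x y ;
  weight_measurable :
    measurable_fun (X `*` X) (fun z => weight th z.1 z.2) ;
  weight_bounded : exists CW, forall x y, X x -> X y -> weight th x y <= CW ;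
  weight_BV : forall y, X y -> bounded_variation X (weight th ^~ y) ;
  weight_TV : exists c : R, forall y, X y ->
    (total_variation X° (weight th ^~ y) <= c%:E)%E ;
  impact_ge0 : forall w x y, X x -> X y -> 0 <= impact th w x y ;
  impact_measurable : measurable_fun (setT `*` (X `*` X))
    (fun z : M * (E * E) => impact th z.1 z.2.1 z.2.2) ;
  impact_separable : separable_process X (impact th) ;
  impact_bounded : exists CB : R, forall x y, X x -> X y ->
    (mean_impact th x y <= CB%:E)%E ;
  impact_BV : {ae mu, forall y, X y ->
    {ae Q, forall w, bounded_variation X (impact th w ^~ y)}} ;
  impact_TV : exists c : R, forall y, X y ->
    (\int[Q]_w total_variation X° (impact th w ^~ y) <= c%:E)%E ;
  conjugate_exponents : exists p q : \bar R,
    [/\ (1 <= p)%E, (1 <= q)%E, (p^-1 + q^-1 = 1)%E &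
      {ae mu, forall y, X y -> in_Lp X p (weight th ^~ y) /\
                               in_Lp X q (fun x => fine (mean_impact th x y))}]
}.

Definition normL1_exc th : R :=
  \int[lebesgue_measure]_(t in `[0, +oo[) `|exc th t|.

Definition Thom X th (f : E -> R) (x : E) : R :=
  normL1_exc th *
  \int[mu]_(y in X) (fine (mean_impact th x y) * weight th x y * f y).

Definition rho_hom X th : \bar R := spectral_radius X (Thom X th).

Definition stable X th : Prop :=
  (\int[mu]_(x in X) (base th x)%:E < +oo)%E /\ (rho_hom X th < 1)%E.

End parameters.

Section averaging.
Variables (R : realType) (m : nat).
Local Notation E := 'rV[R]_m.
Local Notation mu := (lebm R m).

Definition average d (T : measurableType d) (nu : {measure set T -> \bar R})
    (A : set T) (f : T -> R) : R :=
  Rintegral nu A f / fine (nu A).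

Variables (d : nat) (P : 'I_d -> set E).

Definition step1 (f : E -> R) (x : E) : R :=
  \sum_i \1_(P i) x * average mu (P i) f.

Definition step2 (f : E -> E -> R) (x y : E) : R :=
  \sum_i \sum_j \1_(P i) x * \1_(P j) y *
    average (mu \x mu)%E (P i `*` P j) (fun z => f z.1 z.2).

Definition averaged (M : Type) (th : hawkes_param R m M) : hawkes_param R m M :=
  {| base := step1 (base th) ;
     exc := exc th ;
     weight := step2 (weight th) ;
     impact := fun w => step2 (impact th w) |}.

End averaging.

(* A random countable family of points of T: label i yields the point pt i w
   when w belongs to occurs i, and no point otherwise. *)
Record labelled_points dO (O : measurableType dO) dT (T : measurableType dT)
    (I : Type) := LabelledPoints {
  occurs : I -> set O ;
  pt : I -> O -> T ;
  measurable_occurs : forall i, measurable (occurs i) ;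
  measurable_pt : forall i, measurable_fun (occurs i) (pt i) }.

Definition count_in (R : realType) dO (O : measurableType dO) dT
    (T : measurableType dT) (I : choiceType) (N : labelled_points O T I)
    (J : set I) (A : set T) (w : O) : \bar R :=
  (\esum_(i in [set i | [/\ J i, occurs N i w & A (pt N i w)]]) 1)%E.

(* ((time, location), mark) *)
Notation hawkes_event R m M := (measurableTypeR R * 'rV[R]_m * M)%type.

Section processes.
Variables (R : realType) (m : nat).
Context (dM : measure_display) (M : measurableType dM) (Q : probability M R).
Local Notation E := 'rV[R]_m.
Local Notation mu := (lebm R m).
Local Notation leb := (@lebesgue_measure R).

Local Notation eventT := (hawkes_event R m M).

Variables (X : set E) (th : hawkes_param R m M).

Section hawkes.
Context (dO : measure_display) (O : measurableType dO) (P : probability O R).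
Variable N : labelled_points O eventT nat.

Definition cond_intensity (t : R) (x : E) (w : O) : \bar R :=
  ((base th x)%:E +
   \esum_(i in [set i | occurs N i w /\ ((pt N i w).1.1 < t)%R])
     (let: ((s, y), b) := pt N i w in
      impact th b x y * weight th x y * exc th (t - s))%:E)%E.

Definition history (s : R) : set (set O) :=
  <<s [set H | exists (A : set eventT) (k : nat),
         [/\ measurable A, A `<=` [set e | e.1.1 <= s] &
             H = [set w | count_in R N setT A w = k%:R%:E]]] >>.

(* Started at time 0 with empty past. The last clause says that, given the
   past, events occur in dt x dx with mark in db at rate
   cond_intensity t x dt dx Q(db). *)
Record hawkes_process : Prop := {
  hawkes_support : forall i w, occurs N i w ->
    0 < (pt N i w).1.1 /\ X (pt N i w).1.2 ;
  hawkes_locally_finite : forall t : R, {ae P, forall w,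
    (count_in R N setT [set e | e.1.1 <= t]%R w < +oo)%E} ;
  hawkes_intensity : forall (s t : R) (H : set O) (A : set E) (C : set M),
    0 <= s -> s < t -> history s H -> measurable A -> A `<=` X ->
    measurable C ->
    (\int[P]_(w in H) count_in R N setT ([set` `]s, t]] `*` A `*` C) w =
     (\int[P]_(w in H) \int[leb \x mu]_(z in [set` `]s, t]] `*` A)
        cond_intensity z.1 z.2 w) * Q C)%E
}.

End hawkes.

(* Intensity measure of the marked offspring process of an event e: a Poisson
   process on [s, oo) x X whose points receive independent marks of law Q is a
   Poisson process on [s, oo) x X x M with the product intensity. *)
Definition offspring_intensity (e : eventT) (A : set eventT) : \bar R :=
  let: ((s, y), b) := e in
  (\int[(leb \x mu) \x Q]_(e' in A `&` [set e' | (s <= e'.1.1)%R /\ X e'.1.2])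
     (impact th b e'.1.2 y * weight th e'.1.2 y * exc th (e'.1.1 - s))%:E)%E.

(* Poisson point masses for a mean in [0, +oo]; with mean +oo the count is
   almost surely infinite. *)
Definition poisson_mass (r : \bar R) (k : nat) : \bar R :=
  if r is r'%:E then poisson_prob r' 0 [set k] else 0%E.

Section cluster.
Context (dO : measure_display) (O : measurableType dO) (P : probability O R).
(* Events are labelled by finite words: [::] is the initial event and the
   labels of the children of u are the words rcons u k. *)
Variable N : labelled_points O eventT (seq nat).

Definition children (u : seq nat) : set (seq nat) := [set rcons u k | k in setT].

Definition gen_history (n : nat) : set (set O) :=
  <<s [set H | exists (u : seq nat) (A : set eventT),
         [/\ (size u <= n)%N, measurable A &
             H = occurs N u `&` pt N u @^-1` A]] >>.

(* cluster_branching: given the first n generations, the offspring processes of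
   the events of generation n are independent Poisson processes. *)
Record branching_cluster (x : E) : Prop := {
  cluster_root : occurs N [::] = setT ;
  cluster_root_pos : forall w, (pt N [::] w).1 = (0, x) ;
  cluster_root_mark : forall C, measurable C ->
    P ((fun w => (pt N [::] w).2) @^-1` C) = Q C ;
  cluster_branching : forall (n r : nat) (H : set O) (u : 'I_r -> seq nat)
      (A : 'I_r -> set eventT) (k : 'I_r -> nat),
    gen_history n H -> (forall i, size (u i) = n) ->
    (forall i, measurable (A i)) ->
    (forall i j, i != j -> u i = u j -> A i `&` A j = set0) ->
    P (H `&` \bigcap_i
        [set w | count_in R N (children (u i)) (A i) w = (k i)%:R%:E]) =
    (\int[P]_(w in H) \big[mule/1]_(i < r)
       poisson_mass ((\1_(occurs N (u i)) w)%:E *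
                     offspring_intensity (pt N (u i) w) (A i)) (k i))%E
}.

Definition cluster_size (w : O) : \bar R := count_in R N setT setT w.

End cluster.
End processes.

(* Main.v *)
(* Let a_n be the integral of T^n 1. Since T is positive, bounds on its resolvent
   on the real half-line above rho(T) force a_n <= A q^n for every q > rho(T). The
   averaged kernels converge in L^1 and a_{n+p+1} <= C a_n a_p, so the bound
   passes, with a slightly larger rate r < 1, to the averaged operators, uniformly
   in d. These have finite rank and act on step functions through nonnegative
   matrices whose powers are controlled by a_n, whence their spectral radii are at
   most r. The marks being independent of the locations, the expected number of
   cluster events of generation n in a given cell satisfies the recursion of the
   same matrices, so the expected cluster sizes are bounded by a geometric
   series. *)

Require Import Defs.
From HB Require Import structures.
From mathcomp Require Import all_boot all_order all_algebra.
From mathcomp Require Import all_classical all_reals all_analysis.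
From mathcomp Require Import complex measurable_realfun ring lra.

Set Implicit Arguments.
Unset Strict Implicit.
Unset Printing Implicit Defensive.

Import Order.TTheory GRing.Theory Num.Theory.
Import numFieldTopology.Exports numFieldNormedType.Exports.

Local Open Scope classical_set_scope.
Local Open Scope ring_scope.

(** * Growth of the iterates of a bounded kernel *)

(** Averaging makes the kernels converge in L^1 of X * X, which does not imply convergence of the
    operators in the norm of L^1(X), so resolvents cannot simply be perturbed. The masses a_n are
    the substitute: each of them is continuous in the kernel for the L^1 distance. Since the kernels
    are bounded, T maps L^1 into bounded functions, and a bound on a mass becomes a pointwise bound
    at the cost of one step; this is the source of the index n + p + 1 and of the separate treatment
    of n = 0. The same step deals with the initial particle: a point mass is not in L^1, but its
    first generation has a bounded density, which makes the cluster bound uniform in x. Growth of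
    a_n is drawn from the resolvent without functional calculus, by lowering an admissible growth
    rate along the real axis. Convergence of the averages is a density argument and not a martingale
    one, because successive partitions need not be nested. *)

Section series_bounds.
Context {R : realType}.
Implicit Types (u : nat -> R) (A r : R).

Lemma sum_geometric_le r n : 0 <= r < 1 -> \sum_(i < n) r ^+ i <= (1 - r)^-1.
Proof.
move=> /andP[r0 r1]; have r1' : 0 < 1 - r by rewrite subr_gt0.
have := @subrX1 R r n; have := exprn_ge0 n r0 => rn0 E.
by rewrite -[leRHS]mul1r ler_pdivlMr//; lra.
Qed.

Lemma nneseries_geometric_le u A r : 0 <= r < 1 -> 0 <= A ->
  (forall n, 0 <= u n <= A * r ^+ n) ->
  (\sum_(n <oo) (u n)%:E <= (A / (1 - r))%:E)%E.
Proof.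
move=> r01 A0 uA; apply: lime_le.
  by apply: is_cvg_nneseries => n _ _; rewrite lee_fin; case/andP: (uA n).
apply: nearW => n; rewrite sumEFin lee_fin big_mkord.
apply: (@le_trans _ _ (\sum_(i < n) A * r ^+ i)).
  by apply: ler_sum => i _; case/andP: (uA i).
by rewrite -mulr_sumr ler_wpM2l// sum_geometric_le.
Qed.

End series_bounds.

Section integrable_EFin.
Context d (T : measurableType d) (R : realType).
Variables (mu : {measure set T -> \bar R}) (X : set T).
Hypotheses (mX : measurable X) (Xfin : (mu X < +oo)%E).

Lemma bounded_integrable (f : T -> R) (c : R) : measurable_fun X f ->
  (forall x, X x -> `|f x| <= c) -> mu.-integrable X (EFin \o f).
Proof.
move=> mf fc; apply: measurable_bounded_integrable => //.
exists c; split; first by rewrite num_real.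
by move=> B cB x Xx; apply: le_trans (fc x Xx) _; exact: ltW.
Qed.

Lemma integrable_EFinZl (f : T -> R) (c : R) : mu.-integrable X (EFin \o f) ->
  mu.-integrable X (EFin \o (fun x => c * f x)).
Proof.
by move=> fi; rewrite (_ : _ \o _ = (fun y => c%:E * (EFin \o f) y)%E)//; exact: integrableZl.
Qed.

Lemma integrable_EFinD (f g : T -> R) : mu.-integrable X (EFin \o f) ->
  mu.-integrable X (EFin \o g) -> mu.-integrable X (EFin \o (fun x => f x + g x)).
Proof.
by move=> fi gi; rewrite (_ : _ \o _ = (EFin \o f) \+ (EFin \o g))%E//; exact: integrableD.
Qed.

Lemma integrable_EFinB (f g : T -> R) : mu.-integrable X (EFin \o f) ->
  mu.-integrable X (EFin \o g) -> mu.-integrable X (EFin \o (fun x => f x - g x)).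
Proof.
by move=> fi gi; rewrite (_ : _ \o _ = (EFin \o f) \- (EFin \o g))%E//; exact: integrableB.
Qed.

End integrable_EFin.

Section bounded_kernel.
Context d (T : measurableType d) (R : realType).
Variables (mu : {sigma_finite_measure set T -> \bar R}) (X : set T).
Hypotheses (mX : measurable X) (Xfin : (mu X < +oo)%E).
Variables (k : T -> T -> R) (C : R).
Hypotheses (mk : measurable_fun setT (fun z => k z.1 z.2)).
Hypotheses (k0 : forall x y, 0 <= k x y) (kC : forall x y, k x y <= C).

Lemma measurable_kernel_row x : measurable_fun setT (k x).
Proof. exact: (measurableT_comp mk (pair1_measurable x)). Qed.

Lemma kernel_bound_ge0 (x : T) : 0 <= C.
Proof. exact: le_trans (k0 x x) (kC x x). Qed.

Lemma integrable_kernelM (f : T -> R) x : mu.-integrable X (EFin \o f) ->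
  mu.-integrable X (EFin \o (fun y => k x y * f y)).
Proof.
move=> fi; apply: (@le_integrable _ _ _ mu _ mX _ (EFin \o (fun y => C * f y))).
- apply/measurable_EFinP; apply: measurable_funM.
    by apply: measurable_funTS; exact: measurable_kernel_row.
  by apply/measurable_EFinP; exact: measurable_int fi.
- move=> y _ /=; rewrite lee_fin !normrM ler_wpM2r//.
  by rewrite !ger0_norm ?(kernel_bound_ge0 x)// ?k0 ?kC.
- exact: integrable_EFinZl.
Qed.

Definition kop (f : T -> R) (x : T) : R := \int[mu]_(y in X) (k x y * f y).

Lemma kopE f x : mu.-integrable X (EFin \o f) ->
  (kop f x)%:E = (\int[mu]_(y in X) (k x y * f y)%:E)%E.
Proof. by move=> fi; rewrite fineK// integrable_fin_num// integrable_kernelM. Qed.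

Lemma kopB f g x : mu.-integrable X (EFin \o f) -> mu.-integrable X (EFin \o g) ->
  kop (fun y => f y - g y) x = kop f x - kop g x.
Proof.
move=> fi gi; rewrite /kop -RintegralB//; [|exact: integrable_kernelM..].
by apply: eq_Rintegral => y _; rewrite mulrBr.
Qed.

(** A bounded kernel maps L^1 into bounded functions; this turns every later bound on masses into a
    pointwise one. *)
Lemma le_kop_integral f x : mu.-integrable X (EFin \o f) ->
  `|kop f x| <= C * \int[mu]_(y in X) `|f y|.
Proof.
move=> fi; apply: le_trans (le_normr_Rintegral mX (integrable_kernelM x fi)) _.
have nfi : mu.-integrable X (EFin \o (fun y => `|f y|)) by exact: integrable_norm.
rewrite -RintegralZl//; apply: le_Rintegral => //.
- exact/integrable_norm/integrable_kernelM.
- exact: integrable_EFinZl.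
- by move=> y _; rewrite normrM ler_wpM2r// ger0_norm ?k0 ?kC.
Qed.

Lemma kop_ge0 f x : (forall y, 0 <= f y) -> 0 <= kop f x.
Proof. by move=> f0; apply: Rintegral_ge0 => y _; exact: mulr_ge0. Qed.

Lemma measurable_ge0_kop (f : T -> R) : measurable_fun setT f ->
  (forall x, 0 <= f x) -> measurable_fun setT (kop f).
Proof.
move=> mf f0; apply: measurableT_comp => //.
pose F := fun z : T * T => (k z.1 z.2 * (f z.2 * \1_X z.2))%:E.
rewrite (_ : (fun _ => _) = fubini_F mu F).
  apply: measurable_fun_fubini_tonelli_F; last first.
    by move=> z; rewrite lee_fin !mulr_ge0.
  apply/measurable_EFinP/measurable_funM => //.
  by apply: (measurableT_comp (f := fun y => f y * \1_X y)) => //; exact: measurable_funM.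
apply/funext => x; rewrite /fubini_F/= integral_mkcond.
apply: eq_integral => y _; rewrite /F/= patchE indicE.
by case: ifPn => _; rewrite ?mulr1// mulr0 mulr0.
Qed.

(** [kiter n] is T^n 1, and [kmass n] is the number a_n of the overview. *)
Fixpoint kiter (n : nat) : T -> R := if n is n'.+1 then kop (kiter n') else cst 1.

Definition kmass (n : nat) : R := \int[mu]_(x in X) kiter n x.

Lemma kiter_ge0 n x : 0 <= kiter n x.
Proof. by elim: n x => [|n IH] x //=; exact: kop_ge0. Qed.

Lemma measurable_kiter n : measurable_fun setT (kiter n).
Proof. by elim: n => [|n IH] //=; apply: measurable_ge0_kop => //; exact: kiter_ge0. Qed.

(** The two claims go together: bounding an iterate requires integrability of the preceding one,
    which comes from its bound. *)
Lemma kiter_le n x : kiter n x <= (C * fine (mu X)) ^+ n /\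
  mu.-integrable X (EFin \o kiter n).
Proof.
have bi m : (forall x, kiter m x <= (C * fine (mu X)) ^+ m) ->
    mu.-integrable X (EFin \o kiter m).
  move=> b; apply: (@bounded_integrable _ _ _ _ _ mX Xfin _ ((C * fine (mu X)) ^+ m)).
    exact/measurable_funTS/measurable_kiter.
  by move=> y _; rewrite ger0_norm ?kiter_ge0.
suff H m : forall x, kiter m x <= (C * fine (mu X)) ^+ m by split => //; exact: bi.
elim: m => [|m IH] y; first by rewrite expr0.
have mi := bi _ IH.
apply: le_trans (ler_norm _) _; apply: le_trans (le_kop_integral y mi) _.
rewrite exprS -mulrA ler_wpM2l// ?(kernel_bound_ge0 y)// mulrC.
rewrite -Rintegral_cst//; apply: le_Rintegral => //.
- exact: integrable_norm.
- exact: (@bounded_integrable _ _ _ _ _ mX Xfin _ `|(C * fine (mu X)) ^+ m|).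
- by move=> z _; rewrite ger0_norm ?kiter_ge0.
Qed.

Lemma integrable_kiter n : mu.-integrable X (EFin \o kiter n).
Proof.
have [->|/set0P[x _]] := eqVneq X set0; first exact: integrable_set0.
by have [] := kiter_le n x.
Qed.

Lemma kmass_ge0 n : 0 <= kmass n.
Proof. by apply: Rintegral_ge0 => x _; exact: kiter_ge0. Qed.

Lemma kiterS_le n x : kiter n.+1 x <= C * kmass n.
Proof.
apply: le_trans (ler_norm _) _; apply: le_trans (le_kop_integral x (integrable_kiter n)) _.
rewrite (_ : \int[mu]_(y in X) `|kiter n y| = kmass n)//.
by apply: eq_Rintegral => y _; rewrite ger0_norm// kiter_ge0.
Qed.

Section neumann_series.
Variables (s q A : R).
Hypotheses (q0 : 0 < q) (qs : q < s) (A0 : 0 <= A).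
Hypothesis massA : forall n, kmass n <= A * q ^+ n.

Let s0 : 0 < s. Proof. exact: lt_trans q0 qs. Qed.

(** Summed over n, these terms give F_j = T^j (s - T)^-1 1, a tail of the Neumann series at s up to
    the factor s^j. *)
Let term j n x : R := kiter (n + j) x / s ^+ n.+1.

Let term_ge0 j n x : 0 <= term j n x.
Proof. by rewrite divr_ge0 ?kiter_ge0// exprn_ge0// ltW. Qed.

Let mterm j n : measurable_fun setT (term j n).
Proof. by apply: measurable_funM => //; exact: measurable_kiter. Qed.

(** An iterate of positive index i is at most C A q^(i-1), by the mass of the preceding one; the
    summand 1 covers index 0, which has no predecessor. *)
Let bnd j (x : T) : R := (1 + C * A / q * q ^+ j) / s.

Let bnd_ge0 j x : 0 <= bnd j x.
Proof.
have C0 := kernel_bound_ge0 x.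
by rewrite divr_ge0 ?(ltW s0)// addr_ge0// !mulr_ge0 ?invr_ge0 ?exprn_ge0// ltW.
Qed.

Let term_le j n x : term j n x <= bnd j x * (q / s) ^+ n.
Proof.
have C0 := kernel_bound_ge0 x.
have -> : bnd j x * (q / s) ^+ n = (1 + C * A / q * q ^+ j) * q ^+ n / s ^+ n.+1.
  by rewrite /bnd expr_div_n exprS invfM; ring.
rewrite ler_wpM2r ?invr_ge0 ?exprn_ge0 ?(ltW s0)//.
have CA0 : 0 <= C * A by exact: mulr_ge0.
case E : (n + j)%N => [|p].
  move/eqP : E; rewrite addn_eq0 => /andP[/eqP-> /eqP->].
  by rewrite /= !expr0 !mulr1 lerDl divr_ge0// ltW.
apply: le_trans (kiterS_le p x) _; apply: (@le_trans _ _ (C * A / q * q ^+ (n + j))).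
  rewrite E exprS -[leRHS]mulrA mulKf ?gt_eqF//.
  by rewrite -mulrA ler_wpM2l.
by rewrite mulrDl mul1r -[in leRHS]mulrA -exprD addnC lerDr exprn_ge0// ltW.
Qed.

Definition neumann_ser j (x : T) : \bar R := (\sum_(n <oo) (term j n x)%:E)%E.

Lemma neumann_ser_le j x :
  (0 <= neumann_ser j x <= (bnd j x / (1 - q / s))%:E)%E.
Proof.
apply/andP; split; first by apply: nneseries_ge0 => n _ _; rewrite lee_fin term_ge0.
apply: nneseries_geometric_le => //.
  by rewrite divr_ge0 ?(ltW q0) ?(ltW s0)//= ltr_pdivrMr// mul1r.
by move=> n; rewrite term_ge0 term_le.
Qed.

Definition neumann j x : R := fine (neumann_ser j x).

Lemma neumannE j x : (neumann j x)%:E = neumann_ser j x.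
Proof.
rewrite fineK//; have /andP[n0 nb] := neumann_ser_le j x.
by rewrite ge0_fin_numE//; apply: le_lt_trans nb _; rewrite ltry.
Qed.

Lemma neumann_ge0 j x : 0 <= neumann j x.
Proof. by rewrite -lee_fin neumannE; case/andP: (neumann_ser_le j x). Qed.

Lemma measurable_neumann j : measurable_fun setT (neumann j).
Proof.
apply: measurableT_comp => //; apply: ge0_emeasurable_sum => n.
  by move=> x _ _; rewrite lee_fin term_ge0.
by move=> _; apply/measurable_EFinP; exact: mterm.
Qed.

Lemma integrable_neumann j : mu.-integrable X (EFin \o neumann j).
Proof.
have [->|/set0P[x _]] := eqVneq X set0; first exact: integrable_set0.
apply: (@bounded_integrable _ _ _ _ _ mX Xfin _ (bnd j x / (1 - q / s))).
  exact/measurable_funTS/measurable_neumann.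
move=> y _; rewrite ger0_norm ?neumann_ge0//.
by rewrite -lee_fin neumannE; case/andP: (neumann_ser_le j y).
Qed.

(** The term n = 0 splits off, and the shift in n becomes a shift in j. *)
Lemma neumann_eq j x : s * neumann j x = kiter j x + neumann j.+1 x.
Proof.
apply: EFin_inj; rewrite EFinM EFinD !neumannE /neumann_ser.
rewrite nneseries_recl//; last by move=> n; rewrite lee_fin.
rewrite ge0_muleDr ?lee_fin//; last by apply: nneseries_ge0 => n _ _; rewrite lee_fin.
congr (_ + _)%E; first by rewrite -EFinM /term add0n expr1 mulrC divfK// gt_eqF.
rewrite -nneseriesZl//; last by move=> n _; rewrite lee_fin.
rewrite -(nneseries_addn 1%N); last by move=> n; rewrite -EFinM lee_fin mulr_ge0// ltW.
apply: eq_eseriesr => n _; rewrite -EFinM /term addn1 addSnnS; congr EFin.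
by rewrite exprS invfM mulrCA [X in _ * X]mulrA mulfV ?mul1r// gt_eqF.
Qed.

(** Monotone convergence lets T act term by term. Together with [neumann_eq] this says (s - T) F_j =
    T^j 1. *)
Lemma kop_neumann j x : kop (neumann j) x = neumann j.+1 x.
Proof.
apply: EFin_inj; rewrite kopE ?integrable_neumann// neumannE /neumann_ser.
transitivity (\int[mu]_(y in X) (\sum_(n <oo) (k x y * term j n y)%:E))%E.
  apply: eq_integral => y _; rewrite EFinM neumannE -nneseriesZl//.
  by move=> n _; rewrite lee_fin.
rewrite integral_nneseries//.
- apply: eq_eseriesr => n _; rewrite /term addnS /=.
  rewrite EFinM muleC kopE; last exact: integrable_kiter.
  rewrite -ge0_integralZl//.
  + by apply: eq_integral => y _; rewrite -EFinM; congr EFin; ring.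
  + apply/measurable_EFinP/measurable_funTS/measurable_funM.
      exact: measurable_kernel_row.
    exact: measurable_kiter.
  + by move=> y _; rewrite lee_fin mulr_ge0 ?kiter_ge0.
  + by rewrite lee_fin invr_ge0 exprn_ge0// ltW.
- move=> n; apply/measurable_EFinP/measurable_funTS/measurable_funM => //.
  exact: measurable_kernel_row.
- by move=> n y _; rewrite lee_fin mulr_ge0.
Qed.

End neumann_series.

(** Boundedness of (s - T)^-1 in a priori form, restricted to nonnegative functions because it is
    applied to the tails of the Neumann series only. *)
Definition resolvent_bound (s c : R) := forall F : T -> R,
  measurable_fun setT F -> (forall x, 0 <= F x) -> mu.-integrable X (EFin \o F) ->
  \int[mu]_(x in X) F x <= c * \int[mu]_(x in X) `|s * F x - kop F x|.

(* The tails F_j of the Neumann series at s satisfy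
   s0 F_j - T F_j = e_j - (s - s0) F_j for the iterates e_j of 1, so that the
   resolvent bound at s0 gives t_j <= 2 c a_j for their masses t_j and a_j; with
   s t_j = a_j + t_{j+1}, t_j decays at the rate s - 1 / (2 c) < s0. *)
Lemma resolvent_bound_improve (s0 c s q A : R) : 0 < s0 -> 0 < c ->
  resolvent_bound s0 c -> s0 < s -> (s - s0) * (2 * c) < 1 -> 0 < q -> q < s ->
  0 <= A -> (forall n, kmass n <= A * q ^+ n) ->
  exists2 q', 0 < q' < s0 & exists2 A', 0 <= A' & forall n, kmass n <= A' * q' ^+ n.
Proof.
move=> s0p c0 rb s0s sc q0 qs A0 massA.
have sp : 0 < s by exact: lt_trans s0p s0s.
pose F j := neumann s j; pose t j := \int[mu]_(x in X) F j x.
have iF j : mu.-integrable X (EFin \o F j) := integrable_neumann q0 qs A0 massA j.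
have t0 j : 0 <= t j.
  by apply: Rintegral_ge0 => x _; exact: (neumann_ge0 q0 qs A0 massA).
have tS j : s * t j = kmass j + t j.+1.
  rewrite -RintegralZl// -RintegralD//; last exact: integrable_kiter.
  by apply: eq_Rintegral => x _; exact: (neumann_eq q0 qs A0 massA).
have tk j : t j <= 2 * c * kmass j.
  have : t j <= c * (kmass j + (s - s0) * t j).
    apply: le_trans (rb (F j) _ _ (iF j)) _.
    - exact: (measurable_neumann q0 qs).
    - by move=> x; exact: (neumann_ge0 q0 qs A0 massA).
    rewrite ler_wpM2l ?(ltW c0)// -RintegralZl// -RintegralD//; last 2 first.
    - exact: integrable_kiter.
    - exact: integrable_EFinZl.
    have E x : s0 * F j x - kop (F j) x = kiter j x - (s - s0) * F j x.
      rewrite (kop_neumann q0 qs A0 massA) mulrBl.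
      by rewrite (neumann_eq q0 qs A0 massA j x) /F; ring.
    apply: le_Rintegral => //.
    - apply: integrable_norm; rewrite (_ : _ \o _ =
          EFin \o (fun x => kiter j x - (s - s0) * F j x)).
        by apply: integrable_EFinB => //; [exact: integrable_kiter|exact: integrable_EFinZl].
      by apply/funext => x /=; rewrite E.
    - by apply: integrable_EFinD => //; [exact: integrable_kiter|exact: integrable_EFinZl].
    - move=> x _; rewrite E; apply: le_trans (ler_normB _ _) _.
      rewrite ger0_norm ?kiter_ge0// lerD2l ger0_norm// mulr_ge0 ?subr_ge0 ?(ltW s0s)//.
      exact: (neumann_ge0 q0 qs A0 massA).
  (* The closeness of s to s0 makes c (s - s0) t_j at most t_j / 2, which is absorbed on the
     left. *)
  have : (s - s0) * (2 * c) * t j <= 1 * t j by rewrite ler_wpM2r// ltW.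
  by nra.
(* The rate s - 1 / (2 c) is below s0 but need not be positive; the maximum with s0 / 2 keeps q' in
   ]0, s0[. *)
pose q' := Num.max (s - (2 * c)^-1) (s0 / 2).
have q'p : 0 < q' by rewrite lt_max divr_gt0// orbT.
have q's : q' < s0.
  rewrite gt_max; apply/andP; split; last by rewrite ltr_pdivrMr// mulr_natr mulr2n ltrDl.
  by rewrite ltrBlDr -ltrBlDl -[ltRHS]mul1r ltr_pdivlMr// mulr_gt0.
have tle j : t j <= t 0%N * q' ^+ j.
  elim: j => [|j IH]; first by rewrite expr0 mulr1.
  have : t j.+1 <= (s - (2 * c)^-1) * t j.
    have := tS j; have := tk j; rewrite mulrBl => tkj ->.
    rewrite lerBrDl addrC addrC lerD2r mulrC ler_pdivrMr ?mulr_gt0//.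
    by rewrite mulrC.
  move=> h; apply: le_trans h _; rewrite exprS mulrCA.
  apply: (@le_trans _ _ (q' * t j)); first by rewrite ler_wpM2r// le_max lexx.
  by rewrite ler_wpM2l// ltW.
exists q'; first by rewrite q'p.
exists (s * t 0%N) => [|j]; first by rewrite mulr_ge0// ltW.
have := tS j; have := t0 j.+1; have := tle j => tj t1 e.
apply: (@le_trans _ _ (s * t j)); first by rewrite e lerDl.
by rewrite -mulrA ler_wpM2l// ltW.
Qed.

Lemma kmass_le n : kmass n <= fine (mu X) * (C * fine (mu X)) ^+ n.
Proof.
rewrite mulrC -Rintegral_cst//; apply: le_Rintegral => //.
- exact: integrable_kiter.
- exact: (@bounded_integrable _ _ _ _ _ mX Xfin _ `|(C * fine (mu X)) ^+ n|).
- by move=> x _; have [] := kiter_le n x.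
Qed.

(* Only real resolvent points are needed, by positivity: a growth rate whose
   infimum were at least s1 could be improved by the resolvent bound there. *)
Lemma kmass_growth (s1 : R) : 0 < s1 ->
  (forall s, s1 <= s -> exists2 c, 0 < c & resolvent_bound s c) ->
  exists2 A, 0 <= A & forall n, kmass n <= A * s1 ^+ n.
Proof.
move=> s1p rb.
pose S := [set s | 0 < s /\ exists2 A, 0 <= A & forall n, kmass n <= A * s ^+ n].
have SU s s' : S s -> s <= s' -> S s'.
  move=> [s0 [A A0 sA]] ss'; split; first exact: lt_le_trans ss'.
  exists A => // n; apply: le_trans (sA n) _; rewrite ler_wpM2l// lerXn2r//.
    by rewrite nnegrE ltW.
  by rewrite nnegrE ltW// (lt_le_trans s0).
have C0 := kernel_bound_ge0 point.
(* The set of rates is nonempty by the crude bound of [kmass_le]; adding 1 makes the rate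
   positive. *)
have S1 : S (C * fine (mu X) + 1).
  have M0 : 0 <= C * fine (mu X) by rewrite mulr_ge0// fine_ge0.
  split; first by rewrite ltr_wpDl.
  exists (fine (mu X)) => [|n]; first exact: fine_ge0.
  apply: le_trans (kmass_le n) _; rewrite ler_wpM2l ?fine_ge0// lerXn2r ?nnegrE//.
    by rewrite addr_ge0.
  by rewrite lerDl.
apply: contrapT => nS.
have S_lb s : S s -> s1 <= s.
  move=> Ss; rewrite leNgt; apply/negP => ss1; apply: nS.
  by have [] := SU _ _ Ss (ltW ss1).
have hS : has_inf S by split; [exists (C * fine (mu X) + 1)|exists s1].
have s1i : s1 <= inf S by apply: lb_le_inf => //; case: hS.
have [c c0 rbc] := rb _ s1i.
(* With s0 = inf S and s = s0 + 1 / (4 c), the product (s - s0) 2 c equals 1/2, and some admissible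
   rate q lies below s. *)
have e0 : 0 < (4 * c)^-1 by rewrite invr_gt0 mulr_gt0.
have [q [qp [A A0 qA]] qlt] := inf_adherent e0 hS.
have [|||q' /andP[q'0 q'lt] [A' A'0 q'A]] :=
  resolvent_bound_improve (s := inf S + (4 * c)^-1) _ c0 rbc _ _ qp qlt A0 qA.
- exact: lt_le_trans s1i.
- by rewrite ltrDl.
- rewrite addrAC subrr add0r mulrC ltr_pdivrMr ?mulr_gt0// mul1r.
  by rewrite ltr_pM2r// ltr_nat.
have : inf S <= q' by apply: ge_inf; [case: hS|split => //; exists A'].
by rewrite leNgt q'lt.
Qed.

End bounded_kernel.

(** * Resolvent and spectrum of a bounded kernel operator *)

Section resolvent_of_kernel.
Variables (R : realType) (m : nat).
Local Notation E := 'rV[R]_m.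
Local Notation mu := (lebm R m).
Variables (X : set E) (mX : measurable X) (Xfin : (mu X < +oo)%E).
Variables (k : E -> E -> R) (C : R).
Hypotheses (mk : measurable_fun setT (fun z => k z.1 z.2)).
Hypotheses (k0 : forall x y, 0 <= k x y) (kC : forall x y, k x y <= C).
Variable T : (E -> R) -> (E -> R).
Hypothesis TE : forall f, mu.-integrable X (EFin \o f) ->
  forall x, X x -> T f x = kop mu X k f x.

Lemma measurable_normc (f : E -> complex R) : in_L1C X f ->
  measurable_fun X (fun x => ComplexField.Normc.normc (f x)).
Proof.
move=> [/integrableP[/measurable_EFinP f1 _] /integrableP[/measurable_EFinP f2 _]].
rewrite (_ : (fun _ => _) = Num.sqrt \o
  ((fun x => complex.Re (f x) ^+ 2) \+ (fun x => complex.Im (f x) ^+ 2))); last first.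
  by apply/funext => x /=; case: (f x).
apply: measurableT_comp; first exact: (continuous_measurable_fun (@sqrt_continuous R)).
by apply: measurable_funD; apply: measurable_funX.
Qed.

(** Surjectivity yields a preimage f of (s - T) F with controlled norm, and injectivity applied to f
    - F identifies f with F almost everywhere. The constant in [resolvent_set] carries no sign,
    hence [|c| + 1]. *)
Lemma resolvent_set_bound (s : R) : resolvent_set X T (Complex s 0) ->
  exists2 c, 0 < c & resolvent_bound mu X k s c.
Proof.
move=> [[c ex] un]; exists (`|c| + 1); first by rewrite ltr_wpDl.
move=> F mF F0 iF; have i0 : mu.-integrable X (EFin \o (fun _ : E => 0 : R)).
  exact: integrable0.
have mkF : measurable_fun setT (kop mu X k F) by exact: measurable_ge0_kop.
have ikF : mu.-integrable X (EFin \o kop mu X k F).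
  apply: (@bounded_integrable _ _ _ _ _ mX Xfin _ (C * \int[mu]_(y in X) `|F y|)).
    exact: measurable_funTS.
  by move=> x _; exact: (@le_kop_integral _ _ _ _ _ mX _ _ mk k0 kC).
pose G x := s * F x - kop mu X k F x.
have iG : mu.-integrable X (EFin \o G).
  by apply: integrable_EFinB => //; exact: integrable_EFinZl.
pose g x := Complex (G x) 0.
have [|f [Lf fg fc]] := ex g; first by split.
have [if1 if2] := Lf.
pose h x := Complex (complex.Re (f x) - F x) (complex.Im (f x)).
have Lh : in_L1C X h by split => //; exact: integrable_EFinB.
have h0 : {ae mu, forall x, X x -> Complex s 0 * h x - complexify T h x = 0}.
  move: fg; apply: filterS => x /= fg Xx; have := fg Xx.
  rewrite /complexify !TE//; last by exact: (integrable_EFinB mX if1 iF).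
  rewrite (@kopB _ _ _ _ _ mX k C mk k0 kC (complex.Re (R:=R) \o f) F x if1 iF).
  rewrite /g /G /h; case: (f x) => a b /=.
  move=> -[] e1 e2; congr Complex; lra.
have {}h0 := un h Lh h0.
have fF : {ae mu, forall x, X x -> (F x)%:E <= (ComplexField.Normc.normc (f x))%:E}%E.
  move: h0; apply: filterS => x /= hx Xx; have := hx Xx.
  rewrite /h; case: (f x) => a b /= -[] /eqP.
  rewrite subr_eq0 => /eqP <- _; rewrite lee_fin.
  by apply: le_trans (ler_norm _) _; rewrite -sqrtr_sqr ler_wsqrtr// lerDl sqr_ge0.
have : (\int[mu]_(x in X) (F x)%:E <= c%:E * normL1C X g)%E.
  apply: le_trans fc; apply: ae_ge0_le_integral => //.
  - by move=> x _; rewrite lee_fin.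
  - exact/measurable_EFinP/measurable_funTS.
  - by move=> x _; rewrite lee_fin; case: (f x) => a b /=; exact: sqrtr_ge0.
  - by apply/measurable_EFinP; exact: measurable_normc.
have -> : normL1C X g = (\int[mu]_(x in X) `|G x|)%:E.
  rewrite /normL1C fineK; last exact/integrable_fin_num/integrable_norm.
  by apply: eq_integral => x _ /=; rewrite expr0n /= addr0 sqrtr_sqr.
rewrite -[X in (X <= _)%E]fineK; last exact: integrable_fin_num.
rewrite -EFinM lee_fin => H; apply: le_trans H _.
rewrite ler_wpM2r ?Rintegral_ge0//.
by rewrite (le_trans (ler_norm c))// lerDl.
Qed.

(* T f is bounded by C ||f||_1, so T f = - 1_A cannot be solved with a uniform
   bound when A has small positive measure. *)
Lemma zero_in_spectrum : (forall e : R, 0 < e -> exists A,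
    [/\ measurable A, A `<=` X, (0 < mu A)%E & (mu A < e%:E)%E]) ->
  spectrum X T 0.
Proof.
move=> small [[c ex] _].
have C0 := kernel_bound_ge0 k0 kC point.
(* This size of A gives C |c| mu(A) < 1, whereas T f = -1 at a point of A would force this product
   to be at least 1. *)
have [|A [mA AX A0 Ae]] := small ((C + 1) * (`|c| + 1))^-1.
  by rewrite invr_gt0 mulr_gt0// ltr_wpDl.
pose g x : complex R := Complex (\1_A x) 0.
have Afin : mu A \is a fin_num by rewrite ge0_fin_numE// (lt_trans Ae) ?ltry.
have iA : mu.-integrable X (EFin \o (\1_A : E -> R)).
  apply: (@bounded_integrable _ _ _ _ _ mX Xfin _ 1).
    exact/measurable_funTS/measurable_indic.
  by move=> x _; rewrite ger0_norm// indicE; case: (x \in A); rewrite ?ler01.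
have [|f [[if1 if2] fg fc]] := ex g; first by split => //; exact: integrable0.
have ngA : normL1C X g = mu A.
  rewrite /normL1C -(setIidl AX) -integral_indic//.
  by apply: eq_integral => x _ /=; rewrite expr0n /= addr0 sqrtr_sqr ger0_norm.
have f1 : \int[mu]_(x in X) `|complex.Re (f x)| <= `|c| * fine (mu A).
  rewrite -lee_fin fineK; last exact/integrable_fin_num/integrable_norm.
  apply: (@le_trans _ _ (normL1C X f)).
    apply: ge0_le_integral => //.
    - by have := measurable_int _ (integrable_norm if1).
    - by apply/measurable_EFinP; exact: measurable_normc.
    - move=> x _; rewrite lee_fin; case: (f x) => a b /=.
      by rewrite -sqrtr_sqr ler_wsqrtr// lerDl sqr_ge0.
  apply: le_trans fc _; rewrite ngA EFinM fineK// lee_wpmul2r// lee_fin.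
  exact: ler_norm.
have : {ae mu, forall x, X x -> ~ A x}.
  move: fg; apply: filterS => x /= fg Xx Ax; have := fg Xx.
  rewrite /complexify /g indicE mem_set// TE//; case: (f x) => a b /= -[] e _.
  have := @le_kop_integral _ _ _ _ _ mX _ _ mk k0 kC _ x if1.
  have -> : kop mu X k (complex.Re (R:=R) \o f) x = -1 by lra.
  rewrite normrN1 leNgt => /negP; apply.
  apply: (@le_lt_trans _ _ (C * (`|c| * fine (mu A)))); first by rewrite ler_wpM2l.
  have : fine (mu A) < ((C + 1) * (`|c| + 1))^-1 by rewrite -lte_fin fineK.
  rewrite -[X in _ < X -> _]mul1r ltr_pdivlMr ?mulr_gt0 ?ltr_wpDl// => H.
  have := fine_ge0 (measure_ge0 mu A); have := normr_ge0 c; nra.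
move=> [B [mB B0 AB]]; have : (mu A <= mu B)%E.
  apply: le_measure; rewrite ?inE// => x Ax; apply: AB => /= H.
  exact: H (AX _ Ax) Ax.
by rewrite B0 leNgt A0.
Qed.

End resolvent_of_kernel.

(** * Approximation by cell averages *)

Section lebesgue_boxes.
Variable R : realType.

Lemma measurable_coord_bigcap m (I : 'I_m -> set R) :
  (forall k, measurable (I k)) ->
  measurable [set x : 'rV[R]_m | forall k, I k (x ord0 k)].
Proof.
move=> mI.
rewrite (_ : [set _ | _] = \bigcap_(k in [set: 'I_m]) ((fun x : 'rV[R]_m => x ord0 k) @^-1` I k)).
  apply: fin_bigcap_measurable => // k _; rewrite -[X in measurable X]setTI.
  exact: measurable_coord.
by apply/seteqP; split => x /= h k => [_|]; exact: h.
Qed.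

Lemma box_itvE m (a b : 'rV[R]_m) :
  box a b = [set x | forall k, `[a ord0 k, b ord0 k]%classic (x ord0 k)].
Proof. by apply/seteqP; split => x h k /=; have := h k; rewrite /= in_itv. Qed.

Lemma measurable_box m (a b : 'rV[R]_m) : measurable (box a b).
Proof.
rewrite box_itvE.
apply: (@measurable_coord_bigcap m (fun k => `[a ord0 k, b ord0 k]%classic)) => k.
exact: measurable_itv. Qed.

Lemma measurable_hyperrectangle m (A : set 'rV[R]_m) :
  hyperrectangle A -> measurable A.
Proof.
move=> [I _ ->]; apply: (@measurable_coord_bigcap m (fun k => [set` I k])) => k.
exact: measurable_itv.
Qed.

Lemma lebm_box m (a b : 'rV[R]_m) : (forall k, a ord0 k <= b ord0 k) ->
  lebm R m (box a b) = (\prod_k (b ord0 k - a ord0 k))%:E.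
Proof.
elim: m a b => [|m IH] a b ab.
  rewrite big_ord0 /= diracE mem_set// => -[].
  by case.
pose a' : 'rV[R]_m := \row_i a ord0 (lift ord0 i).
pose b' : 'rV[R]_m := \row_i b ord0 (lift ord0 i).
have E : row_cons (n := m) @^-1` box a b = `[a ord0 ord0, b ord0 ord0]%classic `*` box a' b'.
  apply/seteqP; split => -[x v]; rewrite /row_cons /box /=.
    move=> h; split.
      by have := h ord0; rewrite mxE unlift_none in_itv.
    by move=> k; have := h (lift ord0 k); rewrite !mxE liftK.
  move=> [h1 h2] k; rewrite mxE; case: unliftP => [j|] -> /=.
    by have := h2 j; rewrite !mxE.
  by move: h1; rewrite in_itv.
rewrite [LHS](_ : _ = (@lebesgue_measure R \x lebm R m)%E (row_cons (n := m) @^-1` box a b))//.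
rewrite E product_measure1E//; last exact: measurable_box.
rewrite IH; last by move=> k; rewrite !mxE.
rewrite [X in (X * _)%E](lebesgue_measure_itv `[a ord0 ord0, b ord0 ord0]) /=.
rewrite lte_fin big_ord_recl EFinM.
have -> : \prod_(k < m) (b' ord0 k - a' ord0 k) =
    \prod_(i < m) (b ord0 (lift ord0 i) - a ord0 (lift ord0 i)).
  by apply: eq_bigr => k _; rewrite !mxE.
case: ltP => // ba; rewrite (_ : b ord0 ord0 - a ord0 ord0 = 0)//.
by apply/eqP; rewrite subr_eq0 eq_le ba ab.
Qed.

(** By induction on the dimension, one factor of the product is null. It follows that slabs
    shrinking to a hyperplane have vanishing measure, the error in approximating half-spaces by
    cells. *)
Lemma lebm_hyperplane m (k : 'I_m) (t : R) :
  lebm R m [set x | x ord0 k = t] = 0%E.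
Proof.
elim: m k => [[]//|m IH] k.
rewrite [LHS](_ : _ = (@lebesgue_measure R \x lebm R m)%E
  (row_cons (n := m) @^-1` [set x | x ord0 k = t]))//.
case: (unliftP ord0 k) => [j|] ->.
  rewrite (_ : _ @^-1` _ = setT `*` [set x : 'rV[R]_m | x ord0 j = t]).
    rewrite product_measure1E ?IH ?mule0//.
    rewrite -[X in measurable X]setTI.
    exact: (measurable_coord j measurableT (measurable_set1 t)).
  by apply/seteqP; split => -[x v]; rewrite /row_cons /= mxE liftK//= => -[].
rewrite (_ : _ @^-1` _ = [set t] `*` [set: 'rV[R]_m]).
  by rewrite product_measure1E// [X in (X * _)%E](lebesgue_measure_set1 t) mul0e.
by apply/seteqP; split => -[x v]; rewrite /row_cons /= mxE unlift_none//= => -[].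
Qed.

Lemma box_small_subset m (a b : 'rV[R]_m) : (0 < m)%N ->
  (forall k, a ord0 k < b ord0 k) -> forall e : R, 0 < e -> exists A,
  [/\ measurable A, A `<=` box a b, (0 < lebm R m A)%E & (lebm R m A < e%:E)%E].
Proof.
move=> m0 ab e e0; pose V := \prod_k (b ord0 k - a ord0 k).
have V0 : 0 < V by apply: prodr_gt0 => k _; rewrite subr_gt0.
(* Scaling all sides by t <= 1 scales the volume V by t^m <= t, the dimension being positive; so t V
   < e suffices. *)
pose t := Num.min 1 (e / (2 * V)).
have t0 : 0 < t by rewrite lt_min ltr01 divr_gt0// mulr_gt0.
have t1 : t <= 1 by rewrite ge_min lexx.
have tV : t * V < e.
  apply: (@le_lt_trans _ _ (e / (2 * V) * V)).
    by rewrite ler_wpM2r ?(ltW V0)// ge_min lexx orbT.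
  by rewrite invfM mulrA divfK ?gt_eqF// ltr_pdivrMr// mulr_natr mulr2n ltrDl.
pose c : 'rV[R]_m := \row_k (a ord0 k + t * (b ord0 k - a ord0 k)).
have ac k : a ord0 k <= c ord0 k.
  by rewrite mxE lerDl mulr_ge0// ?subr_ge0 ltW.
exists (box a c); split.
- exact: measurable_box.
- move=> x h k; have /andP[h1 h2] := h k; rewrite h1/=; apply: le_trans h2 _.
  rewrite mxE -lerBrDl -[leRHS]mul1r ler_wpM2r// subr_ge0 ltW//.
- rewrite lebm_box// lte_fin; apply: prodr_gt0 => k _.
  by rewrite mxE addrAC subrr add0r mulr_gt0// subr_gt0.
- rewrite lebm_box// lte_fin; apply: le_lt_trans tV.
  have -> : \prod_k (c ord0 k - a ord0 k) = t ^+ m * V.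
    rewrite (eq_bigr (fun k => t * (b ord0 k - a ord0 k))); last first.
      by move=> k _; rewrite mxE addrAC subrr add0r.
    by rewrite big_split/= prodr_const card_ord.
  rewrite ler_wpM2r ?(ltW V0)// -[leRHS]expr1; apply: ler_wiXn2l => //; exact: ltW.
Qed.

End lebesgue_boxes.

Section cell_approximation.
Context d0 (T : measurableType d0) (R : realType).
Variables (nu : {measure set T -> \bar R}) (X : set T).
Hypotheses (mX : measurable X) (Xfin : (nu X < +oo)%E).
Variables (I : nat -> finType) (P : forall d, I d -> set T).
Hypotheses (mP : forall d i, measurable (P (d := d) i)).
Hypotheses (tP : forall d, trivIset setT (P (d := d))).
Hypotheses (XP : forall d, (0 < d)%N -> \bigcup_i P (d := d) i = X).

Lemma measurable_setY (A B : set T) : measurable A -> measurable B -> measurable (A `+` B).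
Proof. by move=> mA mB; rewrite setY_def; apply: measurableU; exact: measurableD. Qed.

(** The index type [I d] is left arbitrary so that the theory applies both to the cells and to their
    pairwise products. *)
Definition cells d (J : set (I d)) : set T := \bigcup_(i in J) P i.

Lemma measurable_cells d (J : set (I d)) : measurable (cells J).
Proof. by apply: fin_bigcup_measurable. Qed.

(** Approximation in measure by unions of cells, for every sufficiently late partition. As the
    partitions need not be nested, convergence of averages is reached by showing that such sets form
    a sigma-algebra and that it contains the half-spaces. *)
Definition approximable (U : set T) := measurable U /\
  forall e : R, 0 < e -> exists D, forall d, (0 < d)%N -> (D <= d)%N ->
    exists J : set (I d), (nu (X `&` (U `+` cells J)) <= e%:E)%E.

Lemma le_nu (A B : set T) : measurable A -> measurable B -> A `<=` B -> (nu A <= nu B)%E.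
Proof. by move=> mA mB AB; apply: le_measure; rewrite ?inE. Qed.

Let mXY (A B : set T) : measurable A -> measurable B -> measurable (X `&` (A `+` B)).
Proof. by move=> mA mB; apply: measurableI => //; exact: measurable_setY. Qed.

Let nuU (A B : set T) (a b c : R) (S : set T) : measurable A -> measurable B ->
  measurable S -> S `<=` A `|` B ->
  (nu A <= a%:E)%E -> (nu B <= b%:E)%E -> a + b <= c -> (nu S <= c%:E)%E.
Proof.
move=> mA mB mS SAB Aa Bb abc; apply: le_trans (le_nu mS (measurableU _ _ mA mB) SAB) _.
apply: le_trans (measureU2 _ mA mB) _; apply: le_trans (leeD Aa Bb) _.
by rewrite -EFinD lee_fin.
Qed.

Lemma approximable_limit (U : set T) : measurable U ->
  (forall e : R, 0 < e -> exists2 V, approximable V & (nu (X `&` (U `+` V)) <= e%:E)%E) ->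
  approximable U.
Proof.
move=> mU UV; split => // e e0; have e20 : 0 < e / 2 by rewrite divr_gt0.
have [V [mV aV] UVe] := UV _ e20.
have [D De] := aV _ e20; exists D => d dp Dd; have [J Je] := De d dp Dd.
have mJ := measurable_cells J.
exists J; apply: (nuU (mXY mU mV) (mXY mV mJ) (mXY mU mJ) _ UVe Je); last by lra.
by move=> x; rewrite !setY_def /=; case: (pselect (V x)); tauto.
Qed.

(** Inside X the cells outside J form the complement of those in J, so the symmetric difference does
    not grow. *)
Lemma approximableC (U : set T) : approximable U -> approximable (~` U).
Proof.
move=> [mU aU]; split; first exact: measurableC.
move=> e e0; have [D De] := aU e e0; exists D => d dp Dd.
have [J Je] := De d dp Dd; exists (~` J); apply: le_trans Je.
have mJ := measurable_cells J; have mCJ := measurable_cells (~` J).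
apply: le_nu => //; [exact/mXY/mCJ/measurableC|exact: mXY|].
move=> x [Xx h]; split => //.
have [i _ Pix] : (\bigcup_i P (d := d) i) x by rewrite XP.
have JE : cells J x <-> J i.
  split=> [[j Jj Pjx]|Ji]; last by exists i.
  by have <- : j = i by apply: (tP (d := d)) => //; exists x.
have CJE : cells (~` J) x <-> ~ J i.
  split=> [[j Jj Pjx]|Ji]; last by exists i.
  by have <- : j = i by apply: (tP (d := d)) => //; exists x.
by move: h; rewrite !setY_def /=; case: (pselect (J i)); case: (pselect (U x)); tauto.
Qed.

Lemma approximableU (U V : set T) : approximable U -> approximable V -> approximable (U `|` V).
Proof.
move=> [mU aU] [mV aV]; have mUV : measurable (U `|` V) by exact: measurableU.
split => // e e0; have e20 : 0 < e / 2 by rewrite divr_gt0.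
have [D De] := aU _ e20; have [D' De'] := aV _ e20.
exists (maxn D D') => d dp; rewrite geq_max => /andP[Dd Dd'].
have [J Je] := De d dp Dd; have [J' Je'] := De' d dp Dd'.
have mJ := measurable_cells J; have mJ' := measurable_cells J'.
have mJJ' := measurable_cells (J `|` J').
exists (J `|` J').
apply: (nuU (mXY mU mJ) (mXY mV mJ') (mXY mUV mJJ') _ Je Je'); last by lra.
by move=> x; rewrite !setY_def /cells bigcup_setU /=; tauto.
Qed.

Lemma approximable0 : approximable set0.
Proof.
split => // e e0; exists 0%N => d dp _; exists set0.
by rewrite /cells bigcup_set0 setY0 setI0 measure0 lee_fin ltW.
Qed.

(** Finite unions miss a remainder [K n] whose measure tends to 0 by continuity from above, X having
    finite measure; [approximable_limit] absorbs it. *)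
Lemma approximable_bigcup (F : (set T)^nat) : (forall n, approximable (F n)) ->
  approximable (\bigcup_n F n).
Proof.
move=> aF; pose G n := \big[setU/set0]_(i < n) F i.
have aG n : approximable (G n).
  rewrite /G; elim: n => [|n IH]; first by rewrite big_ord0; exact: approximable0.
  by rewrite big_ord_recr /=; exact: approximableU.
have mF : measurable (\bigcup_n F n).
  by apply: bigcupT_measurable => n; have [] := aF n.
apply: approximable_limit => // e e0.
have mG n : measurable (G n) by have [] := aG n.
have GF n : G n `<=` \bigcup_n F n by exact: bigsetU_bigcup.
pose K n := (X `&` \bigcup_n F n) `\` G n.
have mK n : measurable (K n) by apply: measurableD => //; exact: measurableI.
have K0 : (nu (K 0%N) < +oo)%E.
  by apply: le_lt_trans Xfin; apply: le_nu => // x [[]].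
have KE : \bigcap_n K n = set0.
  apply/seteqP; split => // x h; have [[Xx [n _ Fnx]] _] := h 0%N Logic.I.
  have [_] := h n.+1 Logic.I; apply; rewrite /G big_ord_recr /=; by right.
have /fine_cvgP[_] : nu (K n) @[n --> \oo] --> 0%E.
  rewrite -(measure0 nu) -KE; apply: nonincreasing_cvg_mu => //.
    by rewrite KE.
  move=> n p np; apply/subsetPset => x [Xx nG]; split => // GG; apply: nG.
  exact: (subset_bigsetU np).
move=> /cvgrPdist_lt /(_ e e0) [n _ /(_ n (leqnn n))] /=.
rewrite sub0r normrN ger0_norm ?fine_ge0// => Kn.
exists (G n) => //; apply: (@le_trans _ _ (nu (K n))).
  apply: le_nu => //; first exact: mXY.
  move=> x [Xx]; rewrite setY_def => -[[]//|[/GF Fx nF]].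
  by exfalso; exact: nF.
rewrite -[X in (X <= _)%E]fineK ?lee_fin ?(ltW Kn)//.
rewrite ge0_fin_numE//; apply: le_lt_trans Xfin; apply: le_nu => //.
by move=> x [[]].
Qed.

Lemma sigma_algebra_approximable : sigma_algebra setT approximable.
Proof.
split; [exact: approximable0| |exact: approximable_bigcup].
by move=> A aA; rewrite setTD; exact: approximableC.
Qed.

Import HBSimple.
Definition steps d (c : I d -> R) (x : T) : R := \sum_i c i * \1_(P i) x.

Lemma stepsE d (c : I d -> R) i x : P i x -> steps c x = c i.
Proof.
move=> Pix; rewrite /steps (bigD1 i)//= indicE mem_set// mulr1 big1 ?addr0// => j ji.
rewrite indicE memNset ?mulr0// => Pjx; move/eqP: ji; apply.
by apply: (tP (d := d)) => //; exists x.
Qed.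

Lemma measurable_steps d (c : I d -> R) : measurable_fun setT (steps c).
Proof. by apply: measurable_sum => i; apply: measurable_funM. Qed.

Definition approxf (f : T -> R) := nu.-integrable X (EFin \o f) /\
  forall e : R, 0 < e -> exists D, forall d, (0 < d)%N -> (D <= d)%N ->
    exists c : I d -> R, (\int[nu]_(x in X) `|f x - steps c x|%:E <= e%:E)%E.

Let mabs (f : T -> R) : measurable_fun X f -> measurable_fun X (fun x => `|f x|%:E).
Proof. by move=> mf; apply/measurable_EFinP; exact: measurableT_comp. Qed.

Let mint (f : T -> R) : nu.-integrable X (EFin \o f) -> measurable_fun X f.
Proof. by move=> /integrableP[/measurable_EFinP]. Qed.

Let msteps d (c : I d -> R) : measurable_fun X (steps c).
Proof. exact/measurable_funTS/measurable_steps. Qed.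

Let intD (f g h : T -> R) (a b c : R) : measurable_fun X f -> measurable_fun X g ->
  measurable_fun X h -> (forall x, X x -> `|h x| <= `|f x| + `|g x|) ->
  (\int[nu]_(x in X) `|f x|%:E <= a%:E)%E -> (\int[nu]_(x in X) `|g x|%:E <= b%:E)%E ->
  a + b <= c -> (\int[nu]_(x in X) `|h x|%:E <= c%:E)%E.
Proof.
move=> mf mg mh hfg fa gb abc.
apply: (@le_trans _ _ (\int[nu]_(x in X) (`|f x|%:E + `|g x|%:E))%E).
  apply: ge0_le_integral => //.
  - exact: mabs.
  - by apply: emeasurable_funD; exact: mabs.
rewrite ge0_integralD//; [|exact: mabs..].
by apply: le_trans (leeD fa gb) _; rewrite -EFinD lee_fin.
Qed.

Lemma approxfD (f g : T -> R) : approxf f -> approxf g -> approxf (fun x => f x + g x).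
Proof.
move=> [fi af] [gi ag]; split; first exact: integrable_EFinD.
move=> e e0; have e20 : 0 < e / 2 by rewrite divr_gt0.
have [D De] := af _ e20; have [D' De'] := ag _ e20.
exists (maxn D D') => d dp; rewrite geq_max => /andP[Dd Dd'].
have [c ce] := De d dp Dd; have [c' ce'] := De' d dp Dd'.
exists (fun i => c i + c' i).
have sE x : steps (fun i => c i + c' i) x = steps c x + steps c' x.
  by rewrite /steps -big_split; apply: eq_bigr => i _; rewrite mulrDl.
have mf := mint fi; have mg := mint gi.
apply: (intD _ _ _ _ ce ce'); last by lra.
- exact: measurable_funB.
- exact: measurable_funB.
- by apply: measurable_funB => //; exact: measurable_funD.
- by move=> x Xx; rewrite sE opprD addrACA; exact: ler_normD.
Qed.

Lemma approxf_limit (f : T -> R) : nu.-integrable X (EFin \o f) ->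
  (forall e : R, 0 < e -> exists2 g, approxf g &
    (\int[nu]_(x in X) `|f x - g x|%:E <= e%:E)%E) -> approxf f.
Proof.
move=> fi fg; split => // e e0; have e20 : 0 < e / 2 by rewrite divr_gt0.
have [g [gi ag] fge] := fg _ e20; have [D De] := ag _ e20.
exists D => d dp Dd; have [c ce] := De d dp Dd; exists c.
have mf := mint fi; have mg := mint gi.
apply: (intD _ _ _ _ fge ce); last by lra.
- exact: measurable_funB.
- exact: measurable_funB.
- exact: measurable_funB.
- by move=> x Xx; apply: le_trans (ler_normD _ _); rewrite addrA subrK.
Qed.

Lemma approxfZ_indic (r : R) (U : set T) : approximable U ->
  approxf (fun x => r * \1_U x).
Proof.
move=> [mU aU].
have mrU : measurable_fun X (fun x => r * \1_U x).
  by apply: measurable_funM => //; exact/measurable_funTS/measurable_indic.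
split.
  apply: (@bounded_integrable _ _ _ _ _ mX Xfin _ `|r|) => //.
  move=> x _; rewrite normrM -[leRHS]mulr1 ler_wpM2l// indicE.
  by case: (x \in U); rewrite ?normr1 ?normr0.
move=> e e0; have e10 : 0 < e / (`|r| + 1) by rewrite divr_gt0// ltr_wpDl.
have [D De] := aU _ e10; exists D => d dp Dd; have [J Je] := De d dp Dd.
exists (fun i => r * (i \in J)%:R).
have mJ := measurable_cells J.
have mUJ := measurable_setY mU mJ.
apply: (@le_trans _ _ (\int[nu]_(x in X) (`|r|%:E * (\1_(U `+` cells J) x)%:E))%E).
  apply: ge0_le_integral => //.
  - by apply: mabs; apply: measurable_funB.
  - by apply/measurable_EFinP; apply: measurable_funM.
  move=> x Xx; rewrite -EFinM lee_fin.
  have [i _ Pix] : (\bigcup_i P (d := d) i) x by rewrite XP.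
  have JE : cells J x <-> J i.
    split=> [[j Jj Pjx]|Ji]; last by exists i.
    by have <- : j = i by apply: (tP (d := d)) => //; exists x.
  rewrite (stepsE _ Pix) -mulrBr normrM ler_wpM2l// !indicE.
  rewrite [x \in _ `+` _](_ : _ = (x \in U) (+) (i \in J)).
    by case: (x \in U); case: (i \in J); rewrite /= ?subrr ?subr0 ?sub0r ?normrN ?normr1 ?normr0.
  apply/idP/idP; rewrite inE setY_def.
    move=> -[] [/= h1 h2].
      by rewrite (mem_set h1) memNset// => /JE.
    by rewrite (memNset h2) mem_set//; exact/JE.
  case: (asboolP (U x)) => h1; case: (asboolP (J i)) => h2.
  - by rewrite !mem_set.
  - by left; split => // /JE.
  - by right; split => //; exact/JE.
  - by rewrite !memNset.
rewrite ge0_integralZl//; last first.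
  by apply/measurable_EFinP; exact/measurable_funTS/measurable_indic.
rewrite integral_indic// setIC.
apply: (@le_trans _ _ (`|r|%:E * (e / (`|r| + 1))%:E)%E); first exact: lee_wpmul2l.
rewrite -EFinM lee_fin mulrCA ler_piMr ?(ltW e0)//.
by rewrite ler_pdivrMr ?mul1r ?lerDl// ltr_wpDl.
Qed.

(** Simple functions are finite combinations of indicators of approximable sets, and they are dense
    in L^1. *)
Lemma approxf_integrable (f : T -> R) : measurable `<=` approximable ->
  nu.-integrable X (EFin \o f) -> approxf f.
Proof.
move=> mapx fi; apply: approxf_limit => // e e0.
have [g [gi _ /fine_cvgP[gfin]]] := approximation_sfun_integrable mX fi.
move=> /cvgrPdist_lt /(_ e e0) gc.
have [n [gn gl]] : exists n, (\int[nu]_(z in X) `|(EFin \o f) z - (g n z)%:E|)%E \is a fin_num /\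
   fine (\int[nu]_(z in X) `|(EFin \o f) z - (g n z)%:E|)%E < e.
  near \oo => n; exists n; split; first by near: n.
  have : `|0 - fine (\int[nu]_(z in X) `|(EFin \o f) z - (g n z)%:E|)%E| < e by near: n.
  by rewrite sub0r normrN ger0_norm// fine_ge0// integral_ge0.
exists (g n); last first.
  by rewrite -[X in (X <= _)%E]fineK ?lee_fin ?(ltW gl).
have -> : (g n : T -> R) = fun x =>
    \sum_(y <- finmap.enum_fset (fset_set (range (g n)))) (y * \1_(g n @^-1` [set y]) x).
  by apply/funext => x; rewrite {1}fimfunE fsbig_finite//=.
elim: (finmap.enum_fset _) => [|y s IH].
  rewrite (_ : (fun _ => _) = fun x => 0 * \1_set0 x).
    by apply: approxfZ_indic; exact: approximable0.
  by apply/funext => x; rewrite big_nil mul0r.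
rewrite (_ : (fun _ => _) = fun x => y * \1_(g n @^-1` [set y]) x +
    \sum_(y <- s) (y * \1_(g n @^-1` [set y]) x)).
  by apply: approxfD => //; apply: approxfZ_indic; apply: mapx.
by apply/funext => x; rewrite big_cons.
Unshelve. all: by end_near. Qed.
Lemma cell_sub d (i : I d) : (0 < d)%N -> P i `<=` X.
Proof. by move=> dp x Pix; rewrite -(XP dp); exists i. Qed.

Lemma integral_cells d (g : T -> \bar R) : (0 < d)%N -> measurable_fun X g ->
  (forall x, X x -> (0 <= g x)%E) ->
  (\int[nu]_(x in X) g x = \sum_(i : I d) \int[nu]_(x in P i) g x)%E.
Proof.
move=> dp mg g0.
have XE : X = \big[setU/set0]_(i <- index_enum (I d)) P i.
  rewrite -(XP dp) -bigcup_seq; apply: eq_bigcupl.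
  by split => i //= _; rewrite mem_index_enum.
rewrite [in LHS]XE ge0_integral_bigsetU//.
- exact: index_enum_uniq.
- by apply: sub_trivIset (tP (d := d)).
- by rewrite -XE.
- by rewrite -XE.
Qed.

(** On a cell, the distance between a constant c and the mean of f, times the volume, is at most the
    integral of |f - c|. Hence the averages do at most twice as badly as any other step function on
    the same cells, and it is enough to find a good one. *)
Lemma steps_average_close d (f : T -> R) (c : I d -> R) : (0 < d)%N ->
  nu.-integrable X (EFin \o f) ->
  (\int[nu]_(x in X) `|f x - steps (fun i : I d => average nu (P i) f) x|%:E <=
   2%:E * \int[nu]_(x in X) `|f x - steps c x|%:E)%E.
Proof.
move=> dp fi; have mf := mint fi.
rewrite !(@integral_cells d)//; first last.
- by apply: mabs; exact: measurable_funB.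
- by apply: mabs; exact: measurable_funB.
rewrite ge0_sume_distrr; last by move=> i _; apply: integral_ge0.
apply: lee_sum => i _.
have PX := cell_sub dp (i := i).
have fiP : nu.-integrable (P i) (EFin \o f) by exact: integrableS fi.
have Pfin : (nu (P i) < +oo)%E by apply: le_lt_trans Xfin; exact: le_nu.
have ci r : nu.-integrable (P i) (EFin \o (fun _ : T => r)).
  by apply: (@bounded_integrable _ _ _ _ _ (mP i) Pfin _ `|r|).
have fci r : nu.-integrable (P i) (EFin \o (fun x => f x - r)).
  exact: integrable_EFinB.
have nfci r : nu.-integrable (P i) (EFin \o (fun x => `|f x - r|)).
  exact: integrable_norm.
rewrite (eq_integral (fun x => `|f x - average nu (P i) f|%:E)); last first.
  by move=> x /[1!inE] Pix; rewrite (stepsE _ Pix).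
rewrite [in leRHS](eq_integral (fun x => `|f x - c i|%:E)); last first.
  by move=> x /[1!inE] Pix; rewrite (stepsE _ Pix).
set A := average nu (P i) f.
rewrite -[leLHS]fineK; last exact: (integrable_fin_num (mP i) (nfci A)).
rewrite -[in leRHS](@fineK _ (\int[nu]_(x in P i) _)%E); last first.
  exact: (integrable_fin_num (mP i) (nfci (c i))).
rewrite -EFinM lee_fin -!/(Rintegral _ _ _).
have H : `|c i - A| * fine (nu (P i)) <= \int[nu]_(x in P i) `|f x - c i|.
  (* On a null cell the average is a division by 0, but it is multiplied by the volume 0. *)
  have [n0|n0] := eqVneq (fine (nu (P i))) 0.
    by rewrite n0 mulr0; apply: Rintegral_ge0.
  have -> : `|c i - A| * fine (nu (P i)) = `|\int[nu]_(x in P i) (f x - c i)|.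
    rewrite RintegralB// Rintegral_cst// /A /average.
    rewrite -[X in _ * X = _]ger0_norm ?fine_ge0// -normrM -normrN; congr `|_|.
    by rewrite mulrBl divfK// opprB.
  exact: le_normr_Rintegral.
apply: (@le_trans _ _ (\int[nu]_(x in P i) (`|f x - c i| + `|c i - A|))).
  apply: le_Rintegral => //.
  - by apply: integrable_EFinD.
  - by move=> x _; apply: le_trans (ler_normD _ _); rewrite addrA subrK.
rewrite RintegralD// Rintegral_cst//; lra.
Qed.

Lemma average_cvg (f : T -> R) : measurable `<=` approximable ->
  nu.-integrable X (EFin \o f) ->
  forall e : R, 0 < e -> exists D, forall d, (0 < d)%N -> (D <= d)%N ->
    (\int[nu]_(x in X) `|f x - steps (fun i : I d => average nu (P i) f) x|%:E <= e%:E)%E.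
Proof.
move=> ap fi e e0; have e20 : 0 < e / 2 by rewrite divr_gt0.
have [_ /(_ _ e20)[D De]] := approxf_integrable ap fi.
exists D => d dp Dd; have [c ce] := De d dp Dd.
apply: le_trans (steps_average_close c dp fi) _.
apply: (@le_trans _ _ (2%:E * (e / 2)%:E)%E); first exact: lee_wpmul2l.
by rewrite -EFinM lee_fin mulrC divfK.
Qed.

End cell_approximation.

Section partition_averages.
Variables (R : realType) (m : nat).
Local Notation E := 'rV[R]_m.
Local Notation mu := (lebm R m).
Variables (a b : E) (Pt : forall d : nat, 'I_d -> set E).
Local Notation X := (box a b).
Hypothesis hP : hyperrect_partitions X Pt.

Lemma measurable_cell d (i : 'I_d) : measurable (Pt i).
Proof. exact: measurable_hyperrectangle (cell_hyperrect hP i). Qed.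

Lemma cell_subset d (i : 'I_d) : Pt i `<=` X.
Proof.
case: d i => [[]//|d] i x Pix.
by rewrite -(cell_cover hP (ltn0Sn d)); exists i.
Qed.

Lemma lebm_box_lty : (mu X < +oo)%E.
Proof.
case: (pselect (forall k, a ord0 k <= b ord0 k)) => [ab|]; first by rewrite lebm_box// ltry.
move=> /existsNP[k abk]; rewrite (_ : box a b = set0) ?measure0//.
apply/seteqP; split => x //= h; apply: abk; have /andP[h1 h2] := h k.
exact: le_trans h1 h2.
Qed.

Lemma cell_coord_le d (i : 'I_d) (x y : E) k : Pt i x -> Pt i y ->
  x ord0 k <= y ord0 k + mesh (@Pt d).
Proof.
move=> Px Py; rewrite -lerBlDl.
have coord_le (v : E) : v ord0 k <= eucl v.
  apply: le_trans (ler_norm _) _; rewrite -sqrtr_sqr ler_wsqrtr// (bigD1 k)//=.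
  by rewrite lerDl sumr_ge0// => j _; exact: sqr_ge0.
(* [diam] is a real supremum, which dominates its elements only once they are known to be bounded;
   the diagonal of the box bounds them. *)
have bnd : has_ubound [set eucl (p.1 - p.2) | p in Pt i `*` Pt i].
  exists (Num.sqrt (\sum_k (b ord0 k - a ord0 k) ^+ 2)).
  move=> _ [[u v] [/= /cell_subset Xu /cell_subset Xv] <-].
  rewrite ler_wsqrtr//; apply: ler_sum => j _; rewrite !mxE.
  rewrite -[leLHS]real_normK ?num_real// lerXn2r ?nnegrE//.
    by rewrite subr_ge0; have /andP[h1 h2] := Xu j; exact: le_trans h1 h2.
  have /andP[h1 h2] := Xu j; have /andP[h3 h4] := Xv j.
  by rewrite ler_norml; apply/andP; split; lra.
apply: (@le_trans _ _ (diam (Pt i))); last exact: le_bigmax.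
apply: (@le_trans _ _ (eucl (x - y))).
  by have := coord_le (x - y); rewrite !mxE.
by apply: sup_ubound => //; exists (x, y).
Qed.

Local Notation approxE := (approximable mu X (I := fun d => 'I_d) Pt).

(** The cells meeting the half-space overshoot it by at most the mesh, so the error lies in a slab
    around the hyperplane; these slabs decrease to a null set. *)
Lemma approximable_halfspace k (t : R) : approxE [set x | x ord0 k <= t].
Proof.
have mH (s : R) : measurable [set x : E | x ord0 k <= s].
  rewrite -[X in measurable X]setTI.
  by apply: (measurable_coord k measurableT (Y := [set u | u <= s])); rewrite -set_itvNyc.
split; first exact: mH.
move=> e e0.
pose K n := X `&` (fun x : E => x ord0 k) @^-1` `[t - n.+1%:R^-1, t + n.+1%:R^-1]%classic.
have mK n : measurable (K n).
  apply: measurableI; first exact: measurable_box.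
  rewrite -[X in measurable X]setTI.
  exact: (measurable_coord k measurableT (measurable_itv _)).
have KX n : (mu (K n) < +oo)%E.
  by apply: le_lt_trans lebm_box_lty; apply: le_nu => // [|x []//]; exact: measurable_box.
have ninv (n p : nat) : (n <= p)%N -> (p.+1%:R^-1 : R) <= n.+1%:R^-1.
  by move=> np; rewrite lef_pV2 ?posrE// ler_nat.
have mcapK : measurable (\bigcap_n K n) by exact: bigcapT_measurable.
have K0 : mu (\bigcap_n K n) = 0%E.
  apply/eqP; rewrite eq_le measure_ge0 andbT -(lebm_hyperplane k t); apply: le_nu => //.
    rewrite -[X in measurable X]setTI.
    exact: (measurable_coord k measurableT (measurable_set1 t)).
  move=> x h /=; apply/eqP; rewrite -subr_eq0 -normr_le0 leNgt; apply/negP => xt.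
  have [n _ /(_ n (leqnn n)) /= nx] : \forall n \near \oo, n.+1%:R^-1 < `|x ord0 k - t|.
    near=> n; near: n; exact: near_infty_natSinv_lt (PosNum xt).
  have [_ ] := h n Logic.I; rewrite /= in_itv /= => /andP[h1 h2].
  have : `|x ord0 k - t| <= n.+1%:R^-1 by rewrite ler_distl h1.
  by rewrite leNgt nx.
have /fine_cvgP[_] : mu (K n) @[n --> \oo] --> 0%E.
  rewrite -K0; apply: nonincreasing_cvg_mu => //; first exact: KX.
  move=> n p np; apply/subsetPset => x [Xx]; rewrite /= in_itv /= => /andP[h1 h2].
  split => //; rewrite /= in_itv /=; have h := ninv _ _ np; apply/andP; split.
    by apply: le_trans h1; rewrite lerD2l lerN2.
  by apply: (le_trans h2); rewrite lerD2l.
move=> /cvgrPdist_lt /(_ e e0) [n _ /(_ n (leqnn n))] /=.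
rewrite sub0r normrN ger0_norm ?fine_ge0// => Kn.
have n0 : 0 < n.+1%:R^-1 :> R by rewrite invr_gt0.
have /cvgrPdist_lt /(_ _ n0) [D _ De] := mesh_cvg0 hP.
exists D => d dp Dd; exists [set i | exists2 y, Pt i y & y ord0 k <= t].
have mJ := measurable_cells (I := fun d => 'I_d) measurable_cell.
apply: (@le_trans _ _ (mu (K n))); last first.
  by rewrite -[X in (X <= _)%E]fineK ?lee_fin ?(ltW Kn)// ge0_fin_numE.
have mesh_lt : mesh (@Pt d) < n.+1%:R^-1.
  have := De d Dd; rewrite /= sub0r normrN; apply: le_lt_trans; exact: ler_norm.
apply: le_nu => //.
  apply: measurableI; first exact: measurable_box.
  by apply: measurable_setY; [exact: mH|exact: mJ].
move=> x [Xx]; rewrite setY_def => h; split => //.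
have [i _ Pix] : (\bigcup_i Pt (d := d) i) x by rewrite (cell_cover hP).
have nt : t - n.+1%:R^-1 <= t by rewrite gerBl ltW.
rewrite /= in_itv /=; case: h => [[/= xt nJ]|[[j [y Pjy yt] Pjx] /negP]].
  by exfalso; apply: nJ; exists i => //; exists x.
rewrite -ltNge => tx.
have H := cell_coord_le k Pjx Pjy.
rewrite (le_trans nt (ltW tx))/=; apply: (le_trans H).
by rewrite lerD// ltW.
Unshelve. all: by end_near. Qed.

(** The sigma-algebra is generated by the coordinates, and that of R by the intervals ]u, v], whose
    preimages are obtained from half-spaces by complements and a union. *)
Lemma measurable_approximable : (@measurable _ E) `<=` approxE.
Proof.
have sA : sigma_algebra setT approxE.
  apply: sigma_algebra_approximable => //; first exact: measurable_box.
  - exact: lebm_box_lty.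
  - exact: measurable_cell.
  - exact: cell_disjoint hP.
  - by move=> d dp; exact: (cell_cover hP dp).
have [s0 sC sU] := sA.
apply: smallest_sub => // B; rewrite -bigcup_seq /= => -[k _ [C mC <-]].
rewrite setTI.
have sC' : sigma_algebra setT [set Y : set R | approxE ((fun v : E => v ord0 k) @^-1` Y)].
  split => /=; first by rewrite preimage_set0.
    by move=> A hA; rewrite setTD preimage_setC -setTD; exact: sC.
  by move=> F hF; rewrite preimage_bigcup; exact: sU.
suff : (@measurable _ (measurableTypeR R)) `<=`
  [set Y : set R | approxE ((fun v : E => v ord0 k) @^-1` Y)] by apply.
apply: smallest_sub => // Y [[u v] _ <-] /=.
rewrite (_ : _ @^-1` _ = ~` (~` [set x : E | x ord0 k <= v] `|` [set x | x ord0 k <= u])).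
  rewrite -setTD; apply: (sC); apply: approximableU => //; first exact: measurable_box.
    exact: measurable_cell.
  by rewrite -setTD; apply: (sC); exact: approximable_halfspace.
  exact: approximable_halfspace.
apply/seteqP; split => x /=; rewrite in_itv /=.
  move=> /andP[h1 h2] [|]; first by apply.
  by rewrite leNgt h1.
move=> /not_orP[/contrapT h1 /negP]; by rewrite -ltNge h1 => ->.
Qed.

Lemma trivIset_cells2 d :
  trivIset setT (fun ij : 'I_d * 'I_d => Pt ij.1 `*` Pt ij.2).
Proof.
move=> [i j] [i' j'] _ _ [[x y] [[/= h1 h2] [/= h3 h4]]].
have -> : i = i' by apply: (cell_disjoint hP) => //; exists x.
by have -> : j = j' by apply: (cell_disjoint hP) => //; exists y.
Qed.

Lemma cover_cells2 d : (0 < d)%N ->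
  \bigcup_(ij : 'I_d * 'I_d) (Pt ij.1 `*` Pt ij.2) = X `*` X.
Proof.
move=> dp; rewrite -[in RHS](cell_cover hP dp); apply/seteqP; split.
  by move=> [x y] [[i j] _ [/= h1 h2]]; split; [exists i|exists j].
by move=> [x y] [[i _ h1] [j _ h2]]; exists (i, j).
Qed.

Lemma lebm2_box_lty : ((mu \x mu)%E (X `*` X) < +oo)%E.
Proof.
have mX := measurable_box a b.
rewrite [X in (X < _)%E](product_measure1E mu mu mX mX).
by rewrite lte_mul_pinfty// ?ge0_fin_numE// lebm_box_lty.
Qed.

(** It suffices to treat rectangles U x V. Their error is covered by (error of U) x X and X x (error
    of V), each of measure at most mu(X) e / (2 (mu(X) + 1)). *)
Lemma measurable_approximable2 : (@measurable _ (E * E)%type) `<=`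
  approximable (mu \x mu)%E (X `*` X) (I := fun d => ('I_d * 'I_d)%type)
    (fun d ij => Pt ij.1 `*` Pt ij.2).
Proof.
have mX := measurable_box a b.
rewrite measurable_prod_measurableType; apply: smallest_sub.
  apply: sigma_algebra_approximable.
  - exact: measurableX.
  - exact: lebm2_box_lty.
  - by move=> d ij; apply: measurableX; exact: measurable_cell.
  - exact: trivIset_cells2.
  - exact: cover_cells2.
move=> _ [U mU] [V mV <-]; split; first exact: measurableX.
move=> e e0; pose M := fine (mu X); have M0 : 0 <= M by rewrite fine_ge0.
have ME : mu X = M%:E by rewrite fineK// ge0_fin_numE// lebm_box_lty.
have e20 : 0 < e / (2 * (M + 1)) by rewrite divr_gt0// mulr_gt0// ltr_wpDl.
have [_ /(_ _ e20)[D De]] := measurable_approximable mU.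
have [_ /(_ _ e20)[D' De']] := measurable_approximable mV.
exists (maxn D D') => d dp; rewrite geq_max => /andP[Dd Dd'].
have [J Je] := De d dp Dd; have [J' Je'] := De' d dp Dd'.
have mc := measurable_cells (I := fun d => 'I_d) measurable_cell.
have mXY (A B : set E) : measurable A -> measurable B -> measurable (X `&` (A `+` B)).
  by move=> mA mB; apply: measurableI => //; exact: measurable_setY.
exists (J `*` J').
have mcc : measurable (cells (T := (E * E)%type) (I := fun d => ('I_d * 'I_d)%type)
    (fun d ij => Pt ij.1 `*` Pt ij.2) (d := d) (J `*` J')).
  by apply: fin_bigcup_measurable => // ij _; apply: measurableX; exact: measurable_cell.
have m1 : measurable ((X `&` (U `+` cells Pt J)) `*` X).
  by apply: measurableX => //; exact: mXY.
have m2 : measurable (X `*` (X `&` (V `+` cells Pt J'))).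
  by apply: measurableX => //; exact: mXY.
apply: (@le_trans _ _ ((mu \x mu)%E (((X `&` (U `+` cells Pt J)) `*` X) `|`
    (X `*` (X `&` (V `+` cells Pt J')))))).
  apply: le_nu.
  - apply: measurableI; first exact: measurableX.
    by apply: measurable_setY => //; exact: measurableX.
  - exact: measurableU.
  rewrite !setY_def => -[x y] [[/= Xx Xy]].
  have -> : cells (T := (E * E)%type) (I := fun d => ('I_d * 'I_d)%type)
    (fun d ij => Pt ij.1 `*` Pt ij.2) (d := d) (J `*` J') = cells Pt J `*` cells Pt J'.
    apply/seteqP; split => [[u v] [[i j] [/= h1 h2] [/= h3 h4]]|[u v] [[i h1 h2] [j h3 h4]]].
      by split; [exists i|exists j].
    by exists (i, j).
  have cE : (cells Pt J `*` cells Pt J') (x, y) <-> cells Pt J x /\ cells Pt J' y by [].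
  by move: cE; case: (pselect (U x)); case: (pselect (V y)) => /=;
    case: (pselect (cells Pt J x)); case: (pselect (cells Pt J' y)); tauto.
apply: le_trans (measureU2 _ m1 m2) _.
rewrite [X in (X + _)%E]product_measure1E//; last exact: mXY.
rewrite [X in (_ + X)%E]product_measure1E//; last exact: mXY.
apply: (@le_trans _ _ ((e / (2 * (M + 1)))%:E * M%:E + M%:E * (e / (2 * (M + 1)))%:E)%E).
  by rewrite -ME; apply: leeD; [apply: lee_wpmul2r|apply: lee_wpmul2l].
rewrite -!EFinM -EFinD lee_fin; set q := e / _.
have qe : q * (2 * (M + 1)) = e by rewrite divfK// gt_eqF// mulr_gt0// ltr_wpDl.
by rewrite -qe; move: e20; rewrite -/q; nra.
Qed.

Lemma step2E d (f : E -> E -> R) (z : E * E) :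
  step2 (@Pt d) f z.1 z.2 = steps (fun d (ij : 'I_d * 'I_d) => Pt ij.1 `*` Pt ij.2)
    (I := fun d => ('I_d * 'I_d)%type)
    (fun ij : 'I_d * 'I_d => average (mu \x mu)%E (Pt ij.1 `*` Pt ij.2) (fun z => f z.1 z.2)) z.
Proof.
rewrite /step2 /steps pair_bigA /=; apply: eq_bigr => -[i j] _ /=.
by rewrite mulrC; congr (_ * _); rewrite !indicE in_setX -natrM mulnb.
Qed.

Lemma step2_cvg (f : E -> E -> R) :
  (mu \x mu)%E.-integrable (X `*` X) (EFin \o (fun z => f z.1 z.2)) ->
  forall e : R, 0 < e -> exists D, forall d, (0 < d)%N -> (D <= d)%N ->
    (\int[(mu \x mu)%E]_(z in X `*` X)
       `|f z.1 z.2 - step2 (@Pt d) f z.1 z.2|%:E <= e%:E)%E.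
Proof.
move=> fi e e0; have mX := measurable_box a b.
have [|||||D De] := average_cvg (nu := (mu \x mu)%E) (X := X `*` X)
  (I := fun d => ('I_d * 'I_d)%type) (P := fun d ij => Pt ij.1 `*` Pt ij.2)
   _ _ _ _ _ measurable_approximable2 fi e0.
- exact: measurableX.
- exact: lebm2_box_lty.
- by move=> d ij; apply: measurableX; exact: measurable_cell.
- exact: trivIset_cells2.
- exact: cover_cells2.
exists D => d dp Dd; apply: le_trans (De d dp Dd).
rewrite le_eqVlt; apply/orP; left; apply/eqP; apply: eq_integral => z _.
by rewrite step2E.
Qed.

End partition_averages.

(** * Kernels of the averaged operators *)

Section kernel_perturbation.
Context d (T : measurableType d) (R : realType).
Variables (mu : {sigma_finite_measure set T -> \bar R}) (X : set T).
Hypotheses (mX : measurable X) (Xfin : (mu X < +oo)%E).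
Variable C : R.
Hypothesis C0 : 0 <= C.

Definition bounded_kernel (k : T -> T -> R) :=
  [/\ measurable_fun setT (fun z => k z.1 z.2), forall x y, 0 <= k x y &
      forall x y, k x y <= C].

Local Notation B := (C * fine (mu X)).

Let B0 : 0 <= B. Proof. by rewrite mulr_ge0// fine_ge0. Qed.

(** T^(p+1) 1 lies below the constant C a_p, and the positive operator T^n preserves this
    inequality. The additional step is the one that makes the bound pointwise. *)
Lemma kmass_submul k n p : bounded_kernel k ->
  kmass mu X k (n + p).+1 <= C * kmass mu X k p * kmass mu X k n.
Proof.
move=> [mk k0 kC].
have ik q := integrable_kiter mX Xfin mk k0 kC q.
have H q x : kiter mu X k (q + p.+1) x <= C * kmass mu X k p * kiter mu X k q x.
  elim: q x => [|q IH] x.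
    by rewrite add0n /= mulr1; exact: (kiterS_le mX Xfin mk k0 kC).
  rewrite addSn /= /kop -RintegralZl//; last exact: (integrable_kernelM mX mk k0 kC).
  apply: le_Rintegral => //.
  - exact: (integrable_kernelM mX mk k0 kC).
  - exact/(integrable_EFinZl mX)/(integrable_kernelM mX mk k0 kC).
  - by move=> y _; rewrite mulrCA ler_wpM2l.
rewrite -addnS /kmass -RintegralZl//; apply: le_Rintegral => //.
exact: integrable_EFinZl.
Qed.

(** This is n B^(n-1): replacing the kernel in an n-fold product one factor at a time produces n
    terms. *)
Fixpoint perturbation_factor n : R :=
  if n is p.+1 then B ^+ p + B * perturbation_factor p else 0.

Lemma perturbation_factor_ge0 n : 0 <= perturbation_factor n.
Proof. by elim: n => //= n IH; apply: addr_ge0; [exact: exprn_ge0|exact: mulr_ge0]. Qed.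

(** In k1 e1 - k2 e2 = (k1 - k2) e1 + k2 (e1 - e2), with e1 and e2 the n-th iterates, L^1 closeness
    of the kernels suffices for the first term because e1 <= B^n; the second is handled by induction
    and k2 <= C. *)
Lemma kiter_perturbation k1 k2 (D : R) : bounded_kernel k1 -> bounded_kernel k2 -> 0 <= D ->
  (\int[mu]_(x in X) \int[mu]_(y in X) `|k1 x y - k2 x y|%:E <= D%:E)%E ->
  forall n, \int[mu]_(x in X) `|kiter mu X k1 n x - kiter mu X k2 n x| <=
    perturbation_factor n * D.
Proof.
move=> [mk1 k10 k1C] [mk2 k20 k2C] D0 kD.
pose k x y : R := `|k1 x y - k2 x y|.
have mk : measurable_fun setT (fun z => k z.1 z.2).
  by apply: measurableT_comp => //; exact: measurable_funB.
have k0 x y : 0 <= k x y by exact: normr_ge0.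
have kC x y : k x y <= C.
  by rewrite /k ler_norml; have := k10 x y; have := k20 x y;
     have := k1C x y; have := k2C x y => *; apply/andP; split; lra.
have i1 n := integrable_kiter mX Xfin mk1 k10 k1C n.
have i2 n := integrable_kiter mX Xfin mk2 k20 k2C n.
have id n : mu.-integrable X (EFin \o (fun x => kiter mu X k1 n x - kiter mu X k2 n x)).
  exact: integrable_EFinB.
have ind n := integrable_norm (id n).
have iop : mu.-integrable X (EFin \o kop mu X k (cst 1)).
  exact: (integrable_kiter mX Xfin mk k0 kC 1).
have opD : \int[mu]_(x in X) kop mu X k (cst 1) x <= D.
  rewrite -lee_fin fineK ?integrable_fin_num//; apply: le_trans kD.
  rewrite le_eqVlt; apply/orP; left; apply/eqP; apply: eq_integral => x _.
  rewrite (kopE mX mk k0 kC); last exact: (integrable_kiter mX Xfin mk k0 kC 0).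
  by apply: eq_integral => y _; rewrite mulr1.
elim=> [|n IH].
  rewrite mul0r (@eq_Rintegral _ _ _ mu X (cst 0)) ?Rintegral_cst ?mul0r// => x _ /=.
  by rewrite subrr normr0.
set L := \int[mu]_(x in X) `|_| in IH.
have ik x : mu.-integrable X (EFin \o (fun y => k x y * cst 1 y)).
  by apply: (integrable_kernelM mX mk k0 kC); exact: (integrable_kiter mX Xfin mk k0 kC 0).
have pw x : `|kiter mu X k1 n.+1 x - kiter mu X k2 n.+1 x| <=
    B ^+ n * kop mu X k (cst 1) x + C * L.
  have j1 := integrable_kernelM mX mk1 k10 k1C x (i1 n).
  have j2 := integrable_kernelM mX mk2 k20 k2C x (i2 n).
  have iBk := integrable_EFinZl mX (B ^+ n) (ik x).
  have iCd := integrable_EFinZl mX C (ind n).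
  have -> : B ^+ n * kop mu X k (cst 1) x = \int[mu]_(y in X) (B ^+ n * (k x y * cst 1 y)).
    by rewrite RintegralZl//; exact: ik.
  have -> : C * L = \int[mu]_(y in X) (C * `|kiter mu X k1 n y - kiter mu X k2 n y|).
    by rewrite RintegralZl//; exact: ind.
  rewrite -RintegralD//= /kop -RintegralB//.
  have j12 := integrable_EFinB mX j1 j2.
  apply: le_trans (le_normr_Rintegral mX j12) _; apply: le_Rintegral => //.
  - exact: integrable_norm.
  - exact: integrable_EFinD.
  move=> y _; rewrite mulr1.
  have -> : k1 x y * kiter mu X k1 n y - k2 x y * kiter mu X k2 n y =
    (k1 x y - k2 x y) * kiter mu X k1 n y + k2 x y * (kiter mu X k1 n y - kiter mu X k2 n y).
    ring.
  apply: le_trans (ler_normD _ _) _; rewrite !normrM; apply: lerD.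
    rewrite mulrC ler_wpM2r// ger0_norm ?kiter_ge0//.
    by have [] := kiter_le mX Xfin mk1 k10 k1C n y.
  by rewrite ler_wpM2r// ger0_norm.
have iL : mu.-integrable X (EFin \o (fun _ : T => C * L)).
  exact: (@bounded_integrable _ _ _ _ _ mX Xfin _ `|C * L|).
have iBk := integrable_EFinZl mX (B ^+ n) iop.
apply: (@le_trans _ _ (\int[mu]_(x in X) (B ^+ n * kop mu X k (cst 1) x + C * L))).
  by apply: le_Rintegral => //; [exact: (ind n.+1)|exact: integrable_EFinD].
rewrite RintegralD// RintegralZl// Rintegral_cst//= mulrDl; apply: lerD.
  by rewrite ler_wpM2l// exprn_ge0.
by rewrite mulrAC -[leRHS]mulrA ler_wpM2l.
Qed.

Lemma kmass_perturbation k1 k2 (D : R) : bounded_kernel k1 -> bounded_kernel k2 -> 0 <= D ->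
  (\int[mu]_(x in X) \int[mu]_(y in X) `|k1 x y - k2 x y|%:E <= D%:E)%E ->
  forall n, kmass mu X k1 n <= kmass mu X k2 n + perturbation_factor n * D.
Proof.
move=> b1 b2 D0 kD n; have := kiter_perturbation b1 b2 D0 kD n.
case: b1 => mk1 k10 k1C; case: b2 => mk2 k20 k2C.
have i1 := integrable_kiter mX Xfin mk1 k10 k1C n.
have i2 := integrable_kiter mX Xfin mk2 k20 k2C n.
have id := integrable_EFinB mX i1 i2.
rewrite -lerBlDl /kmass -RintegralB// => H; apply: le_trans H.
apply: le_trans (ler_norm _) _; exact: le_normr_Rintegral.
Qed.

(* Submultiplicativity reduces the uniform growth bound to finitely many n,
   where closeness of the kernels in L^1 suffices. *)
Lemma kmass_growth_stable (k : T -> T -> R) (K : nat -> T -> T -> R) (A q r : R) :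
  bounded_kernel k -> (forall n, bounded_kernel (K n)) -> 0 < q -> q < r -> 0 <= A ->
  (forall n, kmass mu X k n <= A * q ^+ n) ->
  (forall e : R, 0 < e -> exists D, forall d, (0 < d)%N -> (D <= d)%N ->
    (\int[mu]_(x in X) \int[mu]_(y in X) `|K d x y - k x y|%:E <= e%:E)%E) ->
  exists D (A' : R), 0 <= A' /\ forall d, (0 < d)%N -> (D <= d)%N ->
    forall n, kmass mu X (K d) n <= A' * r ^+ n.
Proof.
move=> bk bK q0 qr A0 kA cK; have r0 : 0 < r by exact: lt_trans qr.
(* For the limit kernel C a_N stays below half of r^(N+1); the other half is left for the
   perturbation. *)
have [N HN] : exists N, C * (A * q ^+ N) < r ^+ N.+1 / 2.
  have qr1 : `|q / r| < 1 by rewrite ger0_norm ?divr_ge0 ?ltW// ltr_pdivrMr// mul1r.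
  have e0 : 0 < r / 2 / (C * A + 1) by rewrite !divr_gt0// ltr_wpDl// mulr_ge0.
  have /cvgrPdist_lt /(_ _ e0)[N _ /(_ N (leqnn N))] := cvg_expr qr1.
  rewrite sub0r normrN normrX ger0_norm ?divr_ge0 ?ltW// ltr_pdivlMr; last first.
    by rewrite ltr_wpDl// mulr_ge0.
  move=> H; exists N; have rN : 0 < r ^+ N by exact: exprn_gt0.
  have qN : q ^+ N = (q / r) ^+ N * r ^+ N by rewrite expr_div_n divfK ?gt_eqF.
  have x0 : 0 <= (q / r) ^+ N by rewrite exprn_ge0// divr_ge0// ltW.
  rewrite qN exprS; move: H x0 rN; move: (_ ^+ N) (r ^+ N) => x y H x0 y0.
  have H' : C * A * x < r / 2 by lra.
  have -> : C * (A * (x * y)) = (C * A * x) * y by ring.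
  by have -> : r * y / 2 = r / 2 * y; [field|rewrite ltr_pM2r].
have e0 : 0 < r ^+ N.+1 / 2 / (C * perturbation_factor N + 1).
  by rewrite !divr_gt0 ?exprn_gt0// ltr_wpDl// mulr_ge0// perturbation_factor_ge0.
have [D De] := cK _ e0.
(* With this constant, A' r^n dominates the crude bound mu(X) B^n for all n <= N. *)
pose A' := \sum_(i < N.+1) fine (mu X) * B ^+ i / r ^+ i.
have term0 i : 0 <= fine (mu X) * B ^+ i / r ^+ i.
  by rewrite !mulr_ge0 ?fine_ge0 ?invr_ge0 ?exprn_ge0// ltW.
have A'0 : 0 <= A' by apply: sumr_ge0 => i _.
exists D, A'; split => // d0 d0p Dd.
have [mK K0 KC] := bK d0.
have HNd : C * kmass mu X (K d0) N <= r ^+ N.+1.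
  have := kmass_perturbation (bK d0) bk (ltW e0) (De _ d0p Dd) N.
  have := kA N; set x := r ^+ N.+1; set e := _ / _; set p := perturbation_factor N.
  move=> h1 h2; have p0 : 0 <= p by exact: perturbation_factor_ge0.
  have ex : e * (C * p + 1) = x / 2 by rewrite divfK// gt_eqF// ltr_wpDl// mulr_ge0.
  have pe : C * (p * e) <= x / 2.
    by rewrite -ex mulrDr mulr1 mulrA [leLHS]mulrC lerDl ltW.
  apply: (@le_trans _ _ (C * (A * q ^+ N) + C * (p * e))).
    by rewrite -mulrDr ler_wpM2l//; apply: le_trans h2 _; rewrite lerD2r.
  by rewrite [leRHS](splitr x); apply: lerD; [exact: ltW|].
elim/ltn_ind => n IH; have [nN|Nn] := leqP n N.
  apply: le_trans (kmass_le mX Xfin mK K0 KC n) _.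
  rewrite -ler_pdivrMr ?exprn_gt0//.
  by rewrite /A' (bigD1 (Ordinal (nN : (n < N.+1)%N)))//= lerDl sumr_ge0.
(* Beyond N, removing N + 1 steps costs the factor C a_N <= r^(N+1). *)
have nE : n = ((n - N.+1) + N).+1 by rewrite -addnS subnK.
rewrite [in leLHS]nE; apply: le_trans (kmass_submul _ _ (bK d0)) _.
apply: (@le_trans _ _ (r ^+ N.+1 * (A' * r ^+ (n - N.+1)))).
  apply: ler_pM => //; [by rewrite mulr_ge0// kmass_ge0|exact: kmass_ge0|].
  by apply: IH; rewrite ltn_subrL (leq_trans _ Nn).
by rewrite mulrCA -exprD addnC subnK.
Qed.

End kernel_perturbation.

Section fubini_product.
Context d0 d1 d2 (T0 : measurableType d0) (T1 : measurableType d1)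
  (T2 : measurableType d2) (R : realType).
Variables (m0 : {sigma_finite_measure set T0 -> \bar R})
  (m1 : {sigma_finite_measure set T1 -> \bar R})
  (m2 : {sigma_finite_measure set T2 -> \bar R}).

Lemma sigma_finite_product : sigma_finite setT (m1 \x m2)%E.
Proof.
have /sigma_finiteP[F [TF ndF Foo]] := sigma_finiteT m1.
have /sigma_finiteP[G [TG ndG Goo]] := sigma_finiteT m2.
exists (fun n => F n `*` G n).
  rewrite -setXTT TF TG predeqE => -[x y]; split.
    move=> [/= [n _ Fnx] [k _ Gky]]; exists (maxn n k) => //; split.
    - by move: x Fnx; exact/subsetPset/ndF/leq_maxl.
    - by move: y Gky; exact/subsetPset/ndG/leq_maxr.
  by move=> [n _ []/= ? ?]; split; exists n.
move=> k; have [? ?] := Foo k; have [? ?] := Goo k.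
split; first exact: measurableX.
by rewrite product_measure1E// lte_mul_pinfty// ge0_fin_numE.
Qed.

(* The library does not register products as sigma-finite measures, which its
   Tonelli theorem requires for an iterated integral over T0 and T1 * T2. *)
Let m12 : {sigma_finite_measure set (T1 * T2)%type -> \bar R} :=
  HB.pack (m1 \x m2)%E (Measure_isSigmaFinite.Build _ _ _ (m1 \x m2)%E sigma_finite_product).

Variable f : T0 * (T1 * T2) -> \bar R.
Hypotheses (mf : measurable_fun setT f) (f0 : forall u, (0 <= f u)%E).

Lemma measurable_integral_product :
  measurable_fun setT (fun w => \int[(m1 \x m2)%E]_z f (w, z))%E.
Proof. exact: (measurable_fun_fubini_tonelli_F (m2 := m12)). Qed.

Lemma tonelli_product : (\int[m0]_w \int[(m1 \x m2)%E]_z f (w, z) =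
  \int[(m1 \x m2)%E]_z \int[m0]_w f (w, z))%E.
Proof. exact: (fubini_tonelli (m1 := m0) (m2 := m12)). Qed.

End fubini_product.

Section parameter_kernels.
Variables (R : realType) (m : nat) (a b : 'rV[R]_m).
Context (dM : measure_display) (M : measurableType dM) (Q : probability M R).
Variable th : hawkes_param R m M.
Variable Pt : forall d : nat, 'I_d -> set 'rV[R]_m.
Local Notation E := 'rV[R]_m.
Local Notation mu := (lebm R m).
Local Notation X := (box a b).
Local Notation XX := (X `*` X).
Hypothesis hG : graphon_assumptions Q X th.
Hypothesis hP : hyperrect_partitions X Pt.

Let mX : measurable X := measurable_box a b.
Let mXX : measurable XX := measurableX mX mX.

(** The hypotheses control the parameters on X * X only. Extension by 0 makes them measurable,
    nonnegative and, for the weight and the mean impact, bounded on the whole space, as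
    [bounded_kernel] demands. *)
Definition weightX (x y : E) : R := ((fun z : E * E => weight th z.1 z.2) \_ XX) (x, y).

Definition impactX (w : M) (z : E * E) : R :=
  ((fun u : M * (E * E) => impact th u.1 u.2.1 u.2.2) \_ (setT `*` XX)) (w, z).

Definition mimpactX (x y : E) : R := fine (\int[Q]_w (impactX w (x, y))%:E)%E.

Lemma weightXE x y : X x -> X y -> weightX x y = weight th x y.
Proof. by move=> Xx Xy; rewrite /weightX patchE mem_set. Qed.

Lemma impactXE w z : XX z -> impactX w z = impact th w z.1 z.2.
Proof. by move=> Xz; rewrite /impactX patchE mem_set. Qed.

Lemma measurable_weightX : measurable_fun setT (fun z => weightX z.1 z.2).
Proof.
rewrite (_ : (fun _ => _) = (fun z : E * E => weight th z.1 z.2) \_ XX).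
  apply/(measurable_restrictT _ mXX); exact: (weight_measurable hG).
by apply/funext => -[].
Qed.

Lemma measurable_impactX : measurable_fun setT (fun u => impactX u.1 u.2).
Proof.
rewrite (_ : (fun _ => _) = (fun u : M * (E * E) => impact th u.1 u.2.1 u.2.2) \_ (setT `*` XX)).
  have mT := measurableX (@measurableT _ M) mXX.
  by apply/(measurable_restrictT _ mT); exact: (impact_measurable hG).
by apply/funext => -[].
Qed.

Lemma weightX_ge0 x y : 0 <= weightX x y.
Proof.
rewrite /weightX patchE; case: ifPn => //; rewrite inE => -[/= Xx Xy].
exact: (weight_ge0 hG).
Qed.

Lemma impactX_ge0 w z : 0 <= impactX w z.
Proof.
rewrite /impactX patchE; case: ifPn => //; rewrite inE => -[_ [/= Xx Xy]].
exact: (impact_ge0 hG).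
Qed.

Lemma mimpactX_ge0 x y : 0 <= mimpactX x y.
Proof. by apply: fine_ge0; apply: integral_ge0 => w _; rewrite lee_fin impactX_ge0. Qed.

Lemma measurable_mimpactX : measurable_fun setT (fun z => mimpactX z.1 z.2).
Proof.
apply: measurableT_comp => //.
rewrite (_ : (fun _ => _) = fubini_G Q (fun u : M * (E * E) => (impactX u.1 u.2)%:E)).
  apply: measurable_fun_fubini_tonelli_G; last by move=> u; rewrite lee_fin impactX_ge0.
  by apply/measurable_EFinP; exact: measurable_impactX.
by apply/funext => -[].
Qed.

Lemma mean_impactE x y : X x -> X y ->
  mean_impact Q th x y = (\int[Q]_w (impactX w (x, y))%:E)%E.
Proof.
move=> Xx Xy; rewrite /mean_impact unlock; apply: eq_integral => w _.
by rewrite impactXE.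
Qed.

Lemma param_bounds : exists2 C, 0 <= C &
  [/\ forall x y, weightX x y <= C, forall x y, mimpactX x y <= C &
      forall x y, (\int[Q]_w (impactX w (x, y))%:E <= C%:E)%E].
Proof.
have [CW hW] := weight_bounded hG; have [CB hB] := impact_bounded hG.
pose C := Num.max 0 (Num.max CW CB); have C0 : 0 <= C by rewrite le_max lexx.
have hI x y : (\int[Q]_w (impactX w (x, y))%:E <= C%:E)%E.
  case: (pselect (X x /\ X y)) => [[Xx Xy]|nXX].
    rewrite -mean_impactE//; apply: le_trans (hB _ _ Xx Xy) _.
    by rewrite lee_fin !le_max lexx !orbT.
  rewrite integral0_eq// => w _; rewrite /impactX patchE memNset//.
  by move=> -[_ /= [/= Xx Xy]]; apply: nXX.
exists C => //; split => // x y.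
  rewrite /weightX patchE; case: ifPn => //; rewrite inE => -[/= Xx Xy].
  by apply: le_trans (hW _ _ Xx Xy) _; rewrite !le_max lexx orbT.
rewrite -lee_fin fineK// ge0_fin_numE; first by apply: le_lt_trans (hI x y) _; rewrite ltry.
by apply: integral_ge0 => w _; rewrite lee_fin impactX_ge0.
Qed.

Lemma mimpactXE x y : (mimpactX x y)%:E = (\int[Q]_w (impactX w (x, y))%:E)%E.
Proof.
have [C C0 [_ _ hI]] := param_bounds.
rewrite fineK// ge0_fin_numE; first by apply: le_lt_trans (hI x y) _; rewrite ltry.
by apply: integral_ge0 => w _; rewrite lee_fin impactX_ge0.
Qed.

Lemma fine_mean_impact x y : X x -> X y -> fine (mean_impact Q th x y) = mimpactX x y.
Proof. by move=> Xx Xy; rewrite mean_impactE// /mimpactX. Qed.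

Definition cellavg d (i j : 'I_d) (f : E -> E -> R) : R :=
  average (mu \x mu)%E (Pt i `*` Pt j) (fun z => f z.1 z.2).

Lemma step2_cell d (f : E -> E -> R) (i j : 'I_d) x y : Pt i x -> Pt j y ->
  step2 (@Pt d) f x y = cellavg i j f.
Proof.
move=> Px Py; have := @step2E _ _ Pt d f (x, y) => /= ->.
exact: (@stepsE _ _ _ (fun d => ('I_d * 'I_d)%type)
  (fun d ij => Pt ij.1 `*` Pt ij.2) (trivIset_cells2 hP) d _ (i, j)).
Qed.

Lemma step2_out d (f : E -> E -> R) x y : ~ (X x /\ X y) -> step2 (@Pt d) f x y = 0.
Proof.
move=> nXX; rewrite /step2 big1// => i _; rewrite big1// => j _.
rewrite !indicE; case: (asboolP (Pt i x)) => Px; last by rewrite memNset// !mul0r.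
case: (asboolP (Pt j y)) => Py; last by rewrite [y \in _]memNset// mulr0 mul0r.
by exfalso; apply: nXX; split; [exact: (cell_subset hP Px)|exact: (cell_subset hP Py)].
Qed.

Let mPP d (i j : 'I_d) : measurable (Pt i `*` Pt j).
Proof. by apply: measurableX; exact: (measurable_cell hP). Qed.

Let PPX d (i j : 'I_d) : Pt i `*` Pt j `<=` XX.
Proof.
by move=> [x y] [/= Px Py]; split; [exact: (cell_subset hP Px)|exact: (cell_subset hP Py)].
Qed.

Let bint2 (D : set (E * E)) (f : E -> E -> R) (c : R) : measurable D -> D `<=` XX ->
  measurable_fun setT (fun z => f z.1 z.2) ->
  (forall x y, 0 <= f x y) -> (forall x y, f x y <= c) ->
  (mu \x mu)%E.-integrable D (EFin \o (fun z => f z.1 z.2)).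
Proof.
move=> mD DX mf f0 fc; apply: (@bounded_integrable _ _ _ _ _ mD _ _ c).
- by apply: le_lt_trans (lebm2_box_lty a b); exact: le_nu.
- exact: measurable_funTS.
- by move=> z _; rewrite ger0_norm.
Qed.

Lemma eq_cellavg d (i j : 'I_d) (f g : E -> E -> R) :
  (forall x y, X x -> X y -> f x y = g x y) -> cellavg i j f = cellavg i j g.
Proof.
move=> fg; congr (_ / _); apply: eq_Rintegral => z /[1!inE] /PPX [/= Xx Xy].
exact: fg.
Qed.

Lemma cellavg_bounds d (i j : 'I_d) (f : E -> E -> R) (c : R) : 0 <= c ->
  measurable_fun setT (fun z => f z.1 z.2) ->
  (forall x y, 0 <= f x y) -> (forall x y, f x y <= c) -> 0 <= cellavg i j f <= c.
Proof.
move=> c0 mf f0 fc; have V0 := fine_ge0 (measure_ge0 (mu \x mu)%E (Pt i `*` Pt j)).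
apply/andP; split; first by rewrite divr_ge0// Rintegral_ge0.
have [V00|Vn0] := eqVneq (fine ((mu \x mu)%E (Pt i `*` Pt j))) 0.
  by rewrite /cellavg /average V00 invr0 mulr0.
rewrite /cellavg /average ler_pdivrMr; last by rewrite lt_neqAle eq_sym Vn0.
rewrite -Rintegral_cst//; apply: le_Rintegral => //.
  exact: (bint2 (mPP i j) (@PPX _ i j) mf f0 fc).
exact: (@bint2 _ (fun _ _ => c) c (mPP i j) (@PPX _ i j)).
Qed.

(** The cell enters as an indicator because Tonelli is applied to integrals over whole spaces. *)
Let cell_impact d (i j : 'I_d) (u : M * (E * E)) : \bar R :=
  (impactX u.1 u.2 * \1_(Pt i `*` Pt j) u.2)%:E.

Let measurable_cell_impact d (i j : 'I_d) : measurable_fun setT (cell_impact i j).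
Proof.
apply/measurable_EFinP; apply: measurable_funM; first exact: measurable_impactX.
have mI : measurable_fun setT (\1_(Pt i `*` Pt j) : E * E -> R).
  by apply: measurable_indic; exact: mPP.
exact: (measurableT_comp mI measurable_snd).
Qed.

Let cell_impact_ge0 d (i j : 'I_d) u : (0 <= cell_impact i j u)%E.
Proof. by rewrite lee_fin mulr_ge0// impactX_ge0. Qed.

Let cell_impactE d (i j : 'I_d) w : (\int[(mu \x mu)%E]_z cell_impact i j (w, z) =
  \int[(mu \x mu)%E]_(z in Pt i `*` Pt j) (impactX w z)%:E)%E.
Proof.
rewrite [RHS]integral_mkcond; apply: eq_integral => z _; rewrite /cell_impact patchE indicE /=.
by case: ifPn; rewrite ?mulr1 ?mulr0.
Qed.

Let cellavg_impactE d (i j : 'I_d) w : cellavg i j (impact th w) =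
  (fine ((mu \x mu)%E (Pt i `*` Pt j)))^-1 *
  fine (\int[(mu \x mu)%E]_z cell_impact i j (w, z))%E.
Proof.
rewrite mulrC cell_impactE; congr (_ / _).
by apply: eq_Rintegral => z /[1!inE] /PPX Xz; rewrite impactXE.
Qed.

Lemma measurable_cellavg_impact d (i j : 'I_d) :
  measurable_fun setT (fun w => cellavg i j (impact th w)).
Proof.
have mF := @measurable_cell_impact d i j; have F0 := @cell_impact_ge0 d i j.
have mg : measurable_fun setT (fun w => \int[(mu \x mu)%E]_z cell_impact i j (w, z))%E.
  exact: measurable_integral_product mF F0.
under eq_fun do rewrite cellavg_impactE.
by apply: measurable_funM => //; exact: measurableT_comp.
Qed.

(** By Tonelli, the mean over the marks and the average over the cell commute. A single realization
    may have an infinite integral over the cell, which [fine] sends to 0, but finiteness of the mean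
    confines this to a null set of marks. *)
Lemma mean_cellavg d (i j : 'I_d) :
  (\int[Q]_w (cellavg i j (impact th w))%:E = (cellavg i j mimpactX)%:E)%E.
Proof.
set D := Pt i `*` Pt j; set V := fine ((mu \x mu)%E D).
have [C C0 [_ mC hI]] := param_bounds.
pose F := cell_impact i j.
have mF : measurable_fun setT F := measurable_cell_impact i j.
have F0 : forall u, (0 <= F u)%E := @cell_impact_ge0 d i j.
pose g w := (\int[(mu \x mu)%E]_z F (w, z))%E.
have mg : measurable_fun setT g by exact: measurable_integral_product mF F0.
have g0 w : (0 <= g w)%E by apply: integral_ge0.
have ig : (\int[Q]_w g w = \int[(mu \x mu)%E]_(z in D) (mimpactX z.1 z.2)%:E)%E.
  rewrite (tonelli_product Q mu mu mF F0) [RHS]integral_mkcond.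
  apply: eq_integral => -[x y] _; rewrite patchE; case: ifPn => zD.
    by rewrite mimpactXE; apply: eq_integral => w _; rewrite /F /cell_impact indicE zD mulr1.
  by rewrite integral0_eq// => w _; rewrite /F /cell_impact indicE (negbTE zD) mulr0.
have imi : (mu \x mu)%E.-integrable D (EFin \o (fun z => mimpactX z.1 z.2)).
  exact: (bint2 (mPP i j) (@PPX _ i j) measurable_mimpactX mimpactX_ge0 mC).
have fig : (\int[Q]_w g w)%E \is a fin_num by rewrite ig; exact: (integrable_fin_num (mPP i j) imi).
have intg : Q.-integrable setT g.
  apply/integrableP; split => //; under eq_integral do rewrite gee0_abs//.
  by rewrite -ge0_fin_numE// integral_ge0.
have -> : (\int[Q]_w (cellavg i j (impact th w))%:E = \int[Q]_w ((V^-1)%:E * (fine (g w))%:E))%E.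
  by apply: eq_integral => w _; rewrite cellavg_impactE.
have mfg : measurable_fun setT (fun w => (fine (g w))%:E).
  by apply/measurable_EFinP; exact: measurableT_comp.
have V0 : 0 <= V^-1 by rewrite invr_ge0 fine_ge0.
rewrite ge0_integralZl//; [|by move=> w _; rewrite lee_fin fine_ge0].
have -> : (\int[Q]_w (fine (g w))%:E = \int[Q]_w g w)%E.
  apply: ae_eq_integral => //.
  have := integrable_ae measurableT intg; apply: filterS => w /= h _.
  by rewrite fineK//; exact: h.
by rewrite ig -[X in (_ * X)%E]fineK ?(integrable_fin_num (mPP i j) imi)// -EFinM mulrC.
Qed.

Lemma mean_impact_averaged d x y : X x -> X y ->
  mean_impact Q (averaged (@Pt d) th) x y = (step2 (@Pt d) mimpactX x y)%:E.
Proof.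
move=> Xx Xy; have [->|dp] := posnP d.
  by rewrite /mean_impact unlock /= /step2; under eq_integral do rewrite big_ord0;
    rewrite big_ord0 integral0_eq.
have [i _ Px] : (\bigcup_i Pt (d := d) i) x by rewrite (cell_cover hP).
have [j _ Py] : (\bigcup_i Pt (d := d) i) y by rewrite (cell_cover hP).
rewrite /mean_impact unlock (step2_cell _ Px Py) -mean_cellavg.
by apply: eq_integral => w _ /=; rewrite (step2_cell _ Px Py).
Qed.

Definition intensity x y : R := mimpactX x y * weightX x y.

(** A product of two averages, and not the average of [intensity]; its convergence must therefore
    come from that of the factors. *)
Definition averaged_intensity d x y : R :=
  step2 (@Pt d) mimpactX x y * step2 (@Pt d) weightX x y.

Definition hawkes_kernel x y : R := normL1_exc th * intensity x y.

Definition averaged_kernel d x y : R := normL1_exc th * averaged_intensity d x y.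

Lemma normL1_exc_ge0 : 0 <= normL1_exc th.
Proof. by apply: Rintegral_ge0. Qed.

Lemma measurable_step2 d (f : E -> E -> R) :
  measurable_fun setT (fun z => step2 (@Pt d) f z.1 z.2).
Proof.
apply: (eq_measurable_fun (steps (fun d (ij : 'I_d * 'I_d) => Pt ij.1 `*` Pt ij.2)
    (I := fun d => ('I_d * 'I_d)%type) (d := d)
    (fun ij : 'I_d * 'I_d => cellavg ij.1 ij.2 f))).
  by move=> z _; rewrite step2E.
by apply: measurable_steps => d' ij; exact: mPP.
Qed.

Lemma step2_bounds d (f : E -> E -> R) (c : R) : 0 <= c ->
  measurable_fun setT (fun z => f z.1 z.2) ->
  (forall x y, 0 <= f x y) -> (forall x y, f x y <= c) ->
  forall x y, 0 <= step2 (@Pt d) f x y <= c.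
Proof.
move=> c0 mf f0 fc x y; have [->|dp] := posnP d; first by rewrite /step2 big_ord0 lexx.
case: (pselect (X x /\ X y)) => [[Xx Xy]|nXX]; last by rewrite step2_out// lexx.
have [i _ Px] : (\bigcup_i Pt (d := d) i) x by rewrite (cell_cover hP).
have [j _ Py] : (\bigcup_i Pt (d := d) i) y by rewrite (cell_cover hP).
by rewrite (step2_cell _ Px Py); exact: cellavg_bounds.
Qed.

Lemma intensities_bounded : exists2 C, 0 <= C &
  bounded_kernel C intensity /\ forall d, bounded_kernel C (averaged_intensity d).
Proof.
have [C C0 [wC mC _]] := param_bounds.
exists (C * C); first by rewrite !mulr_ge0.
split.
  split.
  - by apply: measurable_funM; [exact: measurable_mimpactX|exact: measurable_weightX].
  - by move=> x y; rewrite mulr_ge0// ?mimpactX_ge0// weightX_ge0.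
  - by move=> x y; rewrite ler_pM// ?mimpactX_ge0// weightX_ge0.
move=> d.
have s1 := step2_bounds d C0 measurable_mimpactX mimpactX_ge0 mC.
have s2 := step2_bounds d C0 measurable_weightX weightX_ge0 wC.
split.
- by apply: measurable_funM; exact: measurable_step2.
- move=> x y; have /andP[a1 _] := s1 x y; have /andP[a2 _] := s2 x y.
  by rewrite mulr_ge0.
- move=> x y; have /andP[a1 a1'] := s1 x y; have /andP[a2 a2'] := s2 x y.
  by rewrite ler_pM.
Qed.

Lemma bounded_kernelZ (C c : R) (k : E -> E -> R) : 0 <= c -> bounded_kernel C k ->
  bounded_kernel (c * C) (fun x y : E => c * k x y).
Proof.
move=> c0 [mk k0 kC]; split.
- exact: measurable_funM.
- by move=> x y; rewrite mulr_ge0.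
- by move=> x y; rewrite ler_wpM2l.
Qed.

Lemma kernels_bounded : exists2 C, 0 <= C &
  bounded_kernel C hawkes_kernel /\ forall d, bounded_kernel C (averaged_kernel d).
Proof.
have [C C0 [b1 b2]] := intensities_bounded; have H0 := normL1_exc_ge0.
exists (normL1_exc th * C); first exact: mulr_ge0.
by split=> [|d]; apply: bounded_kernelZ.
Qed.

Let kopZ (C c : R) (k : E -> E -> R) f x : bounded_kernel C k -> mu.-integrable X (EFin \o f) ->
  kop mu X (fun x y => c * k x y) f x = c * \int[mu]_(y in X) (k x y * f y).
Proof.
move=> [mk k0 kC] fi; rewrite /kop -RintegralZl//; last exact: (integrable_kernelM mX mk k0 kC).
by apply: eq_Rintegral => y _; rewrite mulrA.
Qed.

Lemma ThomE f x : mu.-integrable X (EFin \o f) -> X x ->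
  Thom Q X th f x = kop mu X hawkes_kernel f x.
Proof.
move=> fi Xx; have [C C0 [b1 _]] := intensities_bounded.
rewrite (kopZ _ _ b1 fi); congr (_ * _); apply: eq_Rintegral => y /[1!inE] Xy.
by rewrite fine_mean_impact// /intensity weightXE.
Qed.

Lemma Thom_averagedE d f x : mu.-integrable X (EFin \o f) -> X x ->
  Thom Q X (averaged (@Pt d) th) f x = kop mu X (averaged_kernel d) f x.
Proof.
move=> fi Xx; have [C C0 [_ b2]] := intensities_bounded.
have -> : kop mu X (averaged_kernel d) f x =
    normL1_exc th * \int[mu]_(y in X) (averaged_intensity d x y * f y).
  exact: (kopZ _ _ (b2 d) fi).
rewrite /Thom -[normL1_exc (averaged _ _)]/(normL1_exc th); apply: congr1.
apply: eq_Rintegral => y.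
rewrite inE => Xy.
rewrite mean_impact_averaged// /averaged_intensity /=; congr (_ * _ * _).
have [->|dp] := posnP d; first by rewrite /step2 !big_ord0.
have [i _ Px] : (\bigcup_i Pt (d := d) i) x by rewrite (cell_cover hP).
have [j _ Py] : (\bigcup_i Pt (d := d) i) y by rewrite (cell_cover hP).
by rewrite !(step2_cell _ Px Py); apply: eq_cellavg => u v Xu Xv; rewrite weightXE.
Qed.

(** Both factors are at most C and converge in L^1. The difference of the products is at most C
    times the sum of the two errors, hence the choice of [e']; adding 1 keeps its denominator
    positive. *)
Lemma averaged_kernel_cvg (e : R) : 0 < e -> exists D, forall d, (0 < d)%N -> (D <= d)%N ->
  (\int[mu]_(x in X) \int[mu]_(y in X) `|averaged_kernel d x y - hawkes_kernel x y|%:E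
     <= e%:E)%E.
Proof.
move=> e0; have [C C0 [wC mC _]] := param_bounds; have H0 := normL1_exc_ge0.
set H := normL1_exc th in H0 *.
pose e' := e / (2 * (H * C + 1)).
have HC1 : 0 < 2 * (H * C + 1) by rewrite mulr_gt0// ltr_wpDl// mulr_ge0.
have e'0 : 0 < e' by rewrite divr_gt0.
have iw := bint2 mXX (@subset_refl _ XX) measurable_weightX weightX_ge0 wC.
have im := bint2 mXX (@subset_refl _ XX) measurable_mimpactX mimpactX_ge0 mC.
have [D De] := step2_cvg hP iw e'0; have [D' De'] := step2_cvg hP im e'0.
exists (maxn D D') => d dp; rewrite geq_max => /andP[/(De d dp) we /(De' d dp) me].
pose F (z : E * E) := `|averaged_kernel d z.1 z.2 - hawkes_kernel z.1 z.2|.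
have [C2 C20 [[mk _ _] /(_ d)[mkd _ _]]] := kernels_bounded.
have mF : measurable_fun setT F.
  by apply: measurableT_comp => //; exact: measurable_funB.
have mF1 : measurable_fun setT (fun z => (F z * \1_XX z)%:E).
  by apply/measurable_EFinP/measurable_funM => //; exact: measurable_indic.
have F10 z : (0 <= (F z * \1_XX z)%:E)%E by rewrite lee_fin mulr_ge0// normr_ge0.
have -> : (\int[mu]_(x in X) \int[mu]_(y in X)
    `|averaged_kernel d x y - hawkes_kernel x y|%:E =
    \int[(mu \x mu)%E]_(z in XX) (F z)%:E)%E.
  transitivity (\int[(mu \x mu)%E]_z (F z * \1_XX z)%:E)%E; last first.
    rewrite [RHS]integral_mkcond; apply: eq_integral => z _; rewrite patchE indicE.
    by case: ifPn; rewrite ?mulr1 ?mulr0.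
  rewrite (fubini_tonelli1 _ mF1 F10) [LHS]integral_mkcond; apply: eq_integral => x _.
  rewrite patchE /fubini_F; case: ifPn => Xx.
    rewrite [LHS]integral_mkcond; apply: eq_integral => y _.
    rewrite patchE /F /= indicE in_setX /= Xx.
    by case: ifPn; rewrite ?mulr1 ?mulr0.
  by rewrite integral0_eq// => y _; rewrite indicE in_setX /= (negbTE Xx) mulr0.
have mw := measurable_weightX; have mm := measurable_mimpactX.
have msw := measurable_step2 d weightX; have msm := measurable_step2 d mimpactX.
have mabs (f g : E * E -> R) : measurable_fun setT f -> measurable_fun setT g ->
    measurable_fun XX (fun z => `|f z - g z|%:E).
  move=> mf mg; apply: measurable_funTS; apply/measurable_EFinP.
  by apply: measurableT_comp => //; exact: measurable_funB.
apply: (@le_trans _ _ (\int[(mu \x mu)%E]_(z in XX)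
   ((H * C)%:E * (`|weightX z.1 z.2 - step2 (@Pt d) weightX z.1 z.2|%:E +
                  `|mimpactX z.1 z.2 - step2 (@Pt d) mimpactX z.1 z.2|%:E)))%E).
  apply: ge0_le_integral => //.
  - by move=> z _; rewrite lee_fin normr_ge0.
  - by apply: measurable_funTS; exact/measurable_EFinP.
  - apply: measurable_funeM; apply: emeasurable_funD.
      exact: (mabs _ _ mw msw).
    exact: (mabs _ _ mm msm).
  move=> [x y] _; rewrite -EFinD -EFinM lee_fin /F /=.
  rewrite /averaged_kernel /hawkes_kernel -/H -mulrBr normrM (ger0_norm H0) -mulrA ler_wpM2l//.
  rewrite /averaged_intensity /intensity.
  have /andP[s0 sC] := step2_bounds d C0 mm mimpactX_ge0 mC x y.
  have w0 := weightX_ge0 x y; have wC' := wC x y.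
  move: (step2 _ mimpactX x y) (step2 _ weightX x y) s0 sC => p q p0 pC.
  have -> : p * q - mimpactX x y * weightX x y =
    - (p * (weightX x y - q) + weightX x y * (mimpactX x y - p)) by ring.
  rewrite normrN; apply: le_trans (ler_normD _ _) _; rewrite [leRHS]mulrDr !normrM.
  by apply: lerD; rewrite ler_wpM2r// ger0_norm.
rewrite ge0_integralZl//; last 3 first.
- apply: emeasurable_funD; first exact: (mabs _ _ mw msw).
  exact: (mabs _ _ mm msm).
- by move=> z _; rewrite adde_ge0// lee_fin normr_ge0.
- by rewrite lee_fin mulr_ge0.
have nn (f : E * E -> R) z : XX z -> (0 <= `|f z|%:E)%E by rewrite lee_fin normr_ge0.
rewrite ge0_integralD; [|exact: mXX|exact: (nn (fun z => _ - _))
  |exact: (mabs _ _ mw msw)|exact: (nn (fun z => _ - _))|exact: (mabs _ _ mm msm)].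
apply: (@le_trans _ _ ((H * C)%:E * (e'%:E + e'%:E))%E).
  apply: lee_wpmul2l; first by rewrite lee_fin mulr_ge0.
  by apply: leeD; [exact: we|exact: me].
rewrite -EFinD -EFinM lee_fin.
have e'E : e' * (2 * (H * C + 1)) = e by rewrite divfK// gt_eqF.
rewrite -e'E; have : 0 <= H * C by exact: mulr_ge0.
by move: (H * C) e'0 => u u0; nra.
Qed.

Lemma averaged_growth (q r : R) : 0 < q -> q < r ->
  (forall s, q <= s -> resolvent_set X (Thom Q X th) (Complex s 0)) ->
  exists D (A : R), 0 <= A /\ forall d, (0 < d)%N -> (D <= d)%N ->
    forall n, kmass mu X (averaged_kernel d) n <= A * r ^+ n.
Proof.
move=> q0 qr hres; have [C C0 [bk bkd]] := kernels_bounded.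
have Xfin := lebm_box_lty a b; case: (bk) => mk k0 kC.
have [|A A0 kA] := kmass_growth mX Xfin mk k0 kC q0.
  move=> s qs; apply: (resolvent_set_bound mX Xfin mk k0 kC _ (hres s qs)).
  by move=> f fi x Xx; exact: ThomE.
exact: (kmass_growth_stable mX Xfin C0 bk bkd q0 qr A0 kA averaged_kernel_cvg).
Qed.
End parameter_kernels.

(** * Spectrum of the averaged operators *)

Section finite_rank_operator.
Variables (R : realType) (m : nat).
Local Notation E := 'rV[R]_m.
Local Notation mu := (lebm R m).
Local Notation C := (complex R).
Local Notation normc := ComplexField.Normc.normc.
Variables (X : set E) (mX : measurable X) (Xfin : (mu X < +oo)%E).
Variables (d : nat) (P : 'I_d -> set E).
Hypotheses (mP : forall i, measurable (P i)) (tP : trivIset setT P).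
Hypothesis XP : \bigcup_i P i = X.
Variable kk : 'I_d -> 'I_d -> R.
Hypothesis kk0 : forall i j, 0 <= kk i j.

Let ncD (a b : C) : normc (a + b) <= normc a + normc b. Proof. exact: le_normcD. Qed.

Let ncM (a b : C) : normc (a * b) = normc a * normc b.
Proof. exact: ComplexField.Normc.normcM. Qed.

Let nc0 (c : C) : 0 <= normc c. Proof. by case: c => ? ? /=; exact: sqrtr_ge0. Qed.

Let ncR (c : R) : 0 <= c -> normc c%:C%C = c.
Proof. by move=> c0 /=; rewrite expr0n /= addr0 sqrtr_sqr ger0_norm. Qed.

Let nc_sum (I : Type) (s : seq I) (F : I -> C) :
  normc (\sum_(i <- s) F i) <= \sum_(i <- s) normc (F i).
Proof.
elim/big_rec2 : _ => [|j a b _ h]; first by rewrite ComplexField.Normc.normc0.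
by apply: le_trans (ncD _ _) _; rewrite lerD2l.
Qed.

Let nc_le (p q : R) : normc (Complex p q) <= `|p| + `|q|.
Proof.
have -> : Complex p q = Complex p 0 + Complex 0 q.
  by apply/eqP; rewrite eq_complex /= addr0 add0r !eqxx.
by apply: le_trans (ncD _ _) _ => /=; rewrite expr0n /= addr0 add0r !sqrtr_sqr.
Qed.

Local Notation vol i := (fine (mu (P i))).

(** The constant value of T^n 1 on the cell i when T has the kernel values [kk] (see
    [kiter_averaged]). *)
Fixpoint cmass (n : nat) (i : 'I_d) : R :=
  if n is p.+1 then \sum_j kk i j * (vol j * cmass p j) else 1.

Lemma cmass_ge0 n i : 0 <= cmass n i.
Proof.
elim: n i => [|n IH] i //=; apply: sumr_ge0 => j _.
by rewrite !mulr_ge0 ?fine_ge0.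
Qed.

Let PX i : P i `<=` X. Proof. by move=> x Px; rewrite -XP; exists i. Qed.

Let Pfin i : mu (P i) \is a fin_num.
Proof. by rewrite ge0_fin_numE//; apply: le_lt_trans Xfin; exact: le_nu. Qed.

Let iP i (f : E -> R) : mu.-integrable X (EFin \o f) -> mu.-integrable (P i) (EFin \o f).
Proof. by move=> fi; exact: integrableS fi. Qed.

Lemma Rintegral_cells (f : E -> R) : mu.-integrable X (EFin \o f) ->
  \int[mu]_(x in X) f x = \sum_i \int[mu]_(x in P i) f x.
Proof.
move=> fi; have /integrableP[mf _] := fi.
have XE : X = \big[setU/set0]_(i <- index_enum 'I_d) P i.
  rewrite -XP -bigcup_seq; apply: eq_bigcupl.
  by split => i //= _; rewrite mem_index_enum.
rewrite /Rintegral [in LHS]XE integral_bigsetU_EFin//.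
- rewrite -sum_fine//; first by move=> i _; exact/integrable_fin_num/iP.
- exact: index_enum_uniq.
- by apply: sub_trivIset tP.
- by rewrite -XE.
Qed.

Lemma measurable_cellsum (c : 'I_d -> R) :
  measurable_fun setT (fun x : E => \sum_i c i * \1_(P i) x).
Proof. by apply: measurable_sum => i; apply: measurable_funM. Qed.

Lemma cellsumE (c : 'I_d -> R) i x : P i x -> \sum_j c j * \1_(P j) x = c i.
Proof.
move=> Pix; rewrite (bigD1 i)//= indicE mem_set// mulr1 big1 ?addr0// => j ji.
rewrite indicE memNset ?mulr0// => Pjx; move/eqP: ji; apply.
by apply: tP => //; exists x.
Qed.

Lemma integrable_cellsum (c : 'I_d -> R) :
  mu.-integrable X (EFin \o (fun x : E => \sum_i c i * \1_(P i) x)).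
Proof.
apply: (@bounded_integrable _ _ _ _ _ mX Xfin _ (\sum_i `|c i|)).
  by apply: measurable_funTS; exact: measurable_cellsum.
move=> x _; apply: le_trans (ler_norm_sum _ _ _) _; apply: ler_sum => i _.
rewrite normrM -[leRHS]mulr1 ler_wpM2l// indicE.
by case: (_ \in _); rewrite ?normr1 ?normr0.
Qed.

Let cint (i : 'I_d) (f : E -> C) : C :=
  Complex (\int[mu]_(x in P i) complex.Re (f x)) (\int[mu]_(x in P i) complex.Im (f x)).

Let L1C_D f g : in_L1C X f -> in_L1C X g -> in_L1C X (fun x => f x + g x).
Proof.
move=> [f1 f2] [g1 g2]; split.
  apply: eq_integrable (integrable_EFinD mX f1 g1) => // x _ /=.
  by case: (f x) => ? ?; case: (g x).
apply: eq_integrable (integrable_EFinD mX f2 g2) => // x _ /=.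
by case: (f x) => ? ?; case: (g x).
Qed.

Let L1C_Z (a : C) f : in_L1C X f -> in_L1C X (fun x => a * f x).
Proof.
case: a => a b [f1 f2]; split.
  apply: eq_integrable (integrable_EFinB mX (integrable_EFinZl mX a f1)
    (integrable_EFinZl mX b f2)) => // x _ /=.
  by case: (f x).
apply: eq_integrable (integrable_EFinD mX (integrable_EFinZl mX a f2)
  (integrable_EFinZl mX b f1)) => // x _ /=.
by case: (f x).
Qed.

Let cint_D i f g : in_L1C X f -> in_L1C X g -> cint i (fun x => f x + g x) = cint i f + cint i g.
Proof.
move=> [/(iP i) f1 /(iP i) f2] [/(iP i) g1 /(iP i) g2].
rewrite /cint; apply/eqP; rewrite eq_complex /=; apply/andP; split; apply/eqP;
  rewrite -RintegralD//; apply: eq_Rintegral => x _; by case: (f x) => ? ?; case: (g x).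
Qed.

Let cint_Z i (a : C) f : in_L1C X f -> cint i (fun x => a * f x) = a * cint i f.
Proof.
case: a => a b [/(iP i) f1 /(iP i) f2]; rewrite /cint.
have [a1 a2] := (integrable_EFinZl (mP i) a f1, integrable_EFinZl (mP i) a f2).
have [b1 b2] := (integrable_EFinZl (mP i) b f1, integrable_EFinZl (mP i) b f2).
apply/eqP; rewrite eq_complex /= -!RintegralZl//; apply/andP; split; apply/eqP.
  by rewrite -RintegralB//; apply: eq_Rintegral => x _; case: (f x).
by rewrite -RintegralD//; apply: eq_Rintegral => x _; case: (f x).
Qed.

Let cint_cst i (v : C) : cint i (fun _ => v) = (vol i)%:C%C * v.
Proof.
rewrite /cint !Rintegral_cst//; case: v => v w /=; apply/eqP; rewrite eq_complex /=.
by rewrite !mul0r subr0 addr0 ![_ * vol i]mulrC !eqxx.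
Qed.

Let eq_cint i (f g : E -> C) : (forall x, P i x -> f x = g x) -> cint i f = cint i g.
Proof.
by move=> fg; rewrite /cint; congr Complex; apply: eq_Rintegral => x /[1!inE] Px; rewrite fg.
Qed.

Let L1C_cells (v : 'I_d -> C) : exists2 s : E -> C, in_L1C X s & forall i x, P i x -> s x = v i.
Proof.
exists (fun x => Complex (\sum_i complex.Re (v i) * \1_(P i) x)
  (\sum_i complex.Im (v i) * \1_(P i) x)).
  by split; exact: integrable_cellsum.
by move=> i x Px; rewrite !(cellsumE _ Px); case: (v i).
Qed.

Variable T : (E -> R) -> (E -> R).
Hypothesis TE : forall f i x, mu.-integrable X (EFin \o f) -> P i x ->
  T f x = \sum_j kk i j * \int[mu]_(y in P j) f y.

Let complexifyE (f : E -> C) i x : in_L1C X f -> P i x ->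
  complexify T f x = \sum_j (kk i j)%:C%C * cint j f.
Proof.
move=> [f1 f2] Px; rewrite /complexify (TE f1 Px) (TE f2 Px).
elim/big_rec3 : _ => [|j a b c _ <-]; first by [].
by apply/eqP; rewrite eq_complex /= !mul0r subr0 addr0 !eqxx.
Qed.

Variables (A r : R).
Hypotheses (r0 : 0 < r) (A0 : 0 <= A).
Hypothesis massA : forall n i, cmass n i <= A * r ^+ n.

(** Comparison with the nonnegative matrix: iterating the equation bounds |z|^n |u_i| by N
    [cmass n i] <= N A r^n, which is impossible for large n when |z| > r and u_i is nonzero. *)
Lemma cmass_eigenvector_eq0 (z : C) (u : 'I_d -> C) : r < normc z ->
  (forall i, z * u i = \sum_j (kk i j * vol j)%:C%C * u j) -> forall i, u i = 0.
Proof.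
move=> rz zu.
have z0 : 0 < normc z by exact: lt_trans rz.
pose N := \sum_i normc (u i); have N0 : 0 <= N by apply: sumr_ge0.
have key n i : normc z ^+ n * normc (u i) <= N * cmass n i.
  elim: n i => [|n IH] i.
    by rewrite expr0 mul1r mulr1 /N (bigD1 i)//= lerDl sumr_ge0.
  rewrite exprSr -mulrA -ncM zu /=.
  apply: (@le_trans _ _ (normc z ^+ n * \sum_j (kk i j * vol j) * normc (u j))).
    rewrite ler_wpM2l ?exprn_ge0//.
    apply: le_trans (nc_sum _ _) _; apply: ler_sum => j _.
    by rewrite ncM ncR// mulr_ge0// fine_ge0.
  rewrite !mulr_sumr; apply: ler_sum => j _.
  rewrite mulrCA [X in _ <= _ * X]mulrA [leRHS]mulrCA ler_wpM2l//.
  by rewrite mulr_ge0// fine_ge0.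
move=> i; apply: ComplexField.Normc.eq0_normc; apply/eqP; rewrite eq_le nc0 andbT leNgt.
apply/negP => ui0.
have NA0 : 0 < N * A + 1 by rewrite ltr_wpDl// mulr_ge0.
have q1 : `|r / normc z| < 1.
  by rewrite ger0_norm ?divr_ge0 ?ltW// ltr_pdivrMr// mul1r.
have e0 : 0 < normc (u i) / (N * A + 1) by rewrite divr_gt0.
have /cvgrPdist_lt /(_ _ e0) [n _ /(_ n (leqnn n))] := cvg_expr q1.
rewrite sub0r normrN normrX ger0_norm ?divr_ge0 ?ltW// ltr_pdivlMr// => H.
have : normc (u i) <= N * A * (r / normc z) ^+ n.
  rewrite expr_div_n mulrA ler_pdivlMr ?exprn_gt0// mulrC.
  by apply: le_trans (key n i) _; rewrite -mulrA ler_wpM2l.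
rewrite leNgt => /negP; apply; apply: le_lt_trans H.
by rewrite mulrDr mulr1 mulrC lerDl exprn_ge0// divr_ge0// ltW.
Qed.

Let eq_cint_ae i (f g : E -> C) : in_L1C X f -> in_L1C X g ->
  {ae mu, forall x, P i x -> f x = g x} -> cint i f = cint i g.
Proof.
move=> [/(iP i)/integrableP[f1 _] /(iP i)/integrableP[f2 _]].
move=> [/(iP i)/integrableP[g1 _] /(iP i)/integrableP[g2 _]] fg.
by rewrite /cint; congr Complex; congr fine; apply: ae_eq_integral => //;
  move: fg; apply: filterS => x /= h Px; rewrite h.
Qed.

Let cell_of x : X x -> exists i, P i x.
Proof. by rewrite -XP => -[i _ Px]; exists i. Qed.

Lemma integrable_normc (f : E -> C) : in_L1C X f ->
  mu.-integrable X (EFin \o (fun x => normc (f x))).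
Proof.
move=> Lf; have mn := measurable_normc Lf; have [f1 f2] := Lf.
have n1 := integrable_norm f1; have n2 := integrable_norm f2.
apply: (le_integrable mX _ _ (integrable_EFinD mX n1 n2)); first exact/measurable_EFinP.
move=> x _ /=; rewrite lee_fin ger0_norm// [leRHS]ger0_norm ?addr_ge0//.
by case: (f x) => p q; exact: nc_le.
Qed.

(* Above the growth rate z - T is injective on step functions, hence invertible
   there, and z f = g + T f with T f a step function yields the resolvent. *)
Lemma finite_rank_resolvent (z : C) : r < normc z -> resolvent_set X T z.
Proof.
move=> rz; have z0 : 0 < normc z by exact: lt_trans rz.
have zn0 : z != 0.
  by apply/eqP => ze; move: z0; rewrite ze ComplexField.Normc.normc0 ltxx.
have eig := cmass_eigenvector_eq0 rz.
split.
  (* The vectors are rows multiplied from the left, so the matrix of z - T on step functions appears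
     transposed. *)
  pose Bm : 'M[C]_d := z%:M - \matrix_(j, i) (kk i j * vol j)%:C%C.
  have uB (u : 'rV[C]_d) i : (u *m Bm) ord0 i =
      z * u ord0 i - \sum_j (kk i j * vol j)%:C%C * u ord0 j.
    rewrite mulmxBr mul_mx_scalar !mxE; congr (_ - _).
    by apply: eq_bigr => j _; rewrite mxE mulrC.
  have Bu : Bm \in unitmx.
    rewrite -row_free_unit; apply: inj_row_free => u uB0.
    apply/rowP => i; rewrite mxE; apply: (eig (fun i => u ord0 i)) => {}i.
    by apply/eqP; rewrite -subr_eq0 -uB uB0 mxE.
  (* The norm of g controls v through the entries of the inverse matrix; the factor 2 comes from
     bounding a modulus by the real and imaginary parts. *)
  pose c1 := \sum_i \sum_l (\sum_j kk l j * 2) * normc (invmx Bm l i).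
  exists ((normc z)^-1 * (1 + c1 * fine (mu X))) => g Lg.
  (* Here h holds the cell values of T g. If z f = g + s with s = T f, the cell values v of s must
     satisfy z v = h + (T applied to v), that is, v = h [Bm]^-1. *)
  pose h : 'rV[C]_d := \row_i \sum_j (kk i j)%:C%C * cint j g.
  pose v := h *m invmx Bm.
  have vB : v *m Bm = h by rewrite -mulmxA mulVmx// mulmx1.
  have [s Ls sE] := L1C_cells (fun i => v ord0 i).
  have Lgs := L1C_D Lg Ls.
  pose f x := z^-1 * (g x + s x); have Lf : in_L1C X f := L1C_Z z^-1 Lgs.
  exists f; split => //.
    apply: aeW => x /cell_of[i Px]; rewrite (complexifyE Lf Px) /f mulVKf// (sE _ _ Px).
    have -> : \sum_j (kk i j)%:C%C * cint j f = v ord0 i.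
      apply: (mulfI zn0); have := congr1 (fun M : 'rV[C]_d => M ord0 i) vB.
      rewrite uB => /eqP; rewrite subr_eq => /eqP ->.
      rewrite [h ord0 i]mxE mulr_sumr -big_split /=; apply: eq_bigr => j _.
      rewrite (cint_Z _ _ Lgs) (cint_D _ Lg Ls) (eq_cint (sE j)) cint_cst.
      by rewrite mulrCA mulVKf// mulrDr rmorphM mulrA.
    by rewrite addrK.
  pose G := \int[mu]_(x in X) normc (g x).
  have ig := integrable_normc Lg.
  have GE : normL1C X g = G%:E by rewrite /G fineK//; exact: (integrable_fin_num mX ig).
  have G0 : 0 <= G by apply: Rintegral_ge0 => x _.
  have partG (p : E -> R) j : mu.-integrable X (EFin \o p) ->
      (forall x, `|p x| <= normc (g x)) -> `|\int[mu]_(x in P j) p x| <= G.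
    move=> ip pg; apply: le_trans (le_normr_Rintegral (mP j) (iP j ip)) _.
    have nip := integrable_norm ip.
    apply: (@le_trans _ _ (\int[mu]_(x in P j) normc (g x))).
      by apply: le_Rintegral => //; [exact: (iP j nip)|exact: (iP j ig)].
    rewrite /G Rintegral_cells// (bigD1 j)//= lerDl sumr_ge0// => i _.
    by apply: Rintegral_ge0.
  have cintG j : normc (cint j g) <= 2 * G.
    have [g1 g2] := Lg.
    have p1 : `|\int[mu]_(x in P j) complex.Re (g x)| <= G.
      apply: (partG _ j g1) => x /=; case: (g x) => p q /=.
      by rewrite -sqrtr_sqr ler_wsqrtr// lerDl sqr_ge0.
    have p2 : `|\int[mu]_(x in P j) complex.Im (g x)| <= G.
      apply: (partG _ j g2) => x /=; case: (g x) => p q /=.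
      by rewrite -sqrtr_sqr ler_wsqrtr// lerDr sqr_ge0.
    rewrite /cint; move: (Rintegral _ _ _) (Rintegral _ _ _) p1 p2 => p q p1 p2.
    apply: le_trans (nc_le _ _) _.
    lra.
  have vG : \sum_i normc (v ord0 i) <= c1 * G.
    rewrite /c1 mulr_suml; apply: ler_sum => i _; rewrite mxE.
    apply: le_trans (nc_sum _ _) _; rewrite mulr_suml; apply: ler_sum => l _.
    rewrite ncM mulrAC ler_wpM2r// mxE; apply: le_trans (nc_sum _ _) _.
    rewrite mulr_suml; apply: ler_sum => j _.
    by rewrite ncM ncR// -mulrA ler_wpM2l.
  have zi : normc z^-1 = (normc z)^-1 by exact: ComplexField.Normc.normcV.
  pose V := \sum_i normc (v ord0 i).
  have V0 : 0 <= V by apply: sumr_ge0.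
  have iV : mu.-integrable X (EFin \o (fun _ : E => V)).
    exact: (@bounded_integrable _ _ _ _ _ mX Xfin _ `|V|).
  have igV := integrable_EFinD mX ig iV.
  have izgV := integrable_EFinZl mX (normc z)^-1 igV.
  rewrite GE -EFinM /normL1C -[X in (X <= _)%E]fineK; last first.
    exact: (integrable_fin_num mX (integrable_normc Lf)).
  rewrite lee_fin.
  apply: (@le_trans _ _ (\int[mu]_(x in X) ((normc z)^-1 * (normc (g x) + V)))).
    apply: le_Rintegral => //; first exact: integrable_normc.
    move=> x Xx; rewrite /f ncM zi ler_wpM2l ?invr_ge0//.
    apply: le_trans (ncD _ _) _; rewrite lerD2l; have [i Px] := cell_of Xx.
    by rewrite (sE _ _ Px) /V (bigD1 i)//= lerDl sumr_ge0.
  rewrite RintegralZl// RintegralD// Rintegral_cst// -mulrA ler_wpM2l ?invr_ge0//.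
  rewrite mulrDl mul1r lerD2l mulrAC ler_wpM2r ?fine_ge0//.
move=> f Lf zf.
(* A solution of z f = T f is almost everywhere a step function, and the cell values u of T f
   satisfy the eigenvalue equation. *)
pose u i := \sum_j (kk i j)%:C%C * cint j f.
have zfu : {ae mu, forall x, forall i, P i x -> z * f x = u i}.
  move: zf; apply: filterS => x /= h i Px; have := h (PX Px).
  by rewrite (complexifyE Lf Px) => /eqP; rewrite subr_eq0 => /eqP.
have [s Ls sE] := L1C_cells u.
have zcint i : z * cint i f = (vol i)%:C%C * u i.
  rewrite -(cint_Z _ _ Lf) -cint_cst -(eq_cint (sE i)).
  apply: (eq_cint_ae (L1C_Z z Lf) Ls).
  by move: zfu; apply: filterS => x /= h Px; rewrite (h i)// (sE _ _ Px).
have u0 : forall i, u i = 0.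
  apply: eig => i; rewrite {1}/u mulr_sumr; apply: eq_bigr => j _.
  by rewrite mulrCA zcint mulrA rmorphM.
move: zfu; apply: filterS => x /= h /cell_of[i Px].
by have /eqP := h i Px; rewrite u0 mulf_eq0 (negbTE zn0) /= => /eqP.
Qed.

End finite_rank_operator.

Section averaged_operator.
Variables (R : realType) (m : nat) (a b : 'rV[R]_m).
Context (dM : measure_display) (M : measurableType dM) (Q : probability M R).
Variable th : hawkes_param R m M.
Variable Pt : forall d : nat, 'I_d -> set 'rV[R]_m.
Local Notation E := 'rV[R]_m.
Local Notation mu := (lebm R m).
Local Notation X := (box a b).
Hypothesis hG : graphon_assumptions Q X th.
Hypothesis hP : hyperrect_partitions X Pt.

Let mX : measurable X := measurable_box a b.
Let Xfin : (mu X < +oo)%E := lebm_box_lty a b.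

Definition cell_kernel d (i j : 'I_d) : R := normL1_exc th *
  (cellavg Pt i j (mimpactX a b Q th) * cellavg Pt i j (weightX a b th)).

Lemma averaged_kernel_cell d (i j : 'I_d) x y : Pt i x -> Pt j y ->
  averaged_kernel a b Q th Pt d x y = cell_kernel i j.
Proof.
by move=> Px Py; rewrite /averaged_kernel /averaged_intensity !(step2_cell hP _ Px Py).
Qed.

Lemma cell_kernel_bounds : exists2 C, 0 <= C &
  forall d (i j : 'I_d), 0 <= cell_kernel i j <= C.
Proof.
have [C C0 [wC mC _]] := param_bounds hG; have H0 := normL1_exc_ge0 th.
exists (normL1_exc th * (C * C)) => [|d i j]; first by rewrite !mulr_ge0.
have /andP[p0 pC] := cellavg_bounds hP i j C0 (measurable_mimpactX hG) (mimpactX_ge0 hG) mC.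
have /andP[q0 qC] := cellavg_bounds hP i j C0 (measurable_weightX hG) (weightX_ge0 hG) wC.
rewrite /cell_kernel; apply/andP; split; first by apply: mulr_ge0 => //; exact: mulr_ge0.
by apply: ler_wpM2l => //; exact: ler_pM.
Qed.

Section fixed_partition.
Variables (d : nat) (dp : (0 < d)%N).

Local Notation cm := (cmass (@Pt d) (@cell_kernel d)).
Local Notation K := (averaged_kernel a b Q th Pt d).

Let mP := measurable_cell hP (d := d).
Let XP := cell_cover hP dp.

Lemma kop_averaged_kernel f (i : 'I_d) x : mu.-integrable X (EFin \o f) -> Pt i x ->
  kop mu X K f x = \sum_j cell_kernel i j * \int[mu]_(y in Pt j) f y.
Proof.
move=> fi Px; have [C C0 [_ /(_ d)[mk k0 kC]]] := kernels_bounded hG hP.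
rewrite /kop (Rintegral_cells mX mP (cell_disjoint hP (d:=d)) XP); last first.
  exact: (integrable_kernelM mX mk k0 kC).
apply: eq_bigr => j _; rewrite -RintegralZl//; last first.
  by apply: integrableS fi => //; exact: (cell_subset hP).
by apply: eq_Rintegral => y /[1!inE] Py; rewrite (averaged_kernel_cell Px Py).
Qed.

Lemma kiter_averaged n (i : 'I_d) x : Pt i x -> kiter mu X K n x = cm n i.
Proof.
have [C C0 [_ /(_ d)[mk k0 kC]]] := kernels_bounded hG hP.
elim: n i x => [|n IH] i x Px //=.
rewrite (kop_averaged_kernel _ Px); last exact: (integrable_kiter mX Xfin mk k0 kC).
apply: eq_bigr => j _; congr (_ * _).
rewrite (@eq_Rintegral _ _ _ mu (Pt j) (fun=> cm n j)); last by move=> y /[1!inE] /IH.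
by rewrite Rintegral_cst// mulrC.
Qed.

Lemma kmass_averaged n : kmass mu X K n = \sum_i fine (mu (Pt i)) * cm n i.
Proof.
have [C C0 [_ /(_ d)[mk k0 kC]]] := kernels_bounded hG hP.
rewrite /kmass (Rintegral_cells mX mP (cell_disjoint hP (d:=d)) XP); last first.
  exact: (integrable_kiter mX Xfin mk k0 kC).
apply: eq_bigr => i _; rewrite (@eq_Rintegral _ _ _ mu (Pt i) (fun=> cm n i)).
  by rewrite Rintegral_cst// mulrC.
by move=> x /[1!inE] Px; rewrite (kiter_averaged n Px).
Qed.

(** Cell values are obtained from masses by one more step, T^(n+1) 1 <= C a_n, hence the constant C
    A / r; the summand 1 covers n = 0. *)
Lemma averaged_resolvent (A r : R) : 0 < r -> 0 <= A ->
  (forall n, kmass mu X K n <= A * r ^+ n) ->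
  forall z, r < ComplexField.Normc.normc z ->
    resolvent_set X (Thom Q X (averaged (@Pt d) th)) z.
Proof.
move=> r0 A0 KA; have [C C0 kkC] := cell_kernel_bounds.
have cA0 : 0 <= 1 + C * A / r by rewrite addr_ge0// divr_ge0 ?mulr_ge0// ltW.
apply: (finite_rank_resolvent mX Xfin mP (cell_disjoint hP (d:=d)) XP (kk := @cell_kernel d)
  _ _ r0 cA0).
- by move=> i j; case/andP: (kkC d i j).
- move=> f i x fi Px; rewrite (Thom_averagedE hG hP)//; last exact: (cell_subset hP Px).
  exact: kop_averaged_kernel.
- case=> [|n] i /=; first by rewrite expr0 mulr1 lerDl divr_ge0 ?mulr_ge0// ltW.
  apply: (@le_trans _ _ (C * kmass mu X K n)).
    rewrite kmass_averaged mulr_sumr; apply: ler_sum => j _.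
    rewrite ler_wpM2r//; last by case/andP: (kkC d i j).
    rewrite mulr_ge0 ?fine_ge0// cmass_ge0// => p q.
    by case/andP: (kkC d p q).
  apply: (@le_trans _ _ (C * (A * r ^+ n))); first by rewrite ler_wpM2l.
  rewrite mulrDl mul1r exprS [_ / r * _]mulrA divfK ?gt_eqF// mulrA lerDr.
  by rewrite mulr_ge0 ?exprn_ge0// ltW.
Qed.

End fixed_partition.

End averaged_operator.

(** * Expected cluster sizes *)

Section countable_esum.
Context d (T : measurableType d) (R : realType) (I : countType).
Local Open Scope ereal_scope.

(** Enumeration of the countable index type, padded with 0, turns a sum over J into a series, to
    which monotone convergence applies. *)
Let unpickled (J : set I) (a : I -> \bar R) (n : nat) : \bar R :=
  if pickle_inv n is Some i then (if i \in J then a i else 0) else 0.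

Lemma esum_nneseries (J : set I) (a : I -> \bar R) : (forall i, 0 <= a i) ->
  \esum_(i in J) a i = \sum_(n <oo) unpickled J a n.
Proof.
move=> a0; have u0 n : 0 <= unpickled J a n.
  by rewrite /unpickled; case: pickle_inv => // i; case: ifPn.
rewrite nneseries_esumT// (esumID (pickle @` J) setT)//.
rewrite [X in _ = _ + X]esum1 ?adde0; last first.
  move=> n [_ nJ]; rewrite /unpickled; case E : (pickle_inv n) => [i|//].
  case: ifPn => //; rewrite inE => Ji; exfalso; apply: nJ; exists i => //.
  by have := @pickle_invK I n; rewrite E.
rewrite setTI (esum_image J (@pickle I) (unpickled J a)); last first.
  by move=> i j _ _; exact: (pcan_inj (@pickleK_inv I)).
by apply: eq_esum => i Ji; rewrite /unpickled pickleK_inv mem_set.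
Qed.

Variables (f : I -> T -> \bar R).
Hypotheses (mf : forall i, measurable_fun setT (f i)) (f0 : forall i x, 0 <= f i x).

Let munp J n : measurable_fun setT (fun x => unpickled J (f ^~ x) n).
Proof.
rewrite /unpickled; case: (pickle_inv n) => [i|]; last exact: measurable_cst.
by case: (i \in J); [exact: mf|exact: measurable_cst].
Qed.

Let unp0 J n x : 0 <= unpickled J (f ^~ x) n.
Proof. by rewrite /unpickled; case: pickle_inv => [i|//]; case: ifPn. Qed.

Lemma measurable_esum (J : set I) : measurable_fun setT (fun x => \esum_(i in J) f i x).
Proof.
rewrite (_ : (fun _ => _) = fun x => \sum_(n <oo) unpickled J (f ^~ x) n).
  by apply: ge0_emeasurable_sum => // n _; exact: munp.
by apply/funext => x; rewrite esum_nneseries.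
Qed.

Lemma integral_esum (mu : {measure set T -> \bar R}) (J : set I) :
  \int[mu]_x (\esum_(i in J) f i x) = \esum_(i in J) (\int[mu]_x f i x).
Proof.
rewrite [RHS]esum_nneseries; last by move=> i; exact: integral_ge0.
under eq_integral do rewrite esum_nneseries//.
rewrite integral_nneseries//.
apply: eq_eseriesr => n _; rewrite /unpickled; case: pickle_inv => [i|]; last by rewrite integral0.
by case: (i \in J) => //; rewrite integral0.
Qed.

End countable_esum.

Section poisson_moments.
Context {R : realType}.
Local Open Scope ereal_scope.

Lemma poisson_prob_sum (r : R) : \sum_(k <oo) poisson_prob r 0 [set k] = 1.
Proof.
rewrite -(@probability_setT _ _ _ (poisson_prob r 0)).
rewrite (_ : setT = \bigcup_k [set k]); last by apply/seteqP; split => // k _; exists k.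
rewrite measure_bigcup//; first by apply: eq_eseriesl => k; rewrite in_setT.
by move=> i j _ _ [k [-> ->]].
Qed.

Lemma poisson_prob_mean (r : R) : (0 <= r)%R ->
  \sum_(k <oo) k%:R%:E * poisson_prob r 0 [set k] = r%:E.
Proof.
move=> r0; have t0 k : 0 <= k%:R%:E * poisson_prob r 0 [set k].
  by rewrite mule_ge0// lee_fin.
rewrite nneseries_recl// mul0e add0e.
rewrite -(nneseries_addn 1%N)//.
(* At rate 0, [poisson_prob] is by definition the Dirac mass at 0; at positive rates the weights
   satisfy (k + 1) p_(k+1) = r p_k. *)
have [r0'|r0'] := ltP 0%R r; last first.
  have -> : r = 0%R by apply/eqP; rewrite eq_le r0 r0'.
  apply: eseries0 => k _ _; rewrite /poisson_prob ltxx diracE memNset ?mule0//=.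
  by rewrite addn1.
rewrite -[RHS]mule1 -(poisson_prob_sum r) -nneseriesZl//.
apply: eq_eseriesr => k _; rewrite /poisson_prob r0' !esum_set1 ?lee_fin ?poisson_pmf_ge0//.
rewrite -!EFinM /poisson_pmf r0' addn1 factS exprS natrM invfM; congr EFin.
have k0 : (k.+1%:R != 0 :> R)%R by rewrite pnatr_eq0.
have kf0 : (k`!%:R != 0 :> R)%R by rewrite pnatr_eq0 -lt0n fact_gt0.
by field; rewrite nat1r k0 kf0.
Qed.

(** The hypothesis gives the probabilities of the finite counts of a mixed Poisson variable. As the
    Poisson weights sum to 1, the count is almost surely finite, and its mean is the sum of k
    P(count = k). *)
Lemma poisson_count_mean d (O : measurableType d) (P : probability O R)
    (count : O -> \bar R) (mean : O -> R) :
  measurable_fun setT count -> (forall w, 0 <= count w) ->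
  measurable_fun setT mean -> (forall w, 0 <= mean w)%R ->
  (forall k, P [set w | count w = k%:R%:E] = \int[P]_w poisson_prob (mean w) 0 [set k]) ->
  \int[P]_w count w = \int[P]_w (mean w)%:E.
Proof.
move=> mc c0 mm m0 law; pose F k := [set w | count w = k%:R%:E].
have mF k : measurable (F k).
  by rewrite -[F k]setTI; exact: (mc measurableT _ (emeasurable_set1 k%:R%:E)).
have tF : trivIset setT F.
  by move=> i j _ _ [w []]; rewrite /F/= => -> -[] /eqP; rewrite eqr_nat => /eqP.
have mp k : measurable_fun setT (fun w => poisson_prob (mean w) 0 [set k]).
  rewrite (_ : (fun _ => _) = fun w =>
      if (0 < mean w)%R then (poisson_pmf (mean w) k)%:E else \d_0%N [set k]); last first.
    apply/funext => w; rewrite /poisson_prob; case: ifPn => // _.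
    by rewrite esum_set1// lee_fin poisson_pmf_ge0.
  apply: measurable_fun_ifT; last exact: measurable_cst.
    exact: measurable_fun_ltr.
  by apply/measurable_EFinP; exact: (measurableT_comp (measurable_poisson_pmf k measurableT) mm).
have PF : P (\bigcup_k F k) = 1.
  rewrite measure_bigcup//.
  rewrite (eq_eseriesl (Q := xpredT)); last by move=> k; rewrite in_setT.
  rewrite (eq_eseriesr (fun k _ => law k)) -integral_nneseries//.
  under eq_integral do rewrite poisson_prob_sum.
  by rewrite integral_cst// mul1e; exact: probability_setT.
have mUF : measurable (\bigcup_k F k) by exact: bigcupT_measurable.
have P0 : P (~` \bigcup_k F k) = 0 by rewrite probability_setC// PF subee.
rewrite (ge0_negligible_integral (measurableC mUF) measurableT mc _ P0)//.
rewrite setTD setCK ge0_integral_bigcup//; last first.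
  exact: measurable_funTS.
transitivity (\sum_(k <oo) \int[P]_w (k%:R%:E * poisson_prob (mean w) 0 [set k])).
  apply: eq_eseriesr => k _; rewrite ge0_integralZl//.
  rewrite (eq_integral (fun=> k%:R%:E)); last by move=> w /[1!inE].
  by rewrite integral_cst//; congr (_ * _); exact: law.
rewrite -integral_nneseries//.
- by apply: eq_integral => w _; rewrite poisson_prob_mean.
- by move=> k; apply: measurable_funeM.
- by move=> k w _; rewrite mule_ge0// lee_fin.
Qed.

End poisson_moments.

Section integral_transfer.
Context d1 d2 (T : measurableType d1) (Y : measurableType d2) (R : realType) (I : countType).
Variables (m : {measure set T -> \bar R}) (nu : {measure set Y -> \bar R}).
Variables (J : set I) (D : I -> set T) (pi : I -> T -> Y) (c : {nonneg R}).
Hypotheses (mD : forall i, measurable (D i)) (mpi : forall i, measurable_fun (D i) (pi i)).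
Variables (A : set Y) (y0 : Y).
Hypothesis mA : measurable A.
Hypothesis mass : forall B, measurable B -> B `<=` A ->
  (\esum_(i in J) m (D i `&` pi i @^-1` B) = c%:num%:E * nu B)%E.
Local Open Scope ereal_scope.

(* The boolean tag records membership in D i, so that the image measures are
   those of total functions. *)
Let phi i x : Y * bool := (if x \in D i then pi i x else y0, x \in D i).

Let mphi i : measurable_fun setT (phi i).
Proof.
have D1 : setT `&` (fun x => x \in D i) @^-1` [set true] = D i.
  by apply/seteqP; split => [x [_ /=]|x Dx]; [exact: set_mem|split=> //=; rewrite mem_set].
have mDi : measurable_fun setT (fun x => x \in D i).
  by apply: (measurable_fun_bool true); rewrite D1.
apply: measurable_fun_pair => //; apply: (measurable_fun_if measurableT mDi) => //.
by rewrite D1; exact: mpi.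
Qed.

Let image i : {measure set (Y * bool)%type -> \bar R} :=
  measure_function_pushforward__canonical__measure_function_Measure m (mphi i).

Let m_ n : {measure set (Y * bool)%type -> \bar R} :=
  if pickle_inv n is Some i then
    if i \in J then image i else mzero
  else mzero.

Variable f : Y -> \bar R.
Hypotheses (mf : measurable_fun A f) (f0 : forall y, A y -> 0 <= f y).

(* With I a singleton this computes integrals over product sets; with J a
   generation it integrates functions of the marks, whose law is Q whatever the
   cell. *)
Lemma integral_transfer :
  \esum_(i in J) (\int[m]_(x in D i `&` pi i @^-1` A) f (pi i x)) =
  c%:num%:E * \int[nu]_(y in A) f y.
Proof.
pose A1 : set (Y * bool) := A `*` [set true].
have mA1 : measurable A1 by exact: measurableX.
have mf1 : measurable_fun A1 (f \o fst).
  apply: (measurable_comp mA _ mf) => [_ [y [Ay _] <-]//|].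
  exact: measurable_funTS.
have f10 z : A1 z -> 0 <= (f \o fst) z by move=> [Az _]; exact: f0.
pose psi (y : Y) := (y, true).
have mpsi : measurable_fun setT psi by exact: measurable_fun_pair.
have mpull B : measurable B -> measurable (psi @^-1` B).
  by move=> mB; rewrite -[X in measurable X]setTI; exact: mpsi.
have phiE B i : B `<=` A1 -> phi i @^-1` B = D i `&` pi i @^-1` (psi @^-1` B).
  move=> BA; apply/seteqP; split => x /=; rewrite /phi /psi.
    case: ifPn => [/set_mem Dx Bx//|_ /BA [_ //]].
  by move=> [Dx Bx]; rewrite mem_set.
have psiA : psi @^-1` A1 = A by apply/seteqP; split => y //= [].
rewrite esum_nneseries; last by move=> i; apply: integral_ge0 => x [_ Ax]; exact: f0.
(* Both sides are integrals of f against a measure on [Y * bool]: the sum of the image measures, and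
   c times the image of nu. By [mass] they agree on the measurable subsets of [A1]. *)
transitivity (\int[mseries m_ 0]_(z in A1) (f \o fst) z).
  rewrite ge0_integral_measure_series//; apply: eq_eseriesr => n _; rewrite /m_.
  case: (pickle_inv n) => [i|]; last by rewrite integral_measure_zero.
  case: ifPn => _; last by rewrite integral_measure_zero.
  rewrite (ge0_integral_pushforward (mphi i))//; last by move=> z /[!inE]; exact: f10.
  rewrite phiE// psiA; apply: eq_integral => x /[!inE] -[Dx _].
  by rewrite /= /phi mem_set.
transitivity (\int[mscale c (
    measure_function_pushforward__canonical__measure_function_Measure nu mpsi)]_(z in A1)
      (f \o fst) z).
  apply: eq_measure_integral => B mB BA; rewrite /= /mscale /= /pushforward.
  rewrite -mass; [|exact: mpull|by move=> y /BA []].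
  rewrite esum_nneseries//; apply: eq_eseriesr => n _; rewrite /m_.
  case: (pickle_inv n) => [i|//]; case: ifPn => //= _.
  by rewrite /pushforward phiE.
rewrite ge0_integral_mscale//; congr (_ * _).
rewrite (ge0_integral_pushforward mpsi)//; last by move=> z /[!inE]; exact: f10.
by rewrite psiA.
Qed.
End integral_transfer.

Section offspring_integrals.
Context {R : realType}.
Local Open Scope ereal_scope.
Local Notation leb := (@lebesgue_measure R).

Let shift (s : R) : measurableTypeR R -> measurableTypeR R := fun t => (t - s)%R.

Let mshift s : measurable_fun setT (shift s).
Proof. exact: measurable_funB. Qed.

Lemma lebesgue_measure_shift (s : R) (A : set (measurableTypeR R)) : measurable A ->
  leb A = pushforward leb (fun t : measurableTypeR R => (t - s)%R : measurableTypeR R) A.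
Proof.
move=> mA.
pose nu : {measure set (measurableTypeR R) -> \bar R} :=
  measure_function_pushforward__canonical__measure_function_Measure leb (mshift s).
have h := @lebesgue_measure_unique R nu; apply: (h) => //.
move=> _ [[u v] _ <-]; rewrite /nu /= /pushforward.
rewrite (_ : _ @^-1` _ = `]u + s, v + s]%classic)%R; last first.
  by apply/seteqP; split => t /=; rewrite !in_itv/= ltrBrDr lerBlDr.
rewrite !lebesgue_measure_itv/= !lte_fin ltrD2r; case: ifPn => // _.
by rewrite -!EFinD opprD addrACA subrr addr0.
Qed.

Lemma integral_shift (f : R -> \bar R) (s : R) :
  measurable_fun (`[0%R, +oo[%classic : set (measurableTypeR R)) f ->
  (forall t, (0 <= t)%R -> 0 <= f t) ->
  \int[leb]_(t in `[s, +oo[) f (t - s)%R = \int[leb]_(t in `[0%R, +oo[) f t.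
Proof.
move=> mf f0.
transitivity (\int[pushforward leb (shift s)]_(t in `[0%R, +oo[) f t).
  rewrite (ge0_integral_pushforward (mshift s))//; last first.
    by move=> t /[!inE]; rewrite /= in_itv/= andbT; exact: f0.
  by congr integral; apply/seteqP; split => t /=; rewrite !in_itv/= !andbT subr_ge0.
by apply: eq_measure_integral => A mA _; apply/esym; exact: lebesgue_measure_shift.
Qed.

Context d1 d2 (T1 : measurableType d1) (T2 : measurableType d2).
Variables (m1 : {sigma_finite_measure set T1 -> \bar R}).
Variables (m2 : {sigma_finite_measure set T2 -> \bar R}).

(** The time marginal of the product measure on a cylinder is a multiple of Lebesgue measure, so
    that [integral_transfer] applies with a single index. *)
Lemma integral_cylinder (f : R -> \bar R) (A : set R) (B : set T1) (S : set T2) :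
  measurable A -> measurable B -> measurable S -> m1 B < +oo -> m2 S < +oo ->
  measurable_fun A f -> (forall t, A t -> 0 <= f t) ->
  \int[(leb \x m1) \x m2]_(e in A `*` B `*` S) f e.1.1 =
  m1 B * m2 S * \int[leb]_(t in A) f t.
Proof.
move=> mA mB mS B_fin S_fin mf f0.
have B0 := fine_ge0 (measure_ge0 m1 B); have S0 := fine_ge0 (measure_ge0 m2 S).
pose c : {nonneg R} := NngNum (mulr_ge0 B0 S0).
have cE : c%:num%:E = m1 B * m2 S.
  by rewrite /= EFinM !fineK// ge0_fin_numE.
pose time (e : measurableTypeR R * T1 * T2) : measurableTypeR R := e.1.1.
have strip C : setT `*` B `*` S `&` time @^-1` C = C `*` B `*` S.
  by apply/seteqP; split => [[[t y] w] [[[_ By] Sw] Ct]|[[t y] w] [[Ct By] Sw]].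
have mE : measurable_fun (setT `*` B `*` S) time.
  by apply: measurable_funTS; exact: (measurableT_comp measurable_fst measurable_fst).
have mD : measurable ((setT : set (measurableTypeR R)) `*` B `*` S).
  by do 2 apply: measurableX => //.
have h : forall C : set (measurableTypeR R), measurable C -> C `<=` A ->
    \esum_(_ in [set tt]) ((leb \x m1) \x m2) (setT `*` B `*` S `&` time @^-1` C) =
    c%:num%:E * leb C.
  move=> C mC _; rewrite esum_set1// strip cE.
  have mCB : measurable (C `*` B) by exact: measurableX.
  rewrite [LHS](product_measure1E (leb \x m1) m2 mCB mS).
  by rewrite [X in X * _](product_measure1E leb m1 mC mB) -muleA muleC.
have := @integral_transfer _ _ _ _ R unit ((leb \x m1) \x m2) leb [set tt]
  (fun=> setT `*` B `*` S) (fun=> time) c (fun=> mD) (fun=> mE) A 0%R mA h f mf f0.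
rewrite cE => <-; rewrite esum_set1 ?strip//.
by apply: integral_ge0 => e [[Ae _] _]; exact: f0.
Qed.
End offspring_integrals.

(** A word of length n + 1 is [rcons u k] for exactly one u of length n: each event of a generation
    is counted with its parent. *)
Lemma esum_words (R : realType) (n : nat) (f : seq nat -> \bar R) : (forall u, 0 <= f u)%E ->
  (\esum_(v in [set v : seq nat | size v = n.+1]) f v =
   \esum_(u in [set u : seq nat | size u = n]) \esum_(v in children u) f v)%E.
Proof.
move=> f0.
have -> : (\esum_(u in [set u : seq nat | size u = n]) \esum_(v in children u) f v =
    \esum_(u in [set u : seq nat | size u = n]) \esum_(k in [set: nat]) f (rcons u k))%E.
  by apply: eq_esum => u _; rewrite /children esum_image// => k l _ _; exact: rcons_injr.
rewrite esum_esum//.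
rewrite (reindex_esum ([set u : seq nat | size u = n] `*`` (fun=> [set: nat])) _
  (fun p : seq nat * nat => rcons p.1 p.2))//; split.
- by move=> [u k] /= [un _]; rewrite size_rcons un.
- by move=> [u k] [v l] _ _ /= /rcons_inj[-> ->].
- move=> v /= vn; case/lastP: v vn => // u k; rewrite size_rcons => -[un].
  by exists (u, k).
Qed.

(** * Mean sizes of the generations of a cluster *)

Section generations.
Variables (R : realType) (m : nat).
Context (dM : measure_display) (M : measurableType dM) (Q : probability M R).
Variables (X : set 'rV[R]_m) (th : hawkes_param R m M).
Context (dC : measure_display) (C : measurableType dC) (PC : probability C R).
Variables (Z : labelled_points C (hawkes_event R m M) (seq nat)) (x : 'rV[R]_m).
Hypothesis hZ : branching_cluster Q X th PC Z x.
Local Notation eventT := (hawkes_event R m M).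
Local Open Scope ereal_scope.

Let falls_in (u : seq nat) (A : set eventT) : set C := occurs Z u `&` pt Z u @^-1` A.

Let measurable_falls_in u A : measurable A -> measurable (falls_in u A).
Proof. by move=> mA; have := @measurable_pt _ _ _ _ _ Z u (measurable_occurs Z u) _ mA; exact. Qed.

Definition generation_mean (n : nat) (A : set eventT) : \bar R :=
  \esum_(u in [set u : seq nat | size u = n]) PC (occurs Z u `&` pt Z u @^-1` A).

Let count_inE J A w : count_in R Z J A w = \esum_(u in J) (\1_(falls_in u A) w)%:E.
Proof.
rewrite /count_in [RHS]esum_mkcond [LHS]esum_mkcond; apply: eq_esum => u _.
rewrite indicE; case: (boolP (u \in J)) => [/set_mem Ju|/negP nJ].
  case: (boolP (w \in falls_in u A)) => [/set_mem [Ow Aw]|/negP nw].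
    by rewrite mem_set.
  by rewrite memNset// => -[_ Ow Aw]; apply: nw; rewrite mem_set.
by rewrite memNset// => -[Ju _ _]; apply: nJ; rewrite mem_set.
Qed.

Let measurable_ind u A : measurable A ->
  measurable_fun setT (fun w => (\1_(falls_in u A) w)%:E : \bar R).
Proof.
move=> mA; apply/measurable_EFinP; apply: measurable_indic; exact: measurable_falls_in.
Qed.

Let integral_count_in J A : measurable A ->
  \int[PC]_w count_in R Z J A w = \esum_(u in J) PC (falls_in u A).
Proof.
move=> mA; under eq_integral do rewrite count_inE.
rewrite integral_esum//; first last.
- by move=> u; exact: measurable_ind.
- by apply: eq_esum => u _; rewrite integral_indic// ?setIT//; exact: measurable_falls_in.
Qed.

Lemma cluster_size_mean : \int[PC]_w cluster_size Z w =
  \sum_(n <oo) generation_mean n setT.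
Proof.
rewrite /cluster_size integral_count_in// nneseries_esumT; last by move=> n; exact: esum_ge0.
rewrite /generation_mean -esum_bigcupT//; last by move=> n k _ _ [u [/= <- <-]].
by congr esum; apply/seteqP; split => // u _; exists (size u).
Qed.

(** With a single parent and the trivial history, [cluster_branching] says that the number of its
    children in A is mixed Poisson; [poisson_count_mean] gives its mean. A real-valued F keeps
    [poisson_mass] on its finite branch. *)
Lemma generation_meanS n A (F : eventT -> R) : measurable A ->
  measurable_fun setT F -> (forall e, 0 <= F e)%R ->
  (forall e, offspring_intensity Q X th e A = (F e)%:E) ->
  generation_mean n.+1 A = \esum_(u in [set u : seq nat | size u = n])
    (\int[PC]_(w in occurs Z u) (F (pt Z u w))%:E).
Proof.
move=> mA mF F0 JF; rewrite /generation_mean esum_words//; apply: eq_esum => u un.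
rewrite -integral_count_in//.
pose mean w := (\1_(occurs Z u) w * F (pt Z u w))%R.
have meanE : mean = (F \o pt Z u) \_ (occurs Z u).
  apply/funext => w; rewrite patchE /mean indicE.
  by case: ifPn => _; rewrite ?mul1r ?mul0r.
rewrite (poisson_count_mean (mean := mean)).
- rewrite [RHS]integral_mkcond; apply: eq_integral => w _.
  by rewrite patchE /mean indicE; case: ifPn; rewrite ?mul1r ?mul0r.
- rewrite (_ : count_in _ _ _ _ = fun w => \esum_(v in children u) (\1_(falls_in v A) w)%:E).
    by apply: measurable_esum => // v; exact: measurable_ind.
  by apply/funext => w; exact: count_inE.
- by move=> w; exact: esum_ge0.
- rewrite meanE; apply/(measurable_restrictT _ (measurable_occurs Z u)).
  exact: (measurableT_comp mF (@measurable_pt _ _ _ _ _ Z u)).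
- by move=> w; rewrite mulr_ge0.
- move=> k; have hT : gen_history Z n setT.
    by move=> S [[S0 SC _] _]; rewrite -(setD0 setT); exact: SC.
  have dis (i j : 'I_1) : i != j -> u = u -> A `&` A = set0 by rewrite !ord1 eqxx.
  have := cluster_branching hZ (r := 1) (u := fun=> u) (A := fun=> A) (fun=> k) hT
    (fun=> un) (fun=> mA) dis.
  rewrite setTI (_ : \bigcap__ _ = [set w | count_in R Z (children u) A w = k%:R%:E]); last first.
    by apply/seteqP; split => w; [move=> /(_ ord0 I)|move=> h i _].
  move=> ->; apply: eq_integral => w _; rewrite big_ord1 JF -EFinM.
  by [].
Qed.
End generations.

Section averaged_cluster.
Variables (R : realType) (m : nat) (a b : 'rV[R]_m).
Context (dM : measure_display) (M : measurableType dM) (Q : probability M R).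
Variable th : hawkes_param R m M.
Variable Pt : forall d : nat, 'I_d -> set 'rV[R]_m.
Local Notation E := 'rV[R]_m.
Local Notation mu := (lebm R m).
Local Notation leb := (@lebesgue_measure R).
Local Notation X := (box a b).
Local Notation eventT := (hawkes_event R m M).
Hypothesis hG : graphon_assumptions Q X th.
Hypothesis hP : hyperrect_partitions X Pt.
Variables (d : nat) (dp : (0 < d)%N).

Local Notation tht := (averaged (@Pt d) th).

Let mP (i : 'I_d) : measurable (Pt i) := measurable_cell hP i.

Let in_cell y : X y -> exists j, Pt (d := d) j y.
Proof. by rewrite -(cell_cover hP dp) => -[j _ Pj]; exists j. Qed.

Definition cell_events (i : 'I_d) (S : set M) : set eventT := setT `*` Pt i `*` S.

Definition outer_events : set eventT := setT `*` (~` X) `*` setT.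

Lemma measurable_cell_events i S : measurable S -> measurable (cell_events i S).
Proof. by move=> mS; do 2 apply: measurableX => //. Qed.

Lemma measurable_outer_events : measurable outer_events.
Proof.
by do 2 apply: measurableX => //; apply: measurableC; exact: measurable_box.
Qed.

(* An event in cell j with mark w has a Poisson number of children in cell i,
   with mean cell_rate i j times the averaged impact of w. *)
Definition cell_rate (i j : 'I_d) : R :=
  normL1_exc th * fine (mu (Pt i)) * cellavg Pt i j (weightX a b th).

Definition offspring_rate (i : 'I_d) (e : eventT) : R :=
  \sum_j \1_(Pt j) e.1.2 * (cell_rate i j * cellavg Pt i j (impact th e.2)).

Let measurable_exc : measurable_fun (`[0, +oo[%classic : set (measurableTypeR R)) (EFin \o exc th).
Proof. exact: measurable_int (exc_L1 hG). Qed.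

Lemma integral_exc : (\int[leb]_(t in `[0%R, +oo[) (exc th t)%:E = (normL1_exc th)%:E)%E.
Proof.
rewrite /normL1_exc /Rintegral fineK.
  apply: eq_integral => t /[!inE]/=; rewrite in_itv/= andbT => t0.
  by rewrite ger0_norm// (exc_ge0 hG).
have := integrable_fin_num _ (integrable_abse (exc_L1 hG)); apply.
exact: measurable_itv.
Qed.

Lemma cellavg_weight (i j : 'I_d) : cellavg Pt i j (weight th) = cellavg Pt i j (weightX a b th).
Proof. by apply: (eq_cellavg hP) => x y Xx Xy; rewrite weightXE. Qed.

Lemma cellavg_impact_ge0 (i j : 'I_d) w : 0 <= cellavg Pt i j (impact th w).
Proof.
have V0 := fine_ge0 (measure_ge0 (mu \x mu)%E (Pt i `*` Pt j)).
rewrite /cellavg /average divr_ge0//.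
rewrite Rintegral_ge0// => -[x y] [/= Px Py].
by apply: (impact_ge0 hG); [exact: (cell_subset hP Px)|exact: (cell_subset hP Py)].
Qed.

Lemma cellavg_weight_ge0 (i j : 'I_d) : 0 <= cellavg Pt i j (weightX a b th).
Proof.
have V0 := fine_ge0 (measure_ge0 (mu \x mu)%E (Pt i `*` Pt j)).
rewrite /cellavg /average divr_ge0//.
by rewrite Rintegral_ge0// => z _; exact: (weightX_ge0 hG).
Qed.

Lemma cell_rate_ge0 i j : 0 <= cell_rate i j.
Proof.
by rewrite mulr_ge0 ?cellavg_weight_ge0// mulr_ge0 ?normL1_exc_ge0 ?fine_ge0.
Qed.

Lemma offspring_rate_cell i j (e : eventT) : Pt j e.1.2 ->
  offspring_rate i e = cell_rate i j * cellavg Pt i j (impact th e.2).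
Proof.
move=> Pj; rewrite /offspring_rate (bigD1 j)//= indicE mem_set// mul1r big1 ?addr0//.
move=> k kj; rewrite indicE memNset ?mul0r// => Pk; move/eqP: kj; apply.
by apply: (cell_disjoint hP (d := d)) => //; exists e.1.2.
Qed.

Lemma offspring_rate_out i (e : eventT) : ~ X e.1.2 -> offspring_rate i e = 0.
Proof.
move=> nX; rewrite /offspring_rate big1// => j _; rewrite indicE memNset ?mul0r//.
by move=> Pj; apply: nX; exact: (cell_subset hP Pj).
Qed.

(** On a pair of cells the averaged parameters are constant, so the intensity depends on time alone
    and the integral factors over time, cell and marks; translation by s turns the time integral
    into the norm of h. A parent outside X has no offspring, and both sides vanish. *)
Lemma offspring_intensity_cell i S (e : eventT) : measurable S ->
  (offspring_intensity Q X tht e (cell_events i S) = (offspring_rate i e)%:E * Q S)%E.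
Proof.
move=> mS; case: e => -[s y] w; rewrite /offspring_intensity.
rewrite (_ : _ `&` _ = `[s, +oo[%classic `*` Pt i `*` S); last first.
  apply/seteqP; split => [[[t z] v] /= [[[_ Pz] Sv] [st _]]|[[t z] v] /= [[st Pz] Sv]].
    by rewrite in_itv/= st.
  by move: st; rewrite in_itv/= andbT => st; do !split => //; exact: (cell_subset hP Pz).
case: (pselect (X y)) => [/in_cell[j Pj]|nX]; last first.
  rewrite offspring_rate_out// mul0e integral0_eq// => -[[t z] v] _ /=.
  by rewrite (step2_out hP) ?mul0r// => -[].
rewrite (@offspring_rate_cell i j)//.
pose k := cellavg Pt i j (impact th w) * cellavg Pt i j (weightX a b th).
have k0 : 0 <= k by rewrite mulr_ge0 ?cellavg_impact_ge0 ?cellavg_weight_ge0.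
pose f (t : R) : \bar R := (k%:E * (exc th (t - s))%:E)%E.
have mexc : measurable_fun (`[s, +oo[%classic : set (measurableTypeR R))
    (fun t => (exc th (t - s))%:E).
  apply: (measurable_comp _ _ measurable_exc) => //.
    by move=> _ [t /= + <-]; rewrite !in_itv/= !andbT subr_ge0.
  by apply: measurable_funTS; exact: measurable_funB.
have exc0 t : `[s, +oo[%classic t -> (0 <= (exc th (t - s))%:E)%E.
  by rewrite /= in_itv/= andbT lee_fin => st; apply: (exc_ge0 hG); rewrite subr_ge0.
transitivity (\int[(leb \x mu) \x Q]_(e in `[s, +oo[%classic `*` Pt i `*` S) f e.1.1)%E.
  apply: eq_integral => -[[t z] v] /[!inE] -[[_ Pz] _] /=.
  by rewrite !(step2_cell hP _ Pz Pj) cellavg_weight EFinM.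
have Pi_fin : (mu (Pt i) < +oo)%E.
  apply: le_lt_trans (lebm_box_lty a b); apply: le_measure; rewrite ?inE//.
    exact: measurable_box.
  exact: (cell_subset hP).
have QS_fin : (Q S < +oo)%E by apply: le_lt_trans (probability_le1 Q mS) _; rewrite ltry.
rewrite (integral_cylinder (A := `[s, +oo[%classic) (f := f) _ (mP i) mS)//; first last.
- by move=> t st; rewrite mule_ge0// exc0.
- exact: measurable_funeM.
rewrite ge0_integralZl// (integral_shift s measurable_exc); last first.
  by move=> t t0; rewrite lee_fin (exc_ge0 hG).
rewrite integral_exc -[mu (Pt i)]fineK ?ge0_fin_numE// muleAC -!EFinM.
by congr (_%:E * _)%E; rewrite /cell_rate /k /=; ring.
Qed.

Lemma offspring_intensity_outer (e : eventT) :
  offspring_intensity Q X tht e outer_events = 0%E.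
Proof.
case: e => -[s y] w; rewrite /offspring_intensity (_ : _ `&` _ = set0) ?integral_set0//.
by apply/seteqP; split => // -[[t z] v] /= [[[_ nX] _] []].
Qed.

Section cluster_means.
Context (dC : measure_display) (C : measurableType dC) (PC : probability C R).
Variables (Z : labelled_points C eventT (seq nat)) (x : E).
Hypotheses (hZ : branching_cluster Q X tht PC Z x) (Xx : X x).
Local Open Scope ereal_scope.

Local Notation gen := (generation_mean PC Z).

(** Expected number of events of generation n in the cell i. Divided by the volume of the cell it
    obeys the recursion of [cmass]; only the start differs, a point mass at x in place of the
    function 1. *)
Fixpoint cell_mean (n : nat) (i : 'I_d) : R :=
  if n is n'.+1 then (\sum_j fine (mu (Pt i)) * cell_kernel a b Q th Pt i j * cell_mean n' j)%R
  else \1_(Pt i) x.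

Let kk0 (i j : 'I_d) : (0 <= cell_kernel a b Q th Pt i j)%R.
Proof. by have [c _ /(_ d i j)/andP[]] := cell_kernel_bounds hG hP. Qed.

Lemma cell_mean_ge0 n i : (0 <= cell_mean n i)%R.
Proof.
elim: n i => [|n IH] i /=; first by rewrite indicE.
apply: sumr_ge0 => j _; apply: mulr_ge0; last exact: IH.
by apply: mulr_ge0; [exact: fine_ge0|exact: kk0].
Qed.

Lemma generation_mean0 A : gen 0 A = PC (pt Z [::] @^-1` A).
Proof.
rewrite /generation_mean (_ : [set u : seq nat | size u = 0%N] = [set [::]]); last first.
  by apply/seteqP; split => [[]|u ->].
by rewrite esum_set1// (cluster_root hZ) setTI.
Qed.

Lemma generation_mean_outer n : gen n outer_events = 0.
Proof.
case: n => [|n].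
  rewrite generation_mean0 (_ : _ @^-1` _ = set0) ?measure0//.
  apply/seteqP; split => // w; rewrite /outer_events /= (cluster_root_pos hZ w)/=.
  by case; case.
rewrite (generation_meanS hZ n (F := fun=> 0%R))//; last first.
- exact: offspring_intensity_outer.
- exact: measurable_outer_events.
- by rewrite esum1// => u _; rewrite integral0.
Qed.

Let offspring_term (i j : 'I_d) (e : eventT) : R :=
  (\1_(Pt j) e.1.2 * (cell_rate i j * cellavg Pt i j (impact th e.2)))%R.

Let measurable_offspring_term i j : measurable_fun setT (offspring_term i j).
Proof.
apply: measurable_funM.
  have mI : measurable_fun setT (\1_(Pt j) : E -> R) by exact: measurable_indic.
  exact: (measurableT_comp mI (measurableT_comp measurable_snd measurable_fst)).
apply: measurable_funM => //.
exact: (measurableT_comp (measurable_cellavg_impact hG hP i j) measurable_snd).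
Qed.

Let offspring_term_ge0 i j e : (0 <= offspring_term i j e)%R.
Proof. by rewrite mulr_ge0// mulr_ge0// ?cell_rate_ge0// cellavg_impact_ge0. Qed.

Lemma measurable_offspring_rate i : measurable_fun setT (offspring_rate i).
Proof. by apply: measurable_sum => j; exact: measurable_offspring_term. Qed.

Lemma offspring_rate_ge0 i (e : eventT) : (0 <= offspring_rate i e)%R.
Proof.
by apply: sumr_ge0 => j _; exact: offspring_term_ge0.
Qed.

(** The set S of marks is carried along because the offspring rate of an event depends on its mark:
    knowing that the marks in each cell have law Q, one may integrate this rate over a generation,
    and the mean impact appears by [mean_cellavg]. *)
Lemma generation_mean_cell n i S : measurable S ->
  gen n (cell_events i S) = (cell_mean n i)%:E * Q S.
Proof.
elim: n i S => [|n IH] i S mS.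
  rewrite generation_mean0 /= indicE; case: (boolP (x \in Pt i)) => [/set_mem Px|nPx].
    rewrite mul1e -(cluster_root_mark hZ mS); congr (PC _).
    apply/seteqP; split => w; rewrite /cell_events /= (cluster_root_pos hZ w)/=; first by case.
    by [].
  rewrite mul0e (_ : _ @^-1` _ = set0) ?measure0//; apply/seteqP; split => // w.
  rewrite /cell_events /= (cluster_root_pos hZ w)/= => -[[_ Px] _].
  by move/negP: nPx; apply; rewrite mem_set.
have QS0 : (0 <= fine (Q S))%R by rewrite fine_ge0.
have QSE : (fine (Q S))%:E = Q S.
  by rewrite fineK// fin_num_measure.
rewrite (generation_meanS hZ n (F := fun e => offspring_rate i e * fine (Q S))%R); last 4 first.
- exact: measurable_cell_events.
- by apply: measurable_funM => //; exact: measurable_offspring_rate.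
- by move=> e; rewrite mulr_ge0// offspring_rate_ge0.
- by move=> e; rewrite offspring_intensity_cell// EFinM QSE.
pose f j v : \bar R := (cell_rate i j * fine (Q S) * cellavg Pt i j (impact th v))%:E.
have mf j : measurable_fun setT (f j).
  apply/measurable_EFinP; apply: measurable_funM => //.
  exact: (measurable_cellavg_impact hG hP).
have f0 j v : 0 <= f j v.
  by rewrite lee_fin mulr_ge0 ?cellavg_impact_ge0// mulr_ge0 ?cell_rate_ge0.
pose D j u := occurs Z u `&` pt Z u @^-1` cell_events j setT.
have mD j u : measurable (D j u).
  have := @measurable_pt _ _ _ _ _ Z u (measurable_occurs Z u) _
    (measurable_cell_events j measurableT).
  exact.
have mpt u : measurable_fun (occurs Z u) (fun w => (pt Z u w).2).
  exact: (measurableT_comp measurable_snd (@measurable_pt _ _ _ _ _ Z u)).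
transitivity (\esum_(u in [set u : seq nat | size u = n])
    \sum_j \int[PC]_(w in D j u) f j (pt Z u w).2).
  apply: eq_esum => u _.
  transitivity (\int[PC]_(w in occurs Z u)
      \sum_j (offspring_term i j (pt Z u w) * fine (Q S))%:E).
    by apply: eq_integral => w _; rewrite /offspring_rate mulr_suml -sumEFin.
  rewrite ge0_integral_sum//; last 3 first.
  - exact: measurable_occurs.
  - move=> j; apply/measurable_EFinP; apply: measurable_funM => //.
    exact: (measurableT_comp (measurable_offspring_term i j) (@measurable_pt _ _ _ _ _ Z u)).
  - by move=> j w _; rewrite lee_fin mulr_ge0.
  apply: eq_bigr => j _; rewrite [RHS]integral_mkcondr; apply: eq_integral => w _.
  rewrite patchE /offspring_term indicE /f.
  case: (boolP (w \in _)) => [/set_mem [[_ /= Pj] _]|nw].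
    by rewrite mem_set// mul1r mulrAC.
  by rewrite memNset ?mul0r// => Pj; move/negP: nw; apply; rewrite mem_set.
rewrite esum_sum; last by move=> u j _ _; exact: integral_ge0.
rewrite /= -sumEFin ge0_sume_distrl; last first.
  move=> j _; rewrite lee_fin; apply: mulr_ge0; last exact: cell_mean_ge0.
  by apply: mulr_ge0; [exact: fine_ge0|exact: kk0].
apply: eq_bigr => j _.
pose c : {nonneg R} := NngNum (cell_mean_ge0 n j).
transitivity (c%:num%:E * \int[Q]_(v in setT) f j v); last first.
  rewrite /f; under eq_integral do rewrite EFinM.
  rewrite ge0_integralZl//=; last 3 first.
  - by apply/measurable_EFinP; exact: (measurable_cellavg_impact hG hP).
  - by move=> v _; rewrite lee_fin cellavg_impact_ge0.
  - by rewrite lee_fin mulr_ge0// cell_rate_ge0.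
  rewrite (mean_cellavg hG hP) -QSE -!EFinM /cell_kernel /cell_rate; congr EFin; ring.
have mass B : measurable B -> B `<=` setT ->
    \esum_(u in [set u : seq nat | size u = n]) PC (D j u `&` (fun w => (pt Z u w).2) @^-1` B) =
    c%:num%:E * Q B.
  move=> mB _; rewrite -IH//; apply: eq_esum => u _; congr (PC _).
  by apply/seteqP; split => w; rewrite /D /cell_events /=; tauto.
(* An outcome exists since [PC] has mass 1; the mark of the root there serves as the default point
   of [integral_transfer]. *)
have [w0 _] : [set: C] !=set0.
  apply/set0P/eqP => C0; have := probability_setT PC.
  by rewrite C0 measure0 => -[] /esym/eqP; rewrite oner_eq0.
have := @integral_transfer _ _ C M R (seq nat) PC Q [set u | size u = n] (D j)
  (fun u w => (pt Z u w).2) c (mD j) _ setT (pt Z [::] w0).2 measurableT mass (f j) (mf j).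
move=> <-//.
  by apply: eq_esum => u _; rewrite preimage_setT setIT.
by move=> u; apply: (measurable_funS (measurable_occurs Z u) _ (mpt u)) => w [].
Qed.

(** The cluster is not confined to X outcome by outcome, so events outside X are counted separately
    as [outer_events]; their mean is 0. *)
Lemma generation_mean_setT n : gen n setT <= (\sum_i cell_mean n i)%:E.
Proof.
have mev u A : measurable A -> measurable (occurs Z u `&` pt Z u @^-1` A).
  move=> mA; have := @measurable_pt _ _ _ _ _ Z u (measurable_occurs Z u) _ mA; exact.
apply: (@le_trans _ _ (\sum_i gen n (cell_events i setT) + gen n outer_events)); last first.
  rewrite generation_mean_outer adde0 -sumEFin; apply: lee_sum => i _.
  by rewrite generation_mean_cell// [Q setT]probability_setT mule1.
rewrite /generation_mean -esum_sum// -esumD//; last by move=> u _; exact: sume_ge0.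
apply: le_esum => u _.
pose ev A := occurs Z u `&` pt Z u @^-1` A.
have mi A : measurable A -> measurable_fun setT (fun w => (\1_(ev A) w)%:E : \bar R).
  by move=> mA; apply/measurable_EFinP; apply: measurable_indic; exact: mev.
have PE A : measurable A -> PC (ev A) = \int[PC]_w (\1_(ev A) w)%:E.
  by move=> mA; rewrite integral_indic ?setIT//; exact: mev.
have mT := @measurableT _ eventT.
rewrite (PE setT)// (PE outer_events); last exact: measurable_outer_events.
under eq_bigr => i _ do rewrite (PE _ (measurable_cell_events i measurableT)).
rewrite -ge0_integral_sum//; last by move=> i; apply: mi; exact: measurable_cell_events.
rewrite -ge0_integralD//; first last.
- exact: (mi _ measurable_outer_events).
- by apply: emeasurable_sum => i; apply: mi; exact: measurable_cell_events.
- by move=> w _; exact: sume_ge0.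
apply: ge0_le_integral => //.
- exact: mi.
- apply: emeasurable_funD; last exact: (mi _ measurable_outer_events).
  by apply: emeasurable_sum => i; apply: mi; exact: measurable_cell_events.
move=> w _; rewrite indicE; case: (boolP (w \in ev setT)) => [/set_mem [Ow _]|_]; last first.
  by rewrite adde_ge0// sume_ge0.
case: (pselect (X (pt Z u w).1.2)) => [/in_cell[j Pj]|nX]; last first.
  by rewrite [X in _ <= _ + X%:E]indicE mem_set ?leeDr ?sume_ge0.
rewrite (bigD1 j)//= indicE mem_set//.
by rewrite -addeA leeDl// adde_ge0// sume_ge0.
Qed.

Variable c : R.
Hypotheses (c0 : (0 <= c)%R) (kkc : forall i j : 'I_d, (cell_kernel a b Q th Pt i j <= c)%R).

(** The first generation of the point mass at x has density at most c, wherever x lies; from then on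
    positivity compares each generation with c T^n 1. *)
Lemma cell_mean_le n i :
  (cell_mean n.+1 i <= c * (fine (mu (Pt i)) *
     cmass (@Pt d) (@cell_kernel _ _ a b _ _ Q th Pt d) n i))%R.
Proof.
have mu0 (j : 'I_d) : (0 <= fine (mu (Pt j)))%R by exact: fine_ge0.
elim: n i => [|n IH] i.
  have [k Pk] := in_cell Xx; rewrite /= (bigD1 k)//= big1 ?addr0; last first.
    move=> l lk; rewrite indicE memNset ?mulr0// => Pl; move/eqP: lk; apply.
    by apply: (cell_disjoint hP (d := d)) => //; exists x.
  by rewrite indicE mem_set// !mulr1 mulrC ler_wpM2r.
apply: (@le_trans _ _ (\sum_j fine (mu (Pt i)) * cell_kernel a b Q th Pt i j *
    (c * (fine (mu (Pt j)) * cmass (@Pt d) (@cell_kernel _ _ a b _ _ Q th Pt d) n j)))%R).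
  apply: ler_sum => j _; apply: ler_wpM2l (IH j).
  by apply: mulr_ge0; [exact: mu0|exact: kk0].
rewrite [in leRHS]/= !mulr_sumr; apply: ler_sum => j _.
by rewrite le_eqVlt; apply/orP; left; apply/eqP; ring.
Qed.

Variables (A r : R).
Hypotheses (A0 : (0 <= A)%R) (r01 : (0 <= r < 1)%R).

Hypothesis growth : forall n, (kmass mu X (averaged_kernel a b Q th Pt d) n <= A * r ^+ n)%R.

(** The root contributes 1, and generation n + 1 at most c a_n <= c A r^n. *)
Lemma cluster_mean_le : \int[PC]_w cluster_size Z w <= (1 + c * A / (1 - r))%:E.
Proof.
have g0 k : 0 <= gen k setT by exact: esum_ge0.
rewrite (cluster_size_mean PC Z) nneseries_recl//.
rewrite EFinD; apply: leeD.
  by rewrite generation_mean0 preimage_setT probability_setT.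
rewrite -(nneseries_addn 1%N)//.
apply: (@le_trans _ _ (\sum_(n <oo) (\sum_i cell_mean n.+1 i)%:E)).
  by apply: lee_nneseries => n // _; rewrite addn1 generation_mean_setT.
apply: nneseries_geometric_le => // [|n]; first exact: mulr_ge0.
rewrite sumr_ge0 => [/=|i _]; last exact: cell_mean_ge0.
apply: (@le_trans _ _ (c * kmass mu X (averaged_kernel a b Q th Pt d) n)%R).
  rewrite (kmass_averaged hG hP dp) mulr_sumr; apply: ler_sum => i _.
  exact: cell_mean_le.
by rewrite -mulrA ler_wpM2l.
Qed.

End cluster_means.

End averaged_cluster.

(** * Spectral radius bounds and conclusion *)

Section stability.
Variables (R : realType) (m : nat) (a b : 'rV[R]_m).
Context (dM : measure_display) (M : measurableType dM) (Q : probability M R).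
Variable th : hawkes_param R m M.
Variable Pt : forall d : nat, 'I_d -> set 'rV[R]_m.
Local Notation mu := (lebm R m).
Local Notation X := (box a b).
Hypothesis hP : hyperrect_partitions X Pt.

Lemma integral_averaged_base_lty d :
  (\int[mu]_(x in X) (base (averaged (@Pt d) th) x)%:E < +oo)%E.
Proof.
have mX : measurable X := measurable_box a b.
have mstep : measurable_fun setT (base (averaged (@Pt d) th)).
  apply: measurable_sum => i; apply: measurable_funM => //.
  by apply: measurable_indic; exact: (measurable_cell hP).
rewrite ltey_eq; apply/orP; left; apply: (integrable_fin_num mX).
apply: (@bounded_integrable _ _ _ _ _ mX (lebm_box_lty a b)
  (base (averaged (@Pt d) th)) (\sum_i `|average mu (@Pt d i) (base th)|)).
  exact: measurable_funTS.
move=> x _; apply: le_trans (ler_norm_sum _ _ _) _; apply: ler_sum => i _.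
by rewrite normrM indicE; case: (_ \in _); rewrite ?normr1 ?mul1r// normr0 mul0r.
Qed.

(** The supremum over an empty spectrum would be -oo. Since 0 belongs to the spectrum, rho is
    nonnegative, and with rho < 1 it is a real number. *)
Lemma rho_hom_ge0 : (0 < m)%N -> (forall k, a ord0 k < b ord0 k) ->
  graphon_assumptions Q X th -> (0 <= rho_hom Q X th)%E.
Proof.
move=> m0 ab hG; apply: ereal_sup_ubound; exists 0; last first.
  by rewrite /ComplexField.Normc.normc /= expr0n addr0 sqrtr0.
have [C C0 [[mk k0 kC] _]] := kernels_bounded hG hP.
apply: (zero_in_spectrum (measurable_box a b) (lebm_box_lty a b) mk k0 kC).
- by move=> f fi x Xx; exact: (ThomE hG hP).
- by move=> e e0; exact: box_small_subset.
Qed.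

Lemma resolvent_above_rho_hom r (s : R) : rho_hom Q X th = r%:E -> 0 <= s -> r < s ->
  resolvent_set X (Thom Q X th) (Complex s 0).
Proof.
move=> rhoE s0 rs; apply: contrapT => ns.
have : ((ComplexField.Normc.normc (Complex s 0))%:E <= rho_hom Q X th)%E.
  by apply: ereal_sup_ubound; exists (Complex s 0).
by rewrite rhoE lee_fin /= expr0n addr0 sqrtr_sqr ger0_norm// leNgt rs.
Qed.

End stability.

Theorem lemma2 (R : realType) (m : nat) (a b : 'rV[R]_m)
    (dM : measure_display) (M : measurableType dM) (Q : probability M R)
    (th : hawkes_param R m M)
    (Pt : forall d : nat, 'I_d -> set 'rV[R]_m)
    (dO : measure_display) (O : measurableType dO) (P : probability O R)
    (N : labelled_points O (hawkes_event R m M) nat)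
    (Nt : nat -> labelled_points O (hawkes_event R m M) nat) :
  let X := box a b in
  let tht := fun d => averaged (Pt d) th in
  let rho := rho_hom Q X th in
  let delta : R := (1 - fine rho) / 2 in
  (0 < m)%N ->
  (forall k, a ord0 k < b ord0 k) ->
  graphon_assumptions Q X th ->
  hyperrect_partitions X Pt ->
  hawkes_process Q X th P N ->
  (forall d, (0 < d)%N -> hawkes_process Q X (tht d) P (Nt d)) ->
  stable Q X th ->
  (exists D' : nat, forall d, (0 < d)%N -> (D' <= d)%N ->
    stable Q X (tht d) /\
    (rho_hom Q X (tht d) <= rho + delta%:E)%E /\ (rho + delta%:E < 1)%E) /\
  (exists (D : nat) (K : R), forall d, (0 < d)%N -> (D <= d)%N ->
    forall x, X x ->
    forall (dC : measure_display) (C : measurableType dC) (PC : probability C R)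
      (Z : labelled_points C (hawkes_event R m M) (seq nat)),
    branching_cluster Q X (tht d) PC Z x ->
    (\int[PC]_w cluster_size Z w <= K%:E)%E).
Proof.
move=> X tht rho delta m0 ab hG hP _ _ [_ rho1].
have rho0 : (0 <= rho)%E by exact: (rho_hom_ge0 hP).
have rhoE : rho = (fine rho)%:E.
  by rewrite fineK// ge0_fin_numE//; apply: lt_le_trans rho1 _; rewrite leey.
have fr0 : 0 <= fine rho by exact: fine_ge0.
have fr1 : fine rho < 1 by rewrite -lte_fin -rhoE.
have delta0 : 0 < delta by rewrite divr_gt0// subr_gt0.
pose r := fine rho + delta; have r1 : r < 1 by rewrite /r /delta; lra.
have [D [A [A0 growth]]] : exists D A, 0 <= A /\ forall d, (0 < d)%N -> (D <= d)%N ->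
    forall n, kmass (lebm R m) X (averaged_kernel a b Q th Pt d) n <= A * r ^+ n.
  (* Half of delta puts q above rho, where the real axis lies in the resolvent set; the other half
     is the loss of rate in passing to the averaged kernels. *)
  apply: (averaged_growth hG hP (q := fine rho + delta / 2)); [lra|rewrite /r; lra|].
  by move=> s qs; apply: (resolvent_above_rho_hom rhoE); lra.
have [C C0 kC] := cell_kernel_bounds hG hP.
have rho_averaged d : (0 < d)%N -> (D <= d)%N -> (rho_hom Q X (tht d) <= r%:E)%E.
  move=> d0 Dd; apply: ge_ereal_sup => _ [z zs <-]; rewrite lee_fin leNgt; apply/negP => rz.
  by apply: zs; apply: (averaged_resolvent hG hP d0 _ A0 (growth d d0 Dd) rz); rewrite ltr_pwDr.
split.
  exists D => d d0 Dd; have h := rho_averaged d d0 Dd; split.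
    split; first exact: integral_averaged_base_lty.
    by apply: le_lt_trans h _; rewrite lte_fin.
  by rewrite rhoE -EFinD lte_fin.
exists D, (1 + C * A / (1 - r)) => d d0 Dd x Xx dC O' PC Z hZ.
apply: (cluster_mean_le hG hP d0 hZ Xx C0 _ A0 _ (growth d d0 Dd)).
- by move=> i j; case/andP: (kC d i j).
- by rewrite r1 andbT addr_ge0// ltW.
Qed.
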